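(* Let $X$ be a centered random element of $H$, let $x_0\in H$ be fixed, and assume $\mathbf{A}_1$ and $\mathbf{A}_2$ (stated in the context). For $h>0$ let $$\Gamma_K=\Gamma_K(h)=\mathbb{E}\left(K\left(\frac{\|X-x_0\|}{h}\right)\,(X-x_0)\otimes(X-x_0)\right).$$ When $h\to 0$ the operator $\Gamma_K(h)$ tends to zero, and for all fixed $i,j\in\mathbb{N}$, as $h\to0$, $$\langle \Gamma_K(h)e_i,e_j\rangle\sim v(h)\,\delta_{i,j}+w(h)\,\mathcal{R}_{ij},$$ where $\delta_{i,j}$ is the Kronecker symbol, $v(h)$ and $w(h)$ are the nonnegative quantities $$v(h)=\mathbb{E}\left(K\left(\tfrac{\|X-x_0\|}{h}\right)\|X-x_0\|\,\rho(\|X-x_0\|)\right),\qquad w(h)=\mathbb{E}\left(K\left(\tfrac{\|X-x_0\|}{h}\right)\|X-x_0\|^2\rho^2(\|X-x_0\|)\right),$$ and $$\mathcal{R}_{ii}=\frac{f_i''(\langle x_0,e_i\rangle)}{f_i(\langle x_0,e_i\rangle)},\qquad \mathcal{R}_{ij}=\frac{f_i'(\langle x_0,e_i\rangle)}{f_i(\langle x_0,e_i\rangle)}\,\frac{f_j'(\langle x_0,e_j\rangle)}{f_j(\langle x_0,e_j\rangle)}\quad(i\neq j).$$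
   Context: $H$ is an infinite-dimensional separable real Hilbert space with inner product $\langle\cdot,\cdot\rangle$ and norm $\|\cdot\|$. For $u,v\in H$, $u\otimes v$ is the rank-one operator $(u\otimes v)(t)=\langle u,t\rangle v$. A function $f$ belongs to the class $\Gamma$ at $0$ (is $\Gamma$-varying at $0$) with auxiliary function $\rho$ if $\rho$ is a measurable positive function such that for all $x\in\mathbb{R}$, $\lim_{h\to0^+} f(h+\rho(h)x)/f(h)=\exp(x)$. A kernel is a nonnegative function $K$ on $\mathbb{R}^+$ with $\int K(s)\,ds=1$. Assumption $\mathbf{A}_1$: there is an orthonormal basis $(e_p)_{p\in\mathbb{N}}$ of $H$ such that the real random variables $\langle X,e_p\rangle$, $p\in\mathbb{N}$, are independent and each has a density $f_p$, with $f_p^{(i)}(\langle x_0,e_p\rangle)\neq0$ for $i\in\{0,1,2\}$ (derivatives of order $0,1,2$). Moreover the density of the nonnegative variable $\|X-x_0\|$ exists in a neighborhood of $0$ and belongs to the class $\Gamma$ at $0$ with auxiliary function $\rho$. Assumption $\mathbf{A}_2$: the kernel $K$ is bounded, supported on $[0,1]$, $K(1)>0$ and $\sup_{s\in[0,1]}|K'(s)|<+\infty$. *)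

(* Defs.v *)
From HB Require Import structures.
From mathcomp Require Import all_boot all_order all_algebra.
From mathcomp Require Import all_classical all_reals all_analysis.

Set Implicit Arguments.
Unset Strict Implicit.
Unset Printing Implicit Defensive.

Import Order.TTheory GRing.Theory Num.Theory.
Import numFieldNormedType.Exports.

Local Open Scope classical_set_scope.
Local Open Scope ring_scope.

Section Hilbert.
Context {R : realType} {H : completeNormedModType R}.

(* Over a real field, [{dot H for idfun}] is the type of symmetric positive
   definite bilinear forms; completeness comes from the type of [H]. *)
Definition norm_from (dot : {dot H for (idfun : R -> R)}) : Prop :=
  forall u : H, `|u| ^+ 2 = dot u u.

Definition separable : Prop :=
  exists2 D : set H, countable D & dense D.

Definition infinite_dimensional : Prop :=
  forall (n : nat) (u : 'I_n -> H),
    exists x : H, forall c : 'I_n -> R, x <> \sum_(i < n) c i *: u i.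

Variable dot : {dot H for (idfun : R -> R)}.

Definition orthonormal_basis (e : nat -> H) : Prop :=
  (forall p q, dot (e p) (e q) = (p == q)%:R) /\
  (forall x : H, series (fun p => dot x (e p) *: e p) @ \oo --> x).

Definition tensor (u v : H) : H -> H := fun t => dot u t *: v.

Definition opnorm (S : H -> H) : \bar R :=
  ereal_sup [set `|S t|%:E | t in [set t : H | `|t| <= 1]].

End Hilbert.

Arguments separable {R} H.
Arguments infinite_dimensional {R} H.

Section RandomElements.
Context {R : realType} {d : measure_display} {T : measurableType d}.
Variable P : probability T R.

Definition random_element {H : completeNormedModType R} (X : T -> H) : Prop :=
  measurable_fun [set: T] (X : T -> g_sigma_algebraType (@open H)).

Section mean.
Context {H : completeNormedModType R}.
Variable dot : {dot H for (idfun : R -> R)}.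

(* For separable [H], the measurability of all the [dot u (Y w)] together with
   the integrability of the norm is Bochner integrability (Pettis), and [m] is
   then the Bochner integral of [Y]. *)
Definition has_mean (Y : T -> H) (m : H) : Prop :=
  [/\ P.-integrable [set: T] (fun w => `|Y w|%:E),
      forall u, P.-integrable [set: T] (fun w => (dot u (Y w))%:E) &
      forall u, ('E_P[fun w => dot u (Y w)] = (dot u m)%:E)%E].

(* Such an [m] is unique; [0] is only the value for a [Y] without a mean. *)
Definition mean (Y : T -> H) : H := xget 0 [set m | has_mean Y m].

Definition op_mean (S : T -> H -> H) : H -> H := fun t => mean (S ^~ t).

End mean.

Definition mutually_independent (Y : nat -> T -> R) : Prop :=
  forall (s : seq nat) (B : nat -> set R), uniq s ->
    (forall p, measurable (B p)) ->
    P (\bigcap_(p in [set` s]) (Y p @^-1` B p)) =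
    (\prod_(p <- s) P (Y p @^-1` B p))%E.

Definition has_density_on (D : set R) (Y : T -> R) (f : R -> R) : Prop :=
  [/\ measurable_fun D f, forall y, D y -> 0 <= f y &
      forall A : set R, measurable A -> A `<=` D ->
        P (Y @^-1` A) = (\int[lebesgue_measure]_(y in A) (f y)%:E)%E].

End RandomElements.

Section Assumptions.
Context {R : realType}.

Definition Gamma_varying (g rho : R -> R) : Prop :=
  [/\ measurable_fun (`]0, +oo[ : set R) rho, forall h, 0 < h -> 0 < rho h &
      forall x : R, g (h + rho h * x) / g h @[h --> 0^'+] --> expR x].

Definition kernel_function (K : R -> R) : Prop :=
  [/\ measurable_fun (`[0, +oo[ : set R) K, forall s, 0 <= s -> 0 <= K s &
      (\int[lebesgue_measure]_(s in `[0%R, +oo[) (K s)%:E = 1)%E].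

(* Derivative relative to [A]: on an interval it is two-sided at the interior
   points and one-sided at the endpoints. *)
Definition is_derive_within (A : set R) (f : R -> R) (s l : R) : Prop :=
  (f t - f s) / (t - s) @[t --> within A s^'] --> l.

Definition assumption_A2 (K : R -> R) : Prop :=
  [/\ exists M, forall s, 0 <= s -> K s <= M,
      forall s, 1 < s -> K s = 0,
      0 < K 1 &
      exists (K' : R -> R) (M : R), forall s, s \in `[0, 1] ->
        is_derive_within `[0, 1] K s (K' s) /\ `|K' s| <= M].

Context {d : measure_display} {T : measurableType d} (P : probability T R).
Context {H : completeNormedModType R} (dot : {dot H for (idfun : R -> R)}).

(* The neighbourhood of [0] carrying the density of [`|X - x0|] is taken of the
   form [`]-oo, r[]: the variable being nonnegative, this only adds that the
   density [g] vanishes almost everywhere on the negative half-line. *)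
Definition assumption_A1 (X : T -> H) (x0 : H)
    (e : nat -> H) (f : nat -> R -> R) (rho : R -> R) : Prop :=
  [/\ orthonormal_basis dot e,
      mutually_independent P (fun p w => dot (X w) (e p)),
      forall p, has_density_on P [set: R] (fun w => dot (X w) (e p)) (f p),
      forall p, let x := dot x0 (e p) in
        [/\ \forall y \near x, derivable (f p) y 1,
            derivable ((f p)^`())%classic x 1 &
            forall i : nat, (i <= 2)%N -> ((f p)^`(i))%classic x != 0] &
      exists (r : R) (g : R -> R),
        [/\ 0 < r, has_density_on P `]-oo, r[ (fun w => `|X w - x0|) g &
            Gamma_varying g rho]].

Definition Gamma_K (K : R -> R) (X : T -> H) (x0 : H) (h : R) : H -> H :=
  op_mean P dot (fun w t =>
    K (`|X w - x0| / h) *: tensor dot (X w - x0) (X w - x0) t).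

Definition v_K (K rho : R -> R) (X : T -> H) (x0 : H) (h : R) : R :=
  fine ('E_P[fun w =>
    (K (`|X w - x0| / h) * `|X w - x0| * rho `|X w - x0|)%R])%E.

Definition w_K (K rho : R -> R) (X : T -> H) (x0 : H) (h : R) : R :=
  fine ('E_P[fun w =>
    (K (`|X w - x0| / h) * `|X w - x0| ^+ 2 * rho `|X w - x0| ^+ 2)%R])%E.

Definition R_coef (e : nat -> H) (f : nat -> R -> R) (x0 : H) (i j : nat) : R :=
  let a p := dot x0 (e p) in
  if i == j then ((f i)^`(2))%classic (a i) / f i (a i)
  else (((f i)^`())%classic (a i) / f i (a i)) * (((f j)^`())%classic (a j) / f j (a j)).

End Assumptions.

(* Main.v *)
Require Import Defs.
From HB Require Import structures.
From mathcomp Require Import all_boot all_order all_algebra.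
From mathcomp Require Import all_classical all_reals all_analysis.
From mathcomp Require Import measurable_realfun ring lra.

Set Implicit Arguments.
Unset Strict Implicit.
Unset Printing Implicit Defensive.

Import Order.TTheory GRing.Theory Num.Theory.
Import numFieldNormedType.Exports.

Local Open Scope classical_set_scope.
Local Open Scope ring_scope.

(** Write [Y = X - x0] and [Y_p] for its coordinates, which are independent with
    densities [f_p] translated by [a_p], the coordinate of [x0].  By bilinearity
    the entries of the operator are the numbers E (K (|Y| / h) Y_i Y_j)
    ([Gamma_K_entry]), and its norm is [O(h ^ 2)] because [K] is bounded and
    vanishes beyond [1] ([norm_Gamma_K_le], [opnorm_Gamma_K_cvg0]).  Everything
    else is the asymptotics of these expectations.

    Fix [i != j].  By Parseval [|Y|^2 = Y_i^2 + Y_j^2 + W], where [W] depends on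
    the other coordinates only, hence is independent of [(Y_i, Y_j)]
    ([independent_g_sigma], [cylinder_measurable_remainder]).  The expectation of
    a function of [(Y_i, Y_j, W)] is therefore an integral over the plane times
    the probability space, against the densities of [Y_i] and [Y_j]
    ([decoupling]).  Near [0] these densities are almost constant, so for a
    function of the norm they may be replaced by their values at [0], which
    leaves a model where the plane carries Lebesgue measure
    ([law_radius_comparison], [square_coordinate_comparison]).  For the weight
    [Y_i Y_j] the constants integrate to zero by reflection, and what survives is
    the product of the odd parts of the densities, equivalent to
    [f_i'(a_i) y f_j'(a_j) y'] ([product_coordinates_comparison]).

    In the model the radius has the density [M0 r = 2 pi r P (W <= r^2)]
    ([planar_radius_density]).  A weight [y^2] in front of a function [k] of the
    radius amounts to replacing [k] by its radial tail, the integral of [k s * s]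
    over [s >= r] ([radial_tail_sqr]), and by Tonelli this amounts to replacing
    the density [M] by [r] times its primitive ([integral_radial_tail_mul]).  So
    the three expectations with weights [1], [Y_i^2] and [Y_i Y_j] are governed
    by [M0], by [M1 r = r \int_0^r M0] and by [M2 r = r \int_0^r M1].

    The gain is that [M0] is nondecreasing, which the density [g] of the norm has
    no reason to be.  Since [g] and a multiple of [M0] are equivalent at [0]
    outside a null set ([density_ae_equivalent]), Gamma-variation passes from [g]
    to [M0] ([Gamma_mono_transfer]), together with [rho h = o(h)]
    ([auxiliary_function_littleo]).  For a nondecreasing [M] of class Gamma one
    has [\int_0^h M ~ rho h * M h] ([Gamma_mono_primitive]), and [r \int_0^r M] is
    again of class Gamma with the same [rho] ([Gamma_mono_mul_primitive]).  Hence
    [M1 ~ r rho M0] and [M2 ~ (r rho)^2 M0].  Reading the factors [r rho] as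
    weights under the law of the norm gives [E (K Y_i^2) ~ v h]
    ([square_moment_equiv]) and [E (K Y_i Y_j) ~ R_ij * w h]
    ([cross_moment_equiv]).  Finally [w h = o(v h)] since [r rho r] tends to [0]
    ([second_moment_negligible]), so that in a diagonal entry the term
    [w h * R_ii] is absorbed by [v h]. *)
(** * Monotone functions of class Gamma *)

Section monotone_gamma.
Context {R : realType}.
Implicit Types (M L rho : R -> R).

(** Class Gamma at [0], for functions that are nondecreasing and positive on the
    positive half-line.  That [rho h] is [o(h)] is part of the notion: it keeps
    the points [h + rho h * x] in the half-line for [h] small. *)
Definition Gamma_mono M rho : Prop :=
  [/\ forall x y, 0 < x -> x <= y -> M x <= M y,
      forall x, 0 < x -> 0 < M x,
      forall h, 0 < h -> 0 < rho h,
      rho h / h @[h --> 0^'+] --> 0 &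
      forall x : R, M (h + rho h * x) / M h @[h --> 0^'+] --> expR x].

Lemma near_eq_lim {T : Type} (F : set_system T) {FF : Filter F}
    (u v : T -> R) (l : R) :
  (\forall x \near F, u x = v x) -> v @ F --> l -> u @ F --> l.
Proof.
move=> uv vl; apply: cvg_trans vl; apply: near_eq_cvg.
by apply: filterS uv => x ->.
Qed.

Lemma near0_gt0 : \forall h \near (0:R)^'+, 0 < h.
Proof. exact: nbhs_right_gt. Qed.

Lemma cvg_shift_at_right rho (x : R) :
  (forall h, 0 < h -> 0 < rho h) -> rho h / h @[h --> 0^'+] --> 0 ->
  h + rho h * x @[h --> 0^'+] --> 0^'+.
Proof.
move=> rho0 rhoh.
have small : \forall h \near (0:R)^'+, `|rho h * x| <= h / 2.
  have c0 : 0 < (2 * (`|x| + 1))^-1.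
    by rewrite invr_gt0 mulr_gt0// ltr_wpDl.
  near=> h.
  have h0 : 0 < h by near: h; exact: near0_gt0.
  have : rho h / h <= (2 * (`|x| + 1))^-1.
    by apply: ltW; near: h; exact: (cvgr_lt _ rhoh _ c0).
  rewrite ler_pdivrMr// normrM (gtr0_norm (rho0 _ h0)) => le1.
  have x0 : 0 <= `|x| by [].
  have cx : (2 * (`|x| + 1))^-1 * `|x| <= 1 / 2.
    rewrite mulrC ler_pdivrMr ?mulr_gt0 ?ltr_wpDl//; lra.
  apply: (le_trans (ler_wpM2r x0 le1)); nra.
move=> A [e /= e0 He].
change (\forall h \near (0:R)^'+, A (h + rho h * x)); near=> h.
have h0 : 0 < h by near: h; exact: near0_gt0.
have hs : `|rho h * x| <= h / 2 by near: h.
have he : h < e / 2 by near: h; apply: nbhs_right_lt; rewrite divr_gt0.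
move: hs; rewrite ler_norml => /andP[hs1 hs2].
apply: He; last by lra.
rewrite /ball_ /= sub0r normrN gtr0_norm; lra.
Unshelve. all: by end_near. Qed.

Section fixed.
Variables M rho : R -> R.
Hypothesis GM : Gamma_mono M rho.

Let M_mono x y : 0 < x -> x <= y -> M x <= M y.
Proof. by case: GM => + _ _ _ _; exact. Qed.
Let M_gt0 x : 0 < x -> 0 < M x.
Proof. by case: GM => _ + _ _ _; exact. Qed.
Let rho_gt0 h : 0 < h -> 0 < rho h.
Proof. by case: GM => _ _ + _ _; exact. Qed.
Let rhoh : rho h / h @[h --> 0^'+] --> 0.
Proof. by case: GM. Qed.
Let GMx x : M (h + rho h * x) / M h @[h --> 0^'+] --> expR x.
Proof. by case: GM => _ _ _ _; exact. Qed.
Let shift x : h + rho h * x @[h --> 0^'+] --> 0^'+.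
Proof. exact: cvg_shift_at_right. Qed.

Lemma shift_gt0 x : \forall h \near (0:R)^'+, 0 < h + rho h * x.
Proof. by have /(_ _ near0_gt0) := @shift x. Qed.

(** Moving from [h] to [h + rho h * x], and from there by one more unit of the
    auxiliary function, multiplies [M] by [expR (x + 1)].  If the auxiliary
    function at the intermediate point were off by a factor [1 + e] or [1 - e],
    monotonicity would compare this with [expR (x + 1 + e)] or
    [expR (x + 1 - e)]. *)
Lemma Gamma_mono_self_neglecting (x : R) :
  rho (h + rho h * x) / rho h @[h --> 0^'+] --> (1:R).
Proof.
have two : M (h + rho h * x + rho (h + rho h * x) * 1) / M h @[h --> 0^'+]
    --> expR (x + 1).
  rewrite expRD mulrC.
  have c1 := cvg_comp _ _ (@shift x) (@GMx 1).
  apply: (near_eq_lim _ (cvgM c1 (@GMx x))).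
  near=> h; rewrite /=.
  have h0 : 0 < M h by apply: M_gt0; near: h; exact: near0_gt0.
  have Mx : 0 < M (h + rho h * x) by apply: M_gt0; near: h; exact: shift_gt0.
  by field; rewrite !gt_eqF.
apply/cvgrPdist_le => e e0.
have lt1 : expR (x + 1) < expR (x + 1 + e / 2) by rewrite ltr_expR ltrDl divr_gt0.
have lt2 : expR (x + 1 + e / 2) < expR (x + 1 + e).
  by rewrite ltr_expR ltrD2l gtr_pMr// invf_lt1// ltr1n.
have lt3 : expR (x + 1 - e) < expR (x + 1 - e / 2).
  by rewrite ltr_expR ltrD2l ltrN2 gtr_pMr// invf_lt1// ltr1n.
have lt4 : expR (x + 1 - e / 2) < expR (x + 1).
  by rewrite ltr_expR gtrDl oppr_lt0 divr_gt0.
near=> h.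
have h0 : 0 < h by near: h; exact: near0_gt0.
have Mh := M_gt0 h0; have rh := rho_gt0 h0.
have sx : 0 < h + rho h * x by near: h; exact: shift_gt0.
have s1 : 0 < h + rho h * (x + 1 + e) by near: h; exact: shift_gt0.
have s2 : 0 < h + rho h * (x + 1 - e) by near: h; exact: shift_gt0.
have rx := rho_gt0 sx.
have up : rho (h + rho h * x) <= (1 + e) * rho h.
  rewrite leNgt; apply/negP => big.
  have : M (h + rho h * (x + 1 + e)) / M h <=
         M (h + rho h * x + rho (h + rho h * x) * 1) / M h.
    by rewrite ler_pM2r ?invr_gt0//; apply: M_mono => //; nra.
  apply/negP; rewrite -ltNge; apply: (@lt_trans _ _ (expR (x + 1 + e / 2))).
    near: h; exact: (cvgr_lt _ two _ lt1).
  by near: h; exact: (cvgr_gt _ (@GMx _) _ lt2).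
have lo : (1 - e) * rho h <= rho (h + rho h * x).
  rewrite leNgt; apply/negP => big.
  have : M (h + rho h * x + rho (h + rho h * x) * 1) / M h <=
         M (h + rho h * (x + 1 - e)) / M h.
    by rewrite ler_pM2r ?invr_gt0//; apply: M_mono => //; nra.
  apply/negP; rewrite -ltNge; apply: (@lt_trans _ _ (expR (x + 1 - e / 2))).
    by near: h; exact: (cvgr_lt _ (@GMx _) _ lt3).
  by near: h; exact: (cvgr_gt _ two _ lt4).
by rewrite ler_distlC ler_pdivlMr// ler_pdivrMr//; apply/andP.
Unshelve. all: by end_near. Qed.

(** [L] stands for a primitive of [M].  Only the bounds on its increments matter
    to compare it with [rho h * M h]: both are followed along the decreasing
    sequence obtained by iterating [h |-> h - rho h * dl], along which [M] and
    [rho * M] decay geometrically. *)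
Section primitive.
Variable L : R -> R.
Hypothesis LM : forall a b, 0 < a -> a <= b ->
  (b - a) * M a <= L b - L a <= (b - a) * M b.
Hypothesis L0 : L h @[h --> 0^'+] --> 0.

Let L_mono a b : 0 < a -> a <= b -> L a <= L b.
Proof.
move=> a0 ab; have /andP[le1 _] := LM a0 ab; rewrite -subr_ge0.
by apply: le_trans le1; rewrite mulr_ge0 ?subr_ge0// ltW// M_gt0.
Qed.

Let L_ge0 a : 0 < a -> 0 <= L a.
Proof.
move=> a0; rewrite leNgt; apply/negP => La.
have [x []] : exists x : R, [/\ 0 < x, x < a & L a < L x].
  apply: (@filter_ex _ (0:R)^'+); near=> x; split.
  - by near: x; exact: near0_gt0.
  - by near: x; exact: nbhs_right_lt.
  - by near: x; exact: (cvgr_gt _ L0 _ La).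
by move=> x0 /ltW xa; apply/negP; rewrite -leNgt L_mono.
Unshelve. all: by end_near. Qed.

Let step dl c : 0 < dl -> expR (- dl) < c ->
  \forall h \near (0:R)^'+, [/\ 0 < h - rho h * dl,
    M (h - rho h * dl) <= c * M h &
    rho (h - rho h * dl) * M (h - rho h * dl) <= c * (rho h * M h)].
Proof.
move=> dl0 cdl; have RM : rho (h + rho h * (- dl)) * M (h + rho h * (- dl)) /
    (rho h * M h) @[h --> 0^'+] --> expR (- dl).
  rewrite -[expR _]mul1r.
  apply: (near_eq_lim _ (cvgM (@Gamma_mono_self_neglecting (- dl)) (@GMx (- dl)))).
  by near=> h; rewrite /= mulf_div.
near=> h.
have h0 : 0 < h by near: h; exact: near0_gt0.
have Mh := M_gt0 h0; have rh := rho_gt0 h0.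
have := near (shift_gt0 (- dl)) h; rewrite mulrN => /(_ _)->//.
split => //.
- rewrite -ler_pdivrMr// ltW// -mulrN; near: h.
  exact: (cvgr_lt _ (@GMx _) _ cdl).
- rewrite -ler_pdivrMr ?mulr_gt0// ltW// -mulrN; near: h.
  exact: (cvgr_lt _ RM _ cdl).
Unshelve. all: by end_near. Qed.

(** The contraction factor [c] on the right is the one with
    [(1 + e) * (1 - c) = dl]: the increment of [L] over one step, at most
    [dl * (rho h * M h)], is then matched by that of [(1 + e) * (rho h * M h)]. *)
Let expRN_lt (dl e : R) : 0 < dl -> dl < e -> expR (- dl) < 1 - dl / (1 + e).
Proof.
move=> dl0 dle; have d1 : 0 < 1 + dl by rewrite ltr_wpDl.
have e1 : 0 < 1 + e by lra.
apply: (@le_lt_trans _ _ (1 + dl)^-1).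
  by rewrite expRN lef_pV2 ?posrE ?expR_gt0// expR_ge1Dx.
have -> : 1 - dl / (1 + e) = (1 + e - dl) / (1 + e) by field; rewrite gt_eqF.
by rewrite ltr_pdivlMr// mulrC ltr_pdivrMr//; nra.
Qed.

Lemma Gamma_mono_primitive_le (e : R) : 0 < e ->
  \forall h \near (0:R)^'+, L h <= (1 + e) * (rho h * M h).
Proof.
move=> e0; pose dl := e / 2; pose c := 1 - dl / (1 + e).
have dl0 : 0 < dl by rewrite divr_gt0.
have dle : dl < e by rewrite /dl gtr_pMr// invf_lt1// ltr1n.
have ec : expR (- dl) < c by exact: expRN_lt.
have c0 : 0 < c by exact: lt_trans (expR_gt0 _) ec.
have c1 : c < 1 by rewrite /c gtrBl divr_gt0// addr_gt0.
have [eta /= eta0 Heta] := step dl0 ec.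
have {}Heta h : 0 < h -> h < eta -> [/\ 0 < h - rho h * dl,
    M (h - rho h * dl) <= c * M h &
    rho (h - rho h * dl) * M (h - rho h * dl) <= c * (rho h * M h)].
  by move=> h0 he; apply: Heta => //=; rewrite sub0r normrN gtr0_norm.
(* After [n] steps [M] has shrunk by [c ^+ n], which brings the sequence below
   any prescribed [a]; the inequalities of the steps telescope down to there. *)
have iter a n : 0 < a -> forall h, 0 < h -> h < eta -> c ^+ n * M h < M a ->
    L h <= L a + (1 + e) * (rho h * M h).
  move=> a0; elim: n => [|n IH] h h0 he.
    rewrite expr0 mul1r => Mha.
    have ha : h <= a by rewrite leNgt; apply/negP => /ltW /(M_mono a0); lra.
    apply: (le_trans (L_mono h0 ha)); rewrite lerDl !mulr_ge0 ?ltW// ?addr_gt0//.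
      exact: rho_gt0.
    exact: M_gt0.
  rewrite exprSr -mulrA => Mha; have [h1 Mh1 rM1] := Heta _ h0 he.
  have rh := rho_gt0 h0; have Mh := M_gt0 h0.
  have h1h : h - rho h * dl <= h by rewrite gerBl mulr_ge0 ?ltW.
  have := IH _ h1 (le_lt_trans h1h he).
  have -> : c ^+ n * M (h - rho h * dl) < M a.
    by apply: le_lt_trans Mha; rewrite ler_wpM2l// exprn_ge0// ltW.
  move=> /(_ isT) IH1.
  have /andP[_] := LM h1 h1h.
  have -> : (h - (h - rho h * dl)) * M h = (1 + e) * ((1 - c) * (rho h * M h)).
    by rewrite /c; field; rewrite gt_eqF// addr_gt0.
  have e1 : 0 < 1 + e by rewrite addr_gt0.
  move=> le2; have := ler_wpM2l (ltW e1) rM1; lra.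
near=> h; have h0 : 0 < h by near: h; exact: near0_gt0.
have he : h < eta by near: h; exact: nbhs_right_lt.
apply/ler_addgt0Pr => d d0.
have [a [a0 La]] : exists a, 0 < a /\ L a < d.
  apply: (@filter_ex _ (0:R)^'+); near=> x; split.
  - by near: x; exact: near0_gt0.
  - by near: x; exact: (cvgr_lt _ L0 _ d0).
have cM : c ^+ n * M h @[n --> \oo] --> 0.
  rewrite -(mul0r (M h)); apply: cvgMl; apply: cvg_expr.
  by rewrite ger0_norm// ltW.
have [n cn] : exists n, c ^+ n * M h < M a.
  by apply: (@filter_ex _ \oo); exact: (cvgr_lt _ cM _ (M_gt0 a0)).
by have := iter _ _ a0 _ h0 he cn; lra.
Unshelve. all: by end_near. Qed.

Lemma Gamma_mono_primitive_ge (e : R) : 0 < e -> e < 1 ->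
  \forall h \near (0:R)^'+, (1 - e) * (rho h * M h) <= L h.
Proof.
move=> e0 e1; pose dl := e / 2; pose c := 1 - dl / (1 + e).
have dl0 : 0 < dl by rewrite divr_gt0.
have dle : dl < e by rewrite /dl gtr_pMr// invf_lt1// ltr1n.
have ec : expR (- dl) < c by exact: expRN_lt.
have c0 : 0 < c by exact: lt_trans (expR_gt0 _) ec.
have c1 : c < 1 by rewrite /c gtrBl divr_gt0// addr_gt0.
have lim : dl * (M (h + rho h * (- dl)) / M h) -
    (1 - e) * (1 - rho (h + rho h * (- dl)) / rho h *
                   (M (h + rho h * (- dl)) / M h)) @[h --> 0^'+] -->
    dl * expR (- dl) - (1 - e) * (1 - 1 * expR (- dl)).
  apply: cvgB; first by apply: cvgMr; exact: GMx.
  apply: cvgMr; apply: cvgB; first exact: cvg_cst.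
  by apply: cvgM; [exact: Gamma_mono_self_neglecting|exact: GMx].
(* In the limit one step adds at least [dl * expR (- dl)] to [L], in units of
   [rho h * M h], and this exceeds [(1 - e) * (1 - expR (- dl))], the share of
   [(1 - e) * (rho * M)] lost over the step. *)
have pos : 0 < dl * expR (- dl) - (1 - e) * (1 - 1 * expR (- dl)).
  have := expR_ge1Dx (- dl); have : expR (- dl) < 1 by rewrite expR_lt1; lra.
  by nra.
have [eta /= eta0 Heta] : \forall h \near (0:R)^'+, [/\ 0 < h - rho h * dl,
    rho (h - rho h * dl) * M (h - rho h * dl) <= c * (rho h * M h) &
    (1 - e) * (rho h * M h - rho (h - rho h * dl) * M (h - rho h * dl)) <=
    rho h * dl * M (h - rho h * dl)].
  near=> h.
  have h0 : 0 < h by near: h; exact: near0_gt0.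
  have Mh := M_gt0 h0; have rh := rho_gt0 h0.
  have [//|s1 _ s3] := near (step dl0 ec) h; split => //.
  have : 0 < dl * (M (h + rho h * (- dl)) / M h) -
    (1 - e) * (1 - rho (h + rho h * (- dl)) / rho h *
                   (M (h + rho h * (- dl)) / M h)).
    by near: h; exact: (cvgr_gt _ lim _ pos).
  rewrite mulrN subr_gt0 => /ltW; rewrite -(ler_pM2r (mulr_gt0 rh Mh)).
  set r1 := rho (_ - _); set m1 := M (_ - _).
  have -> : (1 - e) * (1 - r1 / rho h * (m1 / M h)) * (rho h * M h) =
    (1 - e) * (rho h * M h - r1 * m1) by field; rewrite !gt_eqF.
  have -> // : dl * (m1 / M h) * (rho h * M h) = rho h * dl * m1.
  by field; rewrite gt_eqF.
have {}Heta h : 0 < h -> h < eta -> [/\ 0 < h - rho h * dl,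
    rho (h - rho h * dl) * M (h - rho h * dl) <= c * (rho h * M h) &
    (1 - e) * (rho h * M h - rho (h - rho h * dl) * M (h - rho h * dl)) <=
    rho h * dl * M (h - rho h * dl)].
  by move=> h0 he; apply: Heta => //=; rewrite sub0r normrN gtr0_norm.
have iter n : forall h, 0 < h -> h < eta ->
    (1 - e) * ((1 - c ^+ n) * (rho h * M h)) <= L h.
  elim: n => [|n IH] h h0 he.
    by rewrite expr0 subrr mul0r mulr0 L_ge0.
  have [h1 rM1 rM2] := Heta _ h0 he.
  have rh := rho_gt0 h0; have Mh := M_gt0 h0.
  have h1h : h - rho h * dl <= h by rewrite gerBl mulr_ge0 ?ltW.
  have IH1 := IH _ h1 (le_lt_trans h1h he).
  have /andP[+ _] := LM h1 h1h; rewrite subKr => le1.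
  have cn : 0 <= c ^+ n by rewrite exprn_ge0// ltW.
  have := ler_wpM2l cn rM1; rewrite [leRHS]mulrA -exprSr => le2.
  by have e1' : 0 < 1 - e; [lra|nra].
near=> h; have h0 : 0 < h by near: h; exact: near0_gt0.
have he : h < eta by near: h; exact: nbhs_right_lt.
have lim2 : (1 - e) * ((1 - c ^+ n) * (rho h * M h)) @[n --> \oo] -->
    (1 - e) * ((1 - 0) * (rho h * M h)).
  apply: cvgMr; apply: cvgMl; apply: cvgB; first exact: cvg_cst.
  by apply: cvg_expr; rewrite ger0_norm// ltW.
rewrite subr0 mul1r in lim2.
by apply: (cvgr_to_le lim2); apply: nearW => n; exact: iter.
Unshelve. all: by end_near. Qed.

Theorem Gamma_mono_primitive :
  L h / (rho h * M h) @[h --> 0^'+] --> (1:R).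
Proof.
apply/cvgrPdist_le => e e0; pose d := Num.min e (1 / 2).
have d0 : 0 < d by rewrite lt_min e0 divr_gt0.
have d1 : d < 1 by rewrite gt_min; apply/orP; right; lra.
near=> h; have h0 : 0 < h by near: h; exact: near0_gt0.
have rM : 0 < rho h * M h by rewrite mulr_gt0 ?M_gt0 ?rho_gt0.
have de : d <= e by rewrite ge_min lexx.
rewrite ler_distlC ler_pdivlMr// ler_pdivrMr//; apply/andP; split.
- apply: (@le_trans _ _ ((1 - d) * (rho h * M h))).
    by rewrite ler_pM2r//; lra.
  by near: h; exact: Gamma_mono_primitive_ge.
- apply: (@le_trans _ _ ((1 + d) * (rho h * M h))).
    by near: h; exact: Gamma_mono_primitive_le.
  by rewrite ler_pM2r//; lra.
Unshelve. all: by end_near. Qed.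

(** As [L ~ rho * M], the ratio of [h * L h] at the points [h + rho h * x] and [h]
    is that of [M], up to the ratios of [rho] and of the points themselves, which
    tend to [1]. *)
Theorem Gamma_mono_mul_primitive : (forall h, 0 < h -> 0 < L h) ->
  Gamma_mono (fun h => h * L h) rho.
Proof.
move=> Lgt0; split => //.
- move=> x y x0 xy; apply: ler_pM => //; [exact: ltW|exact/ltW/Lgt0|exact: L_mono].
- by move=> x x0; rewrite mulr_gt0 ?Lgt0.
move=> x.
have l1 := cvg_comp _ _ (@shift x) Gamma_mono_primitive.
have lim : (1 + x * (rho h / h)) *
    (L (h + rho h * x) / (rho (h + rho h * x) * M (h + rho h * x)) *
     (L h / (rho h * M h))^-1) *
    (rho (h + rho h * x) / rho h * (M (h + rho h * x) / M h)) @[h --> 0^'+] -->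
    (1 + x * 0) * (1 * 1^-1) * (1 * expR x).
  apply: cvgM; first apply: cvgM.
  - by apply: cvgD; [exact: cvg_cst|exact: cvgMr].
  - by apply: cvgM; [exact: l1|exact: (cvgV (oner_neq0 R) Gamma_mono_primitive)].
  - by apply: cvgM; [exact: Gamma_mono_self_neglecting|exact: GMx].
move: lim; rewrite mulr0 addr0 invr1 !mul1r; apply: near_eq_lim; near=> h => /=.
have h0 : 0 < h by near: h; exact: near0_gt0.
have hx : 0 < h + rho h * x by near: h; exact: shift_gt0.
have := M_gt0 h0; have := rho_gt0 h0; have := Lgt0 _ h0.
have := M_gt0 hx; have := rho_gt0 hx; have := Lgt0 _ hx => *.
by field; rewrite !gt_eqF.
Unshelve. all: by end_near. Qed.

End primitive.
End fixed.
End monotone_gamma.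

(** * Densities, image measures and substitutions *)

Section density_measure.
Local Open Scope ereal_scope.
Context d (X : measurableType d) {R : realType}.
Variables (m : {measure set X -> \bar R}) (a : X -> R).
Hypotheses (ma : measurable_fun [set: X] a) (a0 : forall x, (0 <= a x)%R).

(** The proofs are arguments of the set function so that every instance of it is
    a measure. *)
Definition density_measure (_ : measurable_fun [set: X] a)
  (_ : forall x, (0 <= a x)%R) (A : set X) : \bar R := \int[m]_(x in A) (a x)%:E.

Local Notation nu := (density_measure ma a0).

Let nu0 : nu set0 = 0. Proof. by rewrite /density_measure integral_set0. Qed.
Let nu_ge0 A : 0 <= nu A. Proof. by apply: integral_ge0 => x _; rewrite lee_fin. Qed.
Let nu_sigma : semi_sigma_additive nu.
Proof.
apply: semi_sigma_additive_nng_induced; first exact/measurable_EFinP.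
by move=> x; rewrite lee_fin.
Qed.

HB.instance Definition _ := isMeasure.Build _ _ _ nu nu0 nu_ge0 nu_sigma.

Let integral_density_indic (E : set X) : measurable E ->
  \int[nu]_x (\1_E x)%:E = \int[m]_x ((\1_E x)%:E * (a x)%:E).
Proof.
move=> mE; rewrite integral_indic//= setIT /density_measure integral_mkcond.
apply: eq_integral => x _; rewrite patchE indicE.
by case: ifPn => xE; rewrite ?mul1e ?mul0e.
Qed.

Import HBNNSimple.

Let integral_density_nnsfun (f : {nnsfun X >-> R}) :
  \int[nu]_x (f x)%:E = \int[m]_x ((f x)%:E * (a x)%:E).
Proof.
under [LHS]eq_integral do rewrite fimfunE -fsumEFin//.
rewrite [LHS]ge0_integral_fsum//; last 2 first.
- by move=> r; exact/measurable_EFinP/measurableT_comp.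
- by move=> n x _; rewrite EFinM nnfun_muleindic_ge0.
under [RHS]eq_integral.
  move=> x xD; rewrite fimfunE -fsumEFin// muleC ge0_mule_fsumr; last first.
    by move=> r; rewrite EFinM nnfun_muleindic_ge0.
  over.
rewrite [RHS]ge0_integral_fsum//; last 2 first.
- move=> r; apply: emeasurable_funM; first exact/measurable_EFinP.
  by apply/measurable_EFinP; do 2 apply/measurableT_comp => //.
- by move=> n x _; rewrite muleC mule_ge0 ?lee_fin// -lee_fin EFinM nnfun_muleindic_ge0.
apply: eq_fsbigr => r rf; rewrite integralZl_indic_nnsfun//.
rewrite integral_density_indic//.
have r0 : (0 <= r)%R by move: rf; rewrite inE => -[x _ <-].
rewrite -ge0_integralZl//.
- by apply: eq_integral => x _; rewrite EFinM [RHS]muleC -muleA.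
- apply: emeasurable_funM; apply/measurable_EFinP => //; exact/measurable_indic.
- by move=> x _; rewrite mule_ge0// lee_fin.
Qed.

Lemma ge0_integral_density (f : X -> \bar R) :
  measurable_fun setT f -> (forall x, 0 <= f x) ->
  \int[nu]_x f x = \int[m]_x (f x * (a x)%:E).
Proof.
move=> mf f0; pose f_ := nnsfun_approx measurableT mf.
transitivity (lim (\int[nu]_x (f_ n x)%:E @[n --> \oo])).
  rewrite -monotone_convergence//=.
  - apply: eq_integral => ? /[!inE] xD; apply/esym/cvg_lim => //=.
    exact: cvg_nnsfun_approx.
  - by move=> n; exact/measurable_EFinP/measurable_funTS.
  - by move=> n ? _; rewrite lee_fin.
  - by move=> ? _ ? ? mn; rewrite lee_fin; exact/lefP/nd_nnsfun_approx.
under eq_fun do rewrite integral_density_nnsfun.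
rewrite -monotone_convergence//=.
- apply: eq_integral => x _; apply/cvg_lim => //=.
  apply: cvgeZr => //.
  exact: cvg_nnsfun_approx.
- by move=> n; apply: emeasurable_funM; exact/measurable_EFinP/measurable_funTS.
- by move=> n x _; rewrite mule_ge0// lee_fin.
- move=> x _ i j ij; rewrite lee_wpmul2r ?lee_fin//.
  exact/lefP/nd_nnsfun_approx.
Qed.

End density_measure.

Section image_measure.
Local Open Scope ereal_scope.
Context d d' (X : measurableType d) (Y : measurableType d') {R : realType}.
Variables (m : {measure set X -> \bar R}) (phi : X -> Y).
Hypothesis mphi : measurable_fun [set: X] phi.

(** The pushforward as a measure, which it is only thanks to [mphi]. *)
Definition image_measure : {measure set Y -> \bar R} :=
  measure_function_pushforward__canonical__measure_function_Measure m mphi.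

Lemma image_measureE A : image_measure A = m (phi @^-1` A).
Proof. by []. Qed.

Lemma ge0_integral_image_measure (f : Y -> \bar R) :
  measurable_fun setT f -> (forall y, 0 <= f y) ->
  \int[image_measure]_y f y = \int[m]_x f (phi x).
Proof. by move=> mf f0; rewrite (ge0_integral_pushforward mphi). Qed.

End image_measure.

Section planar_measure.
Local Open Scope ereal_scope.
Context {R : realType}.
Local Notation mu := (@lebesgue_measure R).
Local Notation RR := (measurableTypeR R * measurableTypeR R)%type.

Let square_measure : {measure set RR -> \bar R} := mu \x mu.

Let square_sigma_finite : sigma_finite setT square_measure.
Proof.
have /sigma_finiteP[F [TF ndF Foo]] := sigma_finiteT mu.
exists (fun n => F n `*` F n).
  rewrite -setXTT TF predeqE => -[x y]; split.
    move=> [/= [n _ Fnx] [k _ Fky]]; exists (maxn n k) => //; split.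
    - by move: x Fnx; exact/subsetPset/ndF/leq_maxl.
    - by move: y Fky; exact/subsetPset/ndF/leq_maxr.
  by move=> [n _ []/= ? ?]; split; exists n.
move=> k; have [mF Fk] := Foo k.
split; first exact: measurableX.
by rewrite /square_measure /= product_measure1E// lte_mul_pinfty// ge0_fin_numE.
Qed.

(** The sigma-finiteness is what makes Tonelli available for the products with
    the probability space below. *)
Definition planar_measure : {sigma_finite_measure set RR -> \bar R} :=
  HB.pack (mu \x mu)
    (Measure_isSigmaFinite.Build _ _ _ square_measure square_sigma_finite).

Lemma ge0_integral_planar (G : RR -> \bar R) :
  measurable_fun setT G -> (forall z, 0 <= G z) ->
  \int[planar_measure]_z G z = \int[mu]_y \int[mu]_x G (x, y) /\
  \int[planar_measure]_z G z = \int[mu]_x \int[mu]_y G (x, y).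
Proof.
move=> mG G0; split.
  exact: (@fubini_tonelli2 _ _ _ _ R mu mu G mG G0).
exact: (@fubini_tonelli1 _ _ _ _ R mu mu G mG G0).
Qed.

Context {d : measure_display} {T : measurableType d} (P : probability T R).

Lemma ge0_integral_planar_prod (G : RR * T -> \bar R) :
  measurable_fun setT G -> (forall q, 0 <= G q) ->
  \int[planar_measure \x P]_q G q = \int[P]_w \int[planar_measure]_z G (z, w).
Proof.
by move=> mG G0; exact: (@fubini_tonelli2 _ _ _ _ R planar_measure P G mG G0).
Qed.

End planar_measure.

Section lebesgue_substitutions.
Local Open Scope ereal_scope.
Context {R : realType}.
Local Notation mu := (@lebesgue_measure R).

Let affine (c b : R) : measurableTypeR R -> measurableTypeR R :=
  fun x => (c * x + b)%R.

Lemma measurable_affine (c b : R) : measurable_fun setT (affine c b).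
Proof. by apply: measurable_funD => //; exact: measurable_funM. Qed.

(** The image of Lebesgue measure by [x |-> c * x + b], multiplied by [c], is
    Lebesgue measure, as one sees on intervals. *)
Lemma ge0_integral_affine (c b : R) (f : R -> \bar R) : (0 < c)%R ->
  measurable_fun setT f -> (forall x, 0 <= f x) ->
  \int[mu]_x f x = c%:E * \int[mu]_x f (c * x + b)%R.
Proof.
move=> c0 mf f0; pose k : {nonneg R} := NngNum (ltW c0).
pose im : {measure set (measurableTypeR R) -> \bar R} :=
  image_measure mu (measurable_affine c b).
transitivity (\int[mscale k im]_x f x).
  apply: eq_measure_integral => A mA _.
  apply: (@lebesgue_measure_unique R (mscale k im)) => // _ [[x y]] _ <-.
  change (mu `]x, y] = c%:E * mu (affine c b @^-1` `]x, y])).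
  have -> : affine c b @^-1` `]x, y] = `]((x - b) / c)%R, ((y - b) / c)%R]%classic.
    apply/seteqP; split => z /=; rewrite !in_itv /affine /=;
     by rewrite ltr_pdivrMr// ler_pdivlMr// lerBrDr ltrBlDr mulrC.
  rewrite !lebesgue_measure_itv/= !lte_fin ltr_pM2r ?invr_gt0// ltrD2r.
  case: ifPn => xy; last by rewrite mule0.
  by rewrite -!EFinD -EFinM; congr (_%:E); field; rewrite gt_eqF.
by rewrite ge0_integral_mscale// (ge0_integral_image_measure mu (measurable_affine c b)).
Qed.

Lemma ge0_integral_reflect (f : R -> \bar R) :
  measurable_fun setT f -> (forall x, 0 <= f x) ->
  \int[mu]_x f (- x)%R = \int[mu]_x f x.
Proof.
move=> mf f0.
have mN : measurable_fun setT (-%R : measurableTypeR R -> measurableTypeR R).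
  exact: oppr_measurable.
rewrite -(ge0_integral_image_measure mu mN)//.
by apply: eq_measure_integral => A mA _; exact: lebesgue_measureN.
Qed.

End lebesgue_substitutions.

(** * Radial integrals in the line and in the plane *)

Section radial.
Local Open Scope ereal_scope.
Context {R : realType}.
Local Notation mu := (@lebesgue_measure R).
Implicit Types (k : R -> \bar R).

Lemma integral_id_itv_co (a b : R) : (0 <= a)%R -> (a <= b)%R ->
  \int[mu]_(y in `[a, b[) y%:E = ((b ^+ 2 - a ^+ 2) / 2)%:E.
Proof.
move=> a0; rewrite le_eqVlt => /predU1P[->|ab].
  by rewrite set_itvco0 integral_set0 subrr mul0r.
rewrite integral_itv_bndo_bndc; last exact/measurable_EFinP.
have dF (x : R) : is_derive x 1%R (fun y : R => y ^+ 2 / 2)%R x.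
  apply: trigger_derive; rewrite /GRing.scale /=.
  by field.
have cF (x : R) : {for x, continuous (fun y : R => y ^+ 2 / 2)%R}.
  by apply: differentiable_continuous; exact/derivable1_diffP/ex_derive.
rewrite (@continuous_FTC2 _ id (fun y => y ^+ 2 / 2)%R)//.
- by rewrite -EFinB; congr (_%:E); field.
- by apply: continuous_subspaceT => x; exact: cvg_id.
- split.
  + by move=> x _; exact: ex_derive.
  + by apply: cvg_at_right_filter; exact: cF.
  + by apply: cvg_at_left_filter; exact: cF.
- by move=> x _; rewrite derive1E; apply: derive_val.
Qed.

Lemma measurable_ler_indic d (X : measurableType d) (f g : X -> R) :
  measurable_fun setT f -> measurable_fun setT g ->
  measurable_fun setT (fun x => ((f x <= g x)%R%:R : R)%R).
Proof.
move=> mf mg.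
have -> : (fun x => (f x <= g x)%R%:R : R) = \1_[set x | (f x <= g x)%R].
  apply/funext => x; rewrite indicE; congr ((nat_of_bool _)%:R).
  by apply/idP/idP => [fg|/set_mem//]; exact/mem_set.
apply: measurable_indic; rewrite -[X in measurable X]setTI.
by apply: (measurable_fun_ler mf mg) => //.
Qed.

(** The weight [r dr] on [r >= t], cut at [0] so that it is nonnegative for
    every [t]. *)
Definition tail_weight (t r : R) : R := (Num.max r 0 * (t <= r)%R%:R)%R.

Lemma tail_weight_ge0 t r : (0 <= tail_weight t r)%R.
Proof. by rewrite mulr_ge0 ?ler0n// le_max lexx orbT. Qed.

Lemma measurable_tail_weight2 d (X : measurableType d) (f g : X -> R) :
  measurable_fun setT f -> measurable_fun setT g ->
  measurable_fun setT (fun x => tail_weight (f x) (g x)).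
Proof.
move=> mf mg; apply: measurable_funM; first exact: measurable_maxr.
exact: measurable_ler_indic.
Qed.

Lemma measurable_sqrt : measurable_fun [set: R] (@Num.sqrt R).
Proof. apply: continuous_measurable_fun. exact: sqrt_continuous. Qed.

Lemma measurable_radius (s : R) :
  measurable_fun [set: R] (fun y => Num.sqrt (y ^+ 2 + s)).
Proof.
apply: measurableT_comp; first exact: measurable_sqrt.
by apply: measurable_funD => //; exact: measurable_funX.
Qed.

Let pos_part_ge0 (y : R) : (0 <= Num.max y 0)%R.
Proof. by rewrite le_max lexx orbT. Qed.

(** With [r ^+ 2 = y ^+ 2 + s] one has [r dr = y dy].  The change of variables is
    proved for measures: the image of [y dy] and the measure [r dr] give the mass
    [(x ^+ 2 - s) / 2] to the half-line below [x]. *)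
Lemma radial_substitution_pos (s : R) k : (0 <= s)%R ->
  measurable_fun setT k -> (forall x, 0 <= k x) ->
  \int[mu]_y (k (Num.sqrt (y ^+ 2 + s)) * (Num.max y 0)%:E) =
  \int[mu]_r (k r * (tail_weight (Num.sqrt s) r)%:E).
Proof.
move=> s0 mk k0.
have mpos : measurable_fun [set: measurableTypeR R] (fun y : R => (Num.max y 0)%R).
  by apply: measurable_maxr.
have mw : measurable_fun [set: measurableTypeR R] (tail_weight (Num.sqrt s)).
  exact: measurable_tail_weight2.
have mrad : measurable_fun [set: measurableTypeR R]
    (fun y : measurableTypeR R => Num.sqrt (y ^+ 2 + s)%R : measurableTypeR R).
  exact: measurable_radius.
pose dn := density_measure mu mpos pos_part_ge0.
pose m1 : {measure set (measurableTypeR R) -> \bar R} :=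
  image_measure dn mrad.
pose m2 : {measure set (measurableTypeR R) -> \bar R} :=
  density_measure mu mw (tail_weight_ge0 (Num.sqrt s)).
have sqs : (Num.sqrt s ^+ 2 = s)%R by rewrite sqr_sqrtr.
have m1E x : (Num.sqrt s <= x)%R -> m1 `]-oo, x[%classic = ((x ^+ 2 - s) / 2)%:E.
  move=> sx; have x0 : (0 <= x)%R by apply: le_trans sx; exact: sqrtr_ge0.
  have sx2 : (s <= x ^+ 2)%R.
    by rewrite -[leLHS]sqs ler_sqr ?nnegrE ?sqrtr_ge0.
  rewrite /m1 image_measureE /=.
  transitivity (\int[mu]_(y in `[0%R, Num.sqrt (x ^+ 2 - s)[) y%:E).
    rewrite /density_measure integral_mkcond [RHS]integral_mkcond.
    apply: eq_integral => y _; rewrite !patchE.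
    have -> : (y \in `[0%R, Num.sqrt (x ^+ 2 - s)[%classic) =
       (0 <= y)%R && (y \in (fun y => Num.sqrt (y ^+ 2 + s)%R) @^-1` `]-oo, x[).
      have [y0|y0] := leP 0%R y.
        apply/idP/idP => /set_mem /=; rewrite in_itv /= => H; apply/mem_set => /=;
          rewrite in_itv /= ?y0 /=.
          rewrite y0 /= in H; rewrite -(ltr_pXn2r (n:=2))// ?nnegrE ?sqrtr_ge0//.
          rewrite sqr_sqrtr ?addr_ge0 ?sqr_ge0// -ltrBrDr.
          rewrite -[ltRHS]sqr_sqrtr ?subr_ge0//.
          by rewrite ltr_pXn2r ?nnegrE ?sqrtr_ge0.
        rewrite -(ltr_pXn2r (n:=2))// ?nnegrE ?sqrtr_ge0//.
        rewrite sqr_sqrtr ?subr_ge0// ltrBrDr.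
        rewrite -[ltLHS]sqr_sqrtr ?addr_ge0 ?sqr_ge0//.
        by rewrite ltr_pXn2r ?nnegrE ?sqrtr_ge0.
      apply/negbTE/negP => /set_mem /=; rewrite in_itv /= => /andP[].
      by rewrite leNgt y0.
    have [y0|y0] := leP 0%R y; first by case: ifP.
    by case: ifP.
  by rewrite integral_id_itv_co ?sqrtr_ge0// expr0n subr0 sqr_sqrtr ?subr_ge0.
have m2E x : (Num.sqrt s <= x)%R -> m2 `]-oo, x[%classic = ((x ^+ 2 - s) / 2)%:E.
  move=> sx.
  transitivity (\int[mu]_(y in `[Num.sqrt s, x[) y%:E).
    change (\int[mu]_(y in `]-oo, x[) (tail_weight (Num.sqrt s) y)%:E =
      \int[mu]_(y in `[Num.sqrt s, x[) y%:E).
    rewrite integral_mkcond [RHS]integral_mkcond.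
    apply: eq_integral => y _; rewrite !patchE /tail_weight.
    have -> : (y \in `[Num.sqrt s, x[%classic) =
       (Num.sqrt s <= y)%R && (y \in `]-oo, x[%classic).
      by apply/idP/idP => [/set_mem|/andP[sy /set_mem]] /=; rewrite in_itv /=
        => H; [case/andP: H => -> H; apply/mem_set|apply/mem_set];
        rewrite /= in_itv /= ?sy.
    have [sy|sy] := leP (Num.sqrt s) y => /=; last by rewrite mulr0; case: ifP.
    rewrite mulr1 max_l//; exact: le_trans (sqrtr_ge0 _) sy.
  by rewrite integral_id_itv_co ?sqrtr_ge0// sqs.
have m1_lt x : (x < Num.sqrt s)%R -> m1 `]-oo, x[%classic = 0.
  move=> xs; apply/eqP; rewrite eq_le measure_ge0 andbT.
  rewrite -[leRHS](_ : m1 `]-oo, Num.sqrt s[%classic = _); last first.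
    by rewrite m1E// sqs subrr mul0r.
  apply: le_measure; rewrite ?inE//.
  by move=> z /=; rewrite !in_itv /= => /lt_trans; exact.
have m2_lt x : (x < Num.sqrt s)%R -> m2 `]-oo, x[%classic = 0.
  move=> xs; apply/eqP; rewrite eq_le measure_ge0 andbT.
  rewrite -[leRHS](_ : m2 `]-oo, Num.sqrt s[%classic = _); last first.
    by rewrite m2E// sqs subrr mul0r.
  apply: le_measure; rewrite ?inE//.
  by move=> z /=; rewrite !in_itv /= => /lt_trans; exact.
have m12 A : measurable A -> m1 A = m2 A.
  move=> mA; apply: (@measure_unique _ R (measurableTypeR R) (@RGenInftyO.G R)
    (fun n => `]-oo, (n%:R)%R[%classic)) => //.
  - exact: RGenInftyO.measurableE.
  - move=> _ _ [x ->] [y ->]; exists (Num.min x y).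
    by apply/seteqP; split => z /=; rewrite !in_itv/= lt_min;
      [move=> [-> ->]|move=> /andP].
  - by move=> n; exists (n%:R)%R.
  - apply/seteqP; split => // x _; exists (Num.bound `|x|%R) => //=.
    by rewrite in_itv /= (le_lt_trans (ler_norm x))// archi_boundP.
  - by move=> _ [x ->]; have [sx|sx] := leP (Num.sqrt s) x;
      [rewrite m1E// m2E|rewrite m1_lt// m2_lt].
  - move=> n; have [sx|sx] := leP (Num.sqrt s) (n%:R)%R.
      by rewrite m1E// ltry.
    by rewrite m1_lt.
transitivity (\int[m1]_r k r).
  rewrite ge0_integral_image_measure// ge0_integral_density//.
  exact: measurableT_comp (measurable_radius s).
rewrite (eq_measure_integral m2); last by move=> A mA _; exact: m12.
by rewrite ge0_integral_density.
Qed.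

Lemma radial_substitution (s : R) k : (0 <= s)%R ->
  measurable_fun setT k -> (forall x, 0 <= k x) ->
  \int[mu]_y (k (Num.sqrt (y ^+ 2 + s)) * `|y|%:E) =
  2%:E * \int[mu]_r (k r * (tail_weight (Num.sqrt s) r)%:E).
Proof.
move=> s0 mk k0.
have mkr : measurable_fun [set: measurableTypeR R]
    (fun y : R => k (Num.sqrt (y ^+ 2 + s))).
  exact: (measurableT_comp mk (measurable_radius s)).
have mpos : measurable_fun [set: measurableTypeR R] (fun y : R => (Num.max y 0)%R).
  by apply: measurable_maxr.
have mneg : measurable_fun [set: measurableTypeR R] (fun y : R => (Num.max (- y) 0)%R).
  by apply: measurable_maxr => //; exact: oppr_measurable.
have pos (y : R) : (0 <= Num.max y 0)%R by rewrite le_max lexx orbT.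
transitivity (\int[mu]_y (k (Num.sqrt (y ^+ 2 + s)) * (Num.max y 0)%:E +
                          k (Num.sqrt (y ^+ 2 + s)) * (Num.max (- y) 0)%:E)).
  apply: eq_integral => y _; rewrite -ge0_muleDr ?lee_fin// -EFinD.
  congr (_ * _%:E); have [y0|y0] := leP 0%R y.
    by rewrite max_r ?addr0 ?ger0_norm// oppr_le0.
  by rewrite max_l ?add0r ?ltr0_norm// oppr_ge0 ltW.
rewrite ge0_integralD//=; first last.
- by apply: emeasurable_funM => //; exact/measurable_EFinP.
- by move=> y _; rewrite mule_ge0// lee_fin.
- by apply: emeasurable_funM => //; exact/measurable_EFinP.
- by move=> y _; rewrite mule_ge0// lee_fin.
have -> : \int[mu]_y (k (Num.sqrt (y ^+ 2 + s)) * (Num.max (- y) 0)%:E) =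
    \int[mu]_y (k (Num.sqrt (y ^+ 2 + s)) * (Num.max y 0)%:E).
  rewrite -(ge0_integral_reflect (f := fun y =>
     k (Num.sqrt (y ^+ 2 + s)) * (Num.max y 0)%:E)).
  - by apply: eq_integral => y _; rewrite sqrrN.
  - by apply: emeasurable_funM => //; exact/measurable_EFinP.
  - by move=> y; rewrite mule_ge0// lee_fin.
by rewrite radial_substitution_pos// mule_natl mule2n.
Qed.

(** An integration by parts in one coordinate [y]: since [y * k (radius) dy] is
    minus the differential of the tail of [k] at the radius, the tail absorbs a
    weight [y ^+ 2], see [radial_tail_sqr]. *)
Definition radial_tail k (t : R) : \bar R :=
  \int[mu]_r (k r * (tail_weight t r)%:E).

Lemma radial_tail_ge0 k t : (forall x, 0 <= k x) -> 0 <= radial_tail k t.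
Proof.
by move=> k0; apply: integral_ge0 => r _; rewrite mule_ge0 ?lee_fin ?tail_weight_ge0.
Qed.

Lemma measurable_radial_tail k : measurable_fun setT k ->
  (forall x, 0 <= k x) -> measurable_fun setT (radial_tail k).
Proof.
move=> mk k0.
pose F (z : measurableTypeR R * measurableTypeR R) : \bar R :=
  k z.2 * (tail_weight z.1 z.2)%:E.
have mF : measurable_fun setT F.
  apply: emeasurable_funM; first exact: (measurableT_comp mk).
  by apply/measurable_EFinP; exact: measurable_tail_weight2.
apply: (measurable_fun_fubini_tonelli_F (m2 := mu) F mF).
by move=> z; rewrite mule_ge0 ?lee_fin ?tail_weight_ge0.
Qed.

(** Restricting [k] to the radii beyond that of [y] restricts the coordinate to
    [`|y| <= `|t|], so the tail becomes an integral over the same coordinate. *)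
Lemma radial_tail_radius (s y : R) k : (0 <= s)%R ->
  measurable_fun setT k -> (forall x, 0 <= k x) ->
  radial_tail k (Num.sqrt (y ^+ 2 + s)) = 2^-1%:E *
  \int[mu]_t (k (Num.sqrt (t ^+ 2 + s)) * (`|t| * (`|y| <= `|t|)%R%:R)%:E).
Proof.
move=> s0 mk k0; pose a := Num.sqrt (y ^+ 2 + s)%R.
pose k' r := k r * ((a <= r)%R%:R)%:E.
have mk' : measurable_fun setT k'.
  apply: emeasurable_funM => //; apply/measurable_EFinP.
  exact: measurable_ler_indic.
have k'0 r : 0 <= k' r by rewrite mule_ge0// lee_fin ler0n.
have -> : radial_tail k a = \int[mu]_r (k' r * (tail_weight (Num.sqrt s) r)%:E).
  apply: eq_integral => r _; rewrite /k' -muleA -EFinM; congr (_ * _%:E).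
  rewrite /tail_weight; have [ar|ar] := leP a r; last by rewrite mulr0 mul0r.
  rewrite mul1r; congr (_ * _)%R; suff -> : (Num.sqrt s <= r)%R by [].
  by apply: le_trans ar; rewrite ler_wsqrtr// lerDr sqr_ge0.
have -> : \int[mu]_t (k (Num.sqrt (t ^+ 2 + s)) * (`|t| * (`|y| <= `|t|)%R%:R)%:E)
    = \int[mu]_t (k' (Num.sqrt (t ^+ 2 + s)) * `|t|%:E).
  apply: eq_integral => t _; rewrite /k' -muleA -EFinM [in RHS]mulrC.
  congr (_ * (_ * (nat_of_bool _)%:R)%:E); rewrite /a.
  rewrite ler_sqrt ?addr_ge0 ?sqr_ge0// lerD2r -[(y ^+ 2)%R]real_normK ?num_real//.
  by rewrite -[(t ^+ 2)%R]real_normK ?num_real// ler_sqr ?nnegrE.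
rewrite radial_substitution// muleA -EFinM mulVf ?mul1e//.
Qed.

(** After [radial_tail_radius] and Tonelli, the integral over [y] is the length
    of [`|y| <= `|t|], namely [2 * `|t|], which completes [`|t|] to [t ^+ 2]. *)
Lemma radial_tail_sqr (s : R) k : (0 <= s)%R ->
  measurable_fun setT k -> (forall x, 0 <= k x) ->
  \int[mu]_y (k (Num.sqrt (y ^+ 2 + s)) * (y ^+ 2)%:E) =
  \int[mu]_y (radial_tail k (Num.sqrt (y ^+ 2 + s))).
Proof.
move=> s0 mk k0; under [RHS]eq_integral do rewrite radial_tail_radius//.
pose F (z : measurableTypeR R * measurableTypeR R) : \bar R :=
  k (Num.sqrt (z.2 ^+ 2 + s)) * (`|z.2| * (`|z.1| <= `|z.2|)%R%:R)%:E.
have F0 z : 0 <= F z by rewrite mule_ge0// lee_fin mulr_ge0.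
have mF : measurable_fun setT F.
  apply: emeasurable_funM.
    apply: (measurableT_comp mk).
    exact: (measurableT_comp (measurable_radius s)).
  apply/measurable_EFinP; apply: measurable_funM.
    exact: (measurableT_comp (@normr_measurable R setT)).
  apply: measurable_ler_indic.
    exact: (measurableT_comp (@normr_measurable R setT)).
  exact: (measurableT_comp (@normr_measurable R setT)).
transitivity (2^-1%:E * \int[mu]_y \int[mu]_t F (y, t)); last first.
  rewrite -ge0_integralZl//.
  - exact: (measurable_fun_fubini_tonelli_F (m2 := mu) F mF).
  - by move=> y _; exact: integral_ge0.
rewrite (fubini_tonelli (m1 := mu) (m2 := mu) F mF F0).
rewrite -ge0_integralZl//; first last.
- by move=> y _; exact: integral_ge0.
- exact: (measurable_fun_fubini_tonelli_G (m1 := mu) F mF).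
apply: eq_integral => t _.
have -> : \int[mu]_y F (y, t) =
    \int[mu]_y (k (Num.sqrt (t ^+ 2 + s)) * `|t|%:E * (\1_(`[- `|t|, `|t|]%classic) y)%:E).
  apply: eq_integral => y _; rewrite /F /= EFinM muleA; congr (_ * _%:E).
  rewrite indicE; congr ((nat_of_bool _)%:R).
  by apply/idP/idP => [yt|/set_mem/=]; [apply/mem_set => /=|];
    rewrite in_itv /= -ler_norml.
rewrite ge0_integralZl//; first last.
- by rewrite mule_ge0// lee_fin.
- exact/measurable_EFinP/measurable_indic.
rewrite integral_indic// setIT.
rewrite [X in _ * (_ * X)](lebesgue_measure_itv `[(- `|t|)%R, `|t|%R])/= lte_fin.
rewrite -[(t ^+ 2)%R]real_normK ?num_real//.
rewrite muleCA -muleA; congr (_ * _).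
case: ifPn => [tt|]; first by rewrite -EFinD -!EFinM; congr (_%:E); field.
have [-> _|t0] := eqVneq t 0%R; first by rewrite normr0 !mule0 expr0n.
by rewrite gtrN ?normr_gt0.
Qed.

Lemma ge0_integral_oneDsqrV :
  \int[mu]_t ((1 + t ^+ 2)^-1)%:E = pi%:E.
Proof.
rewrite (@ge0_symfun_integralT R (fun t => (1 + t ^+ 2)^-1)%R).
- have := @integral0y_oneDsqr R; rewrite set_itvcy /oneDsqr => ->.
  by rewrite -EFinM; congr (_%:E); field.
- by move=> x; rewrite invr_ge0 addr_ge0// sqr_ge0.
- by move=> x; exact: continuous_oneDsqrV.
- by move=> x /=; rewrite sqrrN.
Qed.

(** Polar coordinates without angles: [x = `|y| * t] sends the radius to
    [y ^+ 2 * (1 + t ^+ 2) + w] under the square root and brings in the factor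
    [`|y|] needed by [radial_substitution]; rescaling [y] leaves
    [(1 + t ^+ 2)^-1], whose integral is [pi]. *)
Lemma planar_radial (w : R) k : (0 <= w)%R ->
  measurable_fun setT k -> (forall x, 0 <= k x) ->
  \int[mu]_y \int[mu]_x k (Num.sqrt (x ^+ 2 + (y ^+ 2 + w))) =
  (2 * pi)%:E * radial_tail k (Num.sqrt w).
Proof.
move=> w0 mk k0.
pose F (z : measurableTypeR R * measurableTypeR R) : \bar R :=
  k (Num.sqrt (z.1 ^+ 2 * (1 + z.2 ^+ 2) + w)) * `|z.1|%:E.
have F0 z : 0 <= F z by rewrite mule_ge0// lee_fin.
have mF : measurable_fun setT F.
  apply: emeasurable_funM.
    apply: (measurableT_comp mk); apply: (measurableT_comp measurable_sqrt).
    apply: measurable_funD => //; apply: measurable_funM; first exact: measurable_funX.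
    by apply: measurable_funD => //; exact: measurable_funX.
  by apply/measurable_EFinP; exact: (measurableT_comp (@normr_measurable R setT)).
pose G (z : measurableTypeR R * measurableTypeR R) : \bar R :=
  k (Num.sqrt (z.2 ^+ 2 + (z.1 ^+ 2 + w))).
have mG : measurable_fun setT G.
  apply: (measurableT_comp mk); apply: (measurableT_comp measurable_sqrt).
  apply: measurable_funD => //; first exact: measurable_funX.
  by apply: measurable_funD => //; exact: measurable_funX.
have G0 z : 0 <= G z by exact: k0.
(* The substitution is singular on the negligible line [y = 0]. *)
transitivity (\int[mu]_y \int[mu]_t F (y, t)).
  apply: ge0_ae_eq_integral => //.
  - exact: (measurable_fun_fubini_tonelli_F (m2 := mu) G mG).
  - exact: (measurable_fun_fubini_tonelli_F (m2 := mu) F mF).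
  - by move=> y _; exact: integral_ge0.
  - by move=> y _; exact: integral_ge0.
  exists [set 0%R]; split => //; first exact: lebesgue_measure_set1.
  move=> y /= /not_implyP [_ nE]; apply: contrapT => /eqP y0; apply: nE.
  have yp : (0 < `|y|)%R by rewrite normr_gt0.
  rewrite (@ge0_integral_affine R `|y|%R 0%R (fun x => k (Num.sqrt (x ^+ 2 + (y ^+ 2 + w)))))//; last first.
    exact: (measurableT_comp mk (measurable_radius _)).
  rewrite -ge0_integralZl//; last first.
    apply: (measurableT_comp mk); apply: (measurableT_comp measurable_sqrt).
    by apply: measurable_funD => //; apply: measurable_funX; exact: measurable_affine.
  apply: eq_integral => t _; rewrite /F /= muleC; congr (k (Num.sqrt _) * _).
  by rewrite addr0 exprMn real_normK ?num_real//; ring.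
rewrite (fubini_tonelli (m1 := mu) (m2 := mu) F mF F0).
transitivity (\int[mu]_t ((2%:E * radial_tail k (Num.sqrt w)) * ((1 + t ^+ 2)^-1)%:E)).
  apply: eq_integral => t _.
  pose c := Num.sqrt (1 + t ^+ 2)%R.
  have c2 : (c ^+ 2 = 1 + t ^+ 2)%R by rewrite sqr_sqrtr// addr_ge0// sqr_ge0.
  have c0 : (0 < c)%R by rewrite sqrtr_gt0 ltr_pwDl// sqr_ge0.
  rewrite -radial_substitution// -c2.
  have mkr : measurable_fun [set: measurableTypeR R]
      (fun y : R => k (Num.sqrt (y ^+ 2 + w)) * `|y|%:E).
    apply: emeasurable_funM; first exact: (measurableT_comp mk (measurable_radius w)).
    by apply/measurable_EFinP; exact: normr_measurable.
  rewrite (@ge0_integral_affine R c 0%R (fun y => k (Num.sqrt (y ^+ 2 + w)) * `|y|%:E))//;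
    last by move=> y; rewrite mule_ge0// lee_fin.
  rewrite muleC muleA -EFinM -ge0_integralZl//; last first.
  - by rewrite lee_fin mulr_ge0 ?invr_ge0 ?sqr_ge0// ltW.
  - by move=> y _; rewrite mule_ge0// lee_fin.
  - exact: (measurableT_comp mkr (measurable_affine c 0%R)).
  apply: eq_integral => y _; rewrite /F /= addr0 muleCA; congr (k (Num.sqrt _) * _).
    by rewrite -c2; ring.
  by rewrite normrM (gtr0_norm c0) -EFinM; congr (_%:E); field; rewrite gt_eqF.
rewrite ge0_integralZl//; first last.
- by rewrite mule_ge0// radial_tail_ge0.
- by move=> t _; rewrite lee_fin invr_ge0 addr_ge0// sqr_ge0.
- apply/measurable_EFinP; apply: continuous_measurable_fun => x.
  exact: continuous_oneDsqrV.
by rewrite ge0_integral_oneDsqrV muleAC -EFinM.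
Qed.

End radial.

(** * Primitives of monotone functions *)

Section primitive_of_monotone.
Local Open Scope ereal_scope.
Context {R : realType}.
Local Notation mu := (@lebesgue_measure R).

Definition primitive (M : R -> R) (r : R) : R :=
  fine (\int[mu]_(t in `]-oo, r]) (M t)%:E).

(** Densities of radii vanish on the negative half-line; extending by [0] there
    keeps them monotone, hence measurable, on the whole line. *)
Definition half_line_monotone (M : R -> R) : Prop :=
  (forall r, (r <= 0 -> M r = 0)%R) /\ (forall a b, (a <= b -> M a <= M b)%R).

Section props.
Variable M : R -> R.
Hypothesis HM : half_line_monotone M.

Lemma half_line_monotone_ge0 r : (0 <= M r)%R.
Proof.
case: HM => M0 Mm; have [r0|/ltW r0] := leP r 0%R; first by rewrite M0.
by rewrite -(M0 0%R (lexx _)); exact: Mm.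
Qed.

Lemma measurable_half_line_monotone : measurable_fun [set: R] M.
Proof. by apply: nondecreasing_measurable => // a b; exact: HM.2. Qed.

Let mM : measurable_fun [set: measurableTypeR R] (fun t => (M t)%:E).
Proof. by apply/measurable_EFinP; exact: measurable_half_line_monotone. Qed.

Let bound a b : (a <= b)%R ->
  ((b - a) * M a)%:E <= \int[mu]_(t in `]a, b]) (M t)%:E <= ((b - a) * M b)%:E.
Proof.
move=> ab.
have muab : mu `]a, b]%classic = (b - a)%:E.
  rewrite lebesgue_measure_itv/= lte_fin; case: ltP => [_|ba]; first by rewrite EFinB.
  by have -> : a = b; [apply/le_anti/andP|rewrite subrr].
apply/andP; split.
- rewrite mulrC EFinM -muab -integral_cst//; apply: ge0_le_integral => //.
  + by move=> t _; rewrite lee_fin half_line_monotone_ge0.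
  + exact: measurable_funTS.
  + by move=> t /=; rewrite in_itv /= lee_fin => /andP[/ltW ta _]; exact: HM.2.
- rewrite mulrC EFinM -muab -integral_cst//; apply: ge0_le_integral => //.
  + by move=> t _; rewrite lee_fin half_line_monotone_ge0.
  + exact: measurable_funTS.
  + by move=> t /=; rewrite in_itv /= lee_fin => /andP[_ ta]; exact: HM.2.
Qed.

Let below0 a : (a <= 0)%R -> \int[mu]_(t in `]-oo, a]) (M t)%:E = 0.
Proof.
move=> a0; apply: integral0_eq => t /=; rewrite in_itv /= => ta.
by rewrite HM.1// (le_trans ta).
Qed.

Let chasles a b : (a <= b)%R -> \int[mu]_(t in `]-oo, b]) (M t)%:E =
  \int[mu]_(t in `]-oo, a]) (M t)%:E + \int[mu]_(t in `]a, b]) (M t)%:E.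
Proof.
move=> ab; rewrite -ge0_integral_setU//=.
- by congr (integral _ _ _); apply/seteqP; split => t /=; rewrite !in_itv /=;
    [move=> tb; have [|] := leP t a; [left|right; apply/andP]
    |move=> [/le_trans->//|/andP[]//]].
- by apply: measurable_funTS.
- by move=> t _; rewrite lee_fin half_line_monotone_ge0.
- apply/disj_setPS => t /= []; rewrite !in_itv /= => ta /andP[].
  by rewrite ltNge ta.
Qed.

Lemma primitive_fin r : \int[mu]_(t in `]-oo, r]) (M t)%:E \is a fin_num.
Proof.
have [r0|/ltW r0] := leP r 0%R; first by rewrite below0.
rewrite (chasles r0) below0// add0e ge0_fin_numE; last first.
  by apply: integral_ge0 => t _; rewrite lee_fin half_line_monotone_ge0.
by have /andP[_ /le_lt_trans] := bound r0; apply; rewrite ltry.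
Qed.

Lemma primitiveE r : (primitive M r)%:E = \int[mu]_(t in `]-oo, r]) (M t)%:E.
Proof. by rewrite /primitive fineK// primitive_fin. Qed.

Lemma primitive_le0 r : (r <= 0)%R -> primitive M r = 0%R.
Proof. by move=> r0; rewrite /primitive below0. Qed.

Lemma primitive_bound a b : (a <= b)%R ->
  ((b - a) * M a <= primitive M b - primitive M a <= (b - a) * M b)%R.
Proof.
move=> ab; have := bound ab.
have -> : \int[mu]_(t in `]a, b]) (M t)%:E = (primitive M b - primitive M a)%:E.
  rewrite EFinB !primitiveE (chasles ab) addeAC subee ?add0e//.
  exact: primitive_fin.
by rewrite !lee_fin.
Qed.

Lemma primitive_monotone a b : (a <= b)%R -> (primitive M a <= primitive M b)%R.
Proof.
move=> ab; have /andP[le1 _] := primitive_bound ab; rewrite -subr_ge0.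
by apply: le_trans le1; rewrite mulr_ge0 ?subr_ge0// half_line_monotone_ge0.
Qed.

Lemma primitive_ge0 r : (0 <= primitive M r)%R.
Proof.
by rewrite -lee_fin primitiveE; apply: integral_ge0 => t _;
  rewrite lee_fin half_line_monotone_ge0.
Qed.

Lemma primitive_gt0 : (forall r, (0 < r -> 0 < M r)%R) ->
  forall r, (0 < r -> 0 < primitive M r)%R.
Proof.
move=> Mpos r r0; have r2 : (r / 2 <= r)%R by lra.
have /andP[+ _] := primitive_bound r2.
have : (0 < (r - r / 2) * M (r / 2))%R.
  by rewrite mulr_gt0 ?Mpos ?divr_gt0//; lra.
have := primitive_ge0 (r / 2)%R; lra.
Qed.

Lemma primitive_cvg0 : primitive M r @[r --> 0^'+] --> (0 : R)%R.
Proof.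
apply: (@squeeze_cvgr _ _ _ _ (fun=> 0%R) (fun r => r * M 1)%R).
- near=> r; rewrite primitive_ge0 /=.
  have r0 : (0 < r)%R by near: r; exact: nbhs_right_gt.
  have r1 : (r <= 1)%R by near: r; apply: nbhs_right_le.
  have /andP[_] := primitive_bound (ltW r0).
  rewrite !subr0 [primitive M 0]primitive_le0// subr0 => /le_trans; apply.
  by rewrite ler_wpM2l ?(ltW r0)//; exact: HM.2.
- exact: cvg_cst.
- rewrite -[X in _ --> X](mul0r (M 1)); apply: cvgMl.
  exact: cvg_at_right_filter cvg_id.
Unshelve. all: by end_near. Qed.

Lemma half_line_monotone_mul_primitive :
  half_line_monotone (fun r => Num.max r 0 * primitive M r)%R.
Proof.
split => [r r0|a b ab]; first by rewrite max_r// mul0r.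
apply: ler_pM => //.
- by rewrite le_max lexx orbT.
- exact: primitive_ge0.
- by rewrite ge_max !le_max ab lexx !orbT.
- exact: primitive_monotone.
Qed.

(** The tail of [k] at [t] integrates [k r * r] over [r >= t]; exchanging the two
    integrals leaves the integral of [M] over [t <= r]. *)
Lemma integral_radial_tail_mul (k : R -> \bar R) :
  measurable_fun setT k -> (forall x, 0 <= k x) ->
  \int[mu]_t (radial_tail k t * (M t)%:E) =
  \int[mu]_r (k r * (Num.max r 0 * primitive M r)%:E).
Proof.
move=> mk k0.
pose F (z : measurableTypeR R * measurableTypeR R) : \bar R :=
  k z.2 * (tail_weight z.1 z.2)%:E * (M z.1)%:E.
have F0 z : 0 <= F z.
  by rewrite !mule_ge0 ?lee_fin ?tail_weight_ge0 ?half_line_monotone_ge0.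
have mF : measurable_fun setT F.
  apply: emeasurable_funM; last first.
    exact: (measurableT_comp mM measurable_fst).
  apply: emeasurable_funM; first exact: (measurableT_comp mk measurable_snd).
  by apply/measurable_EFinP; exact: measurable_tail_weight2.
transitivity (\int[mu]_t \int[mu]_r F (t, r)).
  apply: eq_integral => t _; rewrite /F /radial_tail muleC -ge0_integralZl//.
  - by apply: eq_integral => r _; rewrite muleC.
  - apply: emeasurable_funM => //; apply/measurable_EFinP.
    exact: measurable_tail_weight2.
  - by move=> r _; rewrite mule_ge0// lee_fin tail_weight_ge0.
  - by rewrite lee_fin half_line_monotone_ge0.
rewrite (fubini_tonelli F mF F0); apply: eq_integral => r _.
transitivity (\int[mu]_t (k r * (Num.max r 0)%:E * ((M t)%:E * (\1_(`]-oo, r]%classic) t)%:E))).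
  apply: eq_integral => t _; rewrite /F /tail_weight /= EFinM -!muleA.
  congr (_ * (_ * _)); rewrite muleC; congr (_ * (nat_of_bool _)%:R%:E).
  by apply/idP/idP => [yt|/set_mem/=]; [apply/mem_set => /=|];
    rewrite in_itv /=.
rewrite ge0_integralZl//; first last.
- by rewrite mule_ge0// lee_fin le_max lexx orbT.
- by move=> t _; rewrite mule_ge0// lee_fin ?half_line_monotone_ge0.
- by apply: emeasurable_funM => //; exact/measurable_EFinP/measurable_indic.
rewrite EFinM muleA primitiveE; congr (_ * _).
rewrite [RHS]integral_mkcond; apply: eq_integral => t _.
by rewrite patchE indicE; case: ifP => _; rewrite ?mule1 ?mule0.
Qed.

End props.

Lemma Gamma_mono_primitives (M rho : R -> R) :
  half_line_monotone M -> Gamma_mono M rho ->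
  (primitive M h / (rho h * M h) @[h --> 0^'+] --> (1:R))%R /\
  Gamma_mono (fun r => Num.max r 0 * primitive M r)%R rho.
Proof.
move=> HM GM; have Mpos := (let: And5 _ H _ _ _ := GM in H).
have bd (a b : R) : (0 < a -> a <= b ->
    (b - a) * M a <= primitive M b - primitive M a <= (b - a) * M b)%R.
  by move=> _; exact: primitive_bound.
split; first exact: (Gamma_mono_primitive GM bd (primitive_cvg0 HM)).
have [m1 m2 m3 m4 m5] := Gamma_mono_mul_primitive GM bd (primitive_cvg0 HM)
  (primitive_gt0 HM Mpos).
split => //.
- by move=> x y x0 xy; exact: (half_line_monotone_mul_primitive HM).2.
- by move=> x x0; rewrite max_l ?m2// ltW.
- move=> x; apply: (near_eq_lim _ (m5 x)); near=> h.
  have h0 : (0 < h)%R by near: h; exact: near0_gt0.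
  have hx : (0 < h + rho h * x)%R by near: h; exact: (shift_gt0 GM).
  by rewrite !max_l ?ltW.
Unshelve. all: by end_near. Qed.

End primitive_of_monotone.

(** * The plane together with an independent remainder *)

Section planar_space.
Local Open Scope ereal_scope.
Context {R : realType} {d : measure_display} {T : measurableType d}.
Variables (P : probability T R) (W : T -> R).
Hypotheses (mW : measurable_fun setT W) (W0 : forall x, (0 <= W x)%R).
Local Notation mu := (@lebesgue_measure R).
Local Notation RR := (measurableTypeR R * measurableTypeR R)%type.
Local Notation Q := (planar_measure \x P).

Definition radius (q : RR * T) : R := Num.sqrt (q.1.1 ^+ 2 + q.1.2 ^+ 2 + W q.2).

Lemma measurable_planar_radius : measurable_fun setT radius.
Proof.
apply: (measurableT_comp measurable_sqrt); apply: measurable_funD.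
  apply: measurable_funD; apply: measurable_funX.
    exact: (measurableT_comp measurable_fst measurable_fst).
  exact: (measurableT_comp measurable_snd measurable_fst).
exact: (measurableT_comp mW measurable_snd).
Qed.

Implicit Types (k : R -> \bar R) (a : R -> R).

Let mw k : measurable_fun setT k -> measurable_fun setT (fun q => k (radius q)).
Proof. by move=> mk; exact: (measurableT_comp mk measurable_planar_radius). Qed.

Let mfst a : measurable_fun setT a -> measurable_fun setT (fun q : RR * T => (a q.1.1)%:E).
Proof.
move=> ma; apply/measurable_EFinP; apply: (measurableT_comp ma).
exact: (measurableT_comp measurable_fst measurable_fst).
Qed.

Let msnd a : measurable_fun setT a -> measurable_fun setT (fun q : RR * T => (a q.1.2)%:E).
Proof.
move=> ma; apply/measurable_EFinP; apply: (measurableT_comp ma).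
exact: (measurableT_comp measurable_snd measurable_fst).
Qed.

Let iterated (G : RR * T -> \bar R) : measurable_fun setT G -> (forall q, 0 <= G q) ->
  \int[Q]_q G q = \int[P]_w \int[mu]_y \int[mu]_x G ((x, y), w) /\
  \int[Q]_q G q = \int[P]_w \int[mu]_x \int[mu]_y G ((x, y), w).
Proof.
move=> mG G0; rewrite (ge0_integral_planar_prod P mG G0).
have mGw w : measurable_fun setT (fun z : RR => G (z, w)).
  exact: (measurableT_comp mG (measurable_pair2 w)).
split; apply: eq_integral => w _.
  exact: (ge0_integral_planar (mGw w) (fun=> G0 _)).1.
exact: (ge0_integral_planar (mGw w) (fun=> G0 _)).2.
Qed.

(** The factor [a q.1.2] leaves room for a weight in the second coordinate, which
    [planar_weight_snd] then removes in turn. *)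
Lemma planar_weight_fst k a : measurable_fun setT k -> (forall x, 0 <= k x) ->
  measurable_fun setT a -> (forall x, (0 <= a x)%R) ->
  \int[Q]_q (k (radius q) * (q.1.1 ^+ 2)%:E * (a q.1.2)%:E) =
  \int[Q]_q (radial_tail k (radius q) * (a q.1.2)%:E).
Proof.
move=> mk k0 ma a0.
have rk0 t : 0 <= radial_tail k t by exact: radial_tail_ge0.
have mrk := measurable_radial_tail mk k0.
have m2 : measurable_fun setT (fun q : RR * T => (q.1.1 ^+ 2)%:E).
  by apply: (mfst (a := fun x => x ^+ 2)%R); exact: measurable_funX.
rewrite [LHS](iterated _ _).1; first last.
- by move=> q; rewrite !mule_ge0 ?lee_fin ?sqr_ge0.
- apply: emeasurable_funM; last exact: msnd.
  by apply: emeasurable_funM => //; exact: mw.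
rewrite [RHS](iterated _ _).1; first last.
- by move=> q; rewrite !mule_ge0 ?lee_fin.
- by apply: emeasurable_funM; [exact: mw|exact: msnd].
apply: eq_integral => w _; apply: eq_integral => y _ /=.
have s0 : (0 <= y ^+ 2 + W w)%R by rewrite addr_ge0 ?sqr_ge0.
rewrite ge0_integralZr//; first last.
- by rewrite lee_fin.
- by move=> x _; rewrite mule_ge0 ?lee_fin ?sqr_ge0.
- apply: emeasurable_funM; last by apply/measurable_EFinP; exact: measurable_funX.
  have := measurableT_comp mk (measurable_radius (y ^+ 2 + W w)).
  by apply: eq_measurable_fun => x _; rewrite /radius /= addrA.
rewrite ge0_integralZr//; first last.
- by rewrite lee_fin.
- have := measurableT_comp mrk (measurable_radius (y ^+ 2 + W w)).
  by apply: eq_measurable_fun => x _; rewrite /radius /= addrA.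
congr (_ * _); rewrite /radius /=.
under eq_integral do rewrite -addrA.
by under [RHS]eq_integral do rewrite -addrA; exact: radial_tail_sqr.
Qed.

Lemma planar_weight_snd k : measurable_fun setT k -> (forall x, 0 <= k x) ->
  \int[Q]_q (k (radius q) * (q.1.2 ^+ 2)%:E) =
  \int[Q]_q (radial_tail k (radius q)).
Proof.
move=> mk k0.
have rk0 t : 0 <= radial_tail k t by exact: radial_tail_ge0.
have mrk := measurable_radial_tail mk k0.
have m2 : measurable_fun setT (fun q : RR * T => (q.1.2 ^+ 2)%:E).
  by apply: (msnd (a := fun x => x ^+ 2)%R); exact: measurable_funX.
rewrite [LHS](iterated _ _).2; first last.
- by move=> q; rewrite !mule_ge0 ?lee_fin ?sqr_ge0.
- by apply: emeasurable_funM => //; exact: mw.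
rewrite [RHS](iterated _ _).2; first last.
- by move=> q; exact: rk0.
- exact: mw.
apply: eq_integral => w _; apply: eq_integral => x _ /=.
have s0 : (0 <= x ^+ 2 + W w)%R by rewrite addr_ge0 ?sqr_ge0.
rewrite /radius /=; under eq_integral do rewrite addrAC addrC.
by under [RHS]eq_integral do rewrite addrAC addrC; exact: radial_tail_sqr.
Qed.

(** The density of [radius] under the product of Lebesgue measure on the plane
    and [P], see [planar_radius_density].  It is a product of two nondecreasing
    factors, whatever the law of [W] is. *)
Definition radius_density (r : R) : R :=
  (2 * pi * Num.max r 0 * fine (P [set w | (Num.sqrt (W w) <= r)%R]))%R.

Let msqrtW : measurable_fun setT (fun w => Num.sqrt (W w)).
Proof. exact: (measurableT_comp measurable_sqrt). Qed.

Let mball r : measurable [set w | (Num.sqrt (W w) <= r)%R].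
Proof. by rewrite -[X in measurable X]setTI; apply: measurable_fun_ler. Qed.

Lemma half_line_monotone_radius_density : half_line_monotone radius_density.
Proof.
split => [r r0|a b ab]; first by rewrite /radius_density max_r// mulr0 mul0r.
rewrite /radius_density ler_pM//.
- by rewrite mulr_ge0 ?mulr_ge0 ?pi_ge0// le_max lexx orbT.
- exact/fine_ge0/measure_ge0.
- by rewrite ler_pM2l ?mulr_gt0 ?pi_gt0// ge_max !le_max ab lexx !orbT.
- rewrite fine_le ?fin_num_measure// le_measure ?inE//.
  by move=> w /= /le_trans; exact.
Qed.

Lemma planar_radius_density k : measurable_fun setT k -> (forall x, 0 <= k x) ->
  \int[Q]_q k (radius q) = \int[mu]_r (k r * (radius_density r)%:E).
Proof.
move=> mk k0.
rewrite [LHS](iterated _ _).1; first last.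
- by move=> q; exact: k0.
- exact: mw.
have rk0 t : 0 <= radial_tail k t by exact: radial_tail_ge0.
transitivity (\int[P]_w ((2 * pi)%:E * radial_tail k (Num.sqrt (W w)))).
  apply: eq_integral => w _; apply: (etrans _ (planar_radial (W0 w) mk k0)).
  by apply: eq_integral => y _; apply: eq_integral => x _; rewrite /radius /= addrA.
pose F (z : T * measurableTypeR R) : \bar R :=
  k z.2 * (tail_weight (Num.sqrt (W z.1)) z.2)%:E.
have F0 z : 0 <= F z by rewrite mule_ge0 ?lee_fin ?tail_weight_ge0.
have mF : measurable_fun setT F.
  apply: emeasurable_funM; first exact: (measurableT_comp mk measurable_snd).
  apply/measurable_EFinP; apply: measurable_tail_weight2 => //.
  exact: (measurableT_comp msqrtW measurable_fst).
rewrite ge0_integralZl//; first last.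
- by rewrite lee_fin mulr_ge0// pi_ge0.
- exact: (measurable_fun_fubini_tonelli_F (m2 := mu) F mF).
rewrite (fubini_tonelli (m1 := P) (m2 := mu) F mF F0) -ge0_integralZl//; first last.
- by rewrite lee_fin mulr_ge0// pi_ge0.
- by move=> r _; exact: integral_ge0.
- exact: (measurable_fun_fubini_tonelli_G (m1 := P) F mF).
apply: eq_integral => r _.
transitivity ((2 * pi)%:E * \int[P]_w (k r * (Num.max r 0)%:E *
    (\1_[set w | (Num.sqrt (W w) <= r)%R] w)%:E)).
  congr (_ * _); apply: eq_integral => w _; rewrite /F /tail_weight /= EFinM muleA.
  congr (_ * (nat_of_bool _)%:R%:E).
  by apply/idP/idP => [yt|/set_mem//]; exact/mem_set.
rewrite ge0_integralZl//; first last.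
- by rewrite mule_ge0// lee_fin le_max lexx orbT.
- exact/measurable_EFinP/measurable_indic.
rewrite integral_indic// setIT /radius_density !EFinM fineK ?fin_num_measure//.
rewrite -!muleA [RHS]muleCA; congr (_ * _); exact: muleCA.
Qed.

End planar_space.

(** * Independence and decoupling *)

Section independence.
Local Open Scope ereal_scope.
Context {R : realType} {d : measure_display} {T : measurableType d}.
Variable P : probability T R.

(** Independence makes the law of [(A, B)] the product of the two laws, and
    Tonelli integrates the first variable with the second one frozen. *)
Lemma ge0_integral_independent d1 d2 (S1 : measurableType d1)
    (S2 : measurableType d2) (A : T -> S1) (B : T -> S2) (F : S1 * S2 -> \bar R) :
  measurable_fun setT A -> measurable_fun setT B ->
  (forall C D, measurable C -> measurable D ->
     P (A @^-1` C `&` B @^-1` D) = P (A @^-1` C) * P (B @^-1` D)) ->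
  measurable_fun setT F -> (forall z, 0 <= F z) ->
  \int[P]_x F (A x, B x) = \int[P]_y \int[P]_x F (A x, B y).
Proof.
move=> mA mB AB mF F0.
pose A' : {mfun T >-> S1} := HB.pack A (isMeasurableFun.Build _ _ _ _ _ mA).
pose B' : {mfun T >-> S2} := HB.pack B (isMeasurableFun.Build _ _ _ _ _ mB).
pose PA : probability S1 R := distribution P A'.
pose PB : probability S2 R := distribution P B'.
have mAB : measurable_fun setT (fun x => (A x, B x)) by exact: measurable_fun_pair.
transitivity (\int[PA \x PB]_z F z).
  rewrite -(ge0_integral_image_measure P mAB)//.
  apply: eq_measure_integral => U mU _; symmetry.
  by apply: product_measure_unique => // C D mC mD; rewrite image_measureE /= -AB.
rewrite (fubini_tonelli2 F)//.
rewrite (@ge0_integral_distribution _ _ T S2 R P B')//; last 2 first.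
- exact: (measurable_fun_fubini_tonelli_G (m1 := PA) F).
- by move=> y; exact: integral_ge0.
apply: eq_integral => y _ /=; rewrite /fubini_G /=.
rewrite (@ge0_integral_distribution _ _ T S1 R P A')//.
exact: (measurableT_comp mF (measurable_pair2 _)).
Qed.

Section sequence.
Variable Y : nat -> T -> R.
Hypothesis mY : forall p, measurable_fun setT (Y p).
Hypothesis indepY : mutually_independent P Y.

(** An event constrains finitely many coordinates, none of which is [i].  The
    constraints are indexed by all integers, the idle ones being [setT], so that
    the intersection of two events is formed componentwise: these events are a
    pi-system generating the sigma-algebra of the coordinates other than [i]. *)
Definition cylinders_avoiding (i : nat) : set (set T) :=
  [set A | exists B : nat -> set R, [/\ forall p, measurable (B p),
    exists n, forall p, (n <= p)%N -> B p = setT, B i = setT &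
    A = \bigcap_p (Y p @^-1` B p)]].

Let mpre p (C : set R) : measurable C -> measurable (Y p @^-1` C).
Proof. by move=> mC; rewrite -[X in measurable X]setTI; exact: mY. Qed.

Lemma measurable_cylinders_avoiding i A : cylinders_avoiding i A -> measurable A.
Proof.
by move=> [B [mB _ _ ->]]; apply: bigcapT_measurable => p; exact: mpre.
Qed.

Let bigcap_seq (B : nat -> set R) (n : nat) (s : seq nat) :
  (forall p, (n <= p)%N -> B p = setT) -> (forall p, (p < n)%N -> p \in s) ->
  \bigcap_p (Y p @^-1` B p) = \bigcap_(p in [set` s]) (Y p @^-1` B p).
Proof.
move=> BT sn; apply/seteqP; split => x H p /= ps; first exact: H.
have [np|pn] := leqP n p; first by rewrite BT.
exact/H/sn.
Qed.

Lemma independent_cylinder i C A : measurable C -> cylinders_avoiding i A ->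
  P (Y i @^-1` C `&` A) = P (Y i @^-1` C) * P A.
Proof.
move=> mC [B [mB [n Bn] Bi ->]].
(* The missing constraint on coordinate [i] is filled by [C]. *)
pose B' p := if p == i then C else B p.
pose s := iota 0 (maxn n i.+1).
have us : uniq s by exact: iota_uniq.
have ins p : (p \in s) = (p < maxn n i.+1)%N by rewrite mem_iota.
have iins : i \in s by rewrite ins leq_max ltnSn orbT.
have -> : Y i @^-1` C `&` \bigcap_p (Y p @^-1` B p) =
    \bigcap_(p in [set` s]) (Y p @^-1` B' p).
  rewrite -(@bigcap_seq B' (maxn n i.+1)).
  - apply/seteqP; split => x.
      move=> [Ci H] p _; rewrite /B' /=; case: eqP => [->//|_]; exact: H.
    move=> H; split; first by have := H i Logic.I; rewrite /B' /= eqxx.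
    move=> p _; have := H p Logic.I; rewrite /B' /=; case: eqP => // ->.
    by rewrite Bi.
  - move=> p; rewrite geq_max => /andP[np ip]; rewrite /B'.
    by rewrite gtn_eqF// Bn.
  - by move=> p; rewrite ins.
rewrite (@bigcap_seq B n s) //; last first.
  by move=> p pn; rewrite ins leq_max pn.
rewrite !indepY//; last first.
  by move=> p; rewrite /B'; case: ifP.
rewrite !(bigD1_seq i)//= Bi preimage_setT probability_setT mul1e {1}/B' eqxx.
by congr (_ * _); apply: eq_bigr => p pi; rewrite /B' (negbTE pi).
Qed.

(** For a fixed [C] both sides are finite measures in [A], and they agree on a
    pi-system. *)
Lemma independent_g_sigma i C A : measurable C ->
  <<s cylinders_avoiding i >> A ->
  P (Y i @^-1` C `&` A) = P (Y i @^-1` C) * P A.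
Proof.
move=> mC sA; have mE := mpre i mC.
pose m1 : {measure set T -> \bar R} := mrestr P mE.
pose c : {nonneg R} := NngNum (fine_ge0 (measure_ge0 P (Y i @^-1` C))).
pose m2 : {measure set T -> \bar R} := mscale c P.
have m2E B : m2 B = P (Y i @^-1` C) * P B.
  by rewrite /m2 /= /mscale/= fineK//; exact: fin_num_measure.
rewrite -m2E setIC; change (m1 A = m2 A).
apply: (@g_sigma_algebra_measure_unique _ _ _ (cylinders_avoiding i) _ (fun=> setT)) => //.
- exact: measurable_cylinders_avoiding.
- by move=> _; exists (fun=> setT); split=> //; [exists 0%N|rewrite bigcapT].
- by rewrite bigcup_const//; exists 0%N.
- move=> _ _ [B [mB [n Bn] Bi ->]] [B' [mB' [n' Bn'] Bi' ->]].
  exists (fun p => B p `&` B' p); split.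
  + by move=> p; exact: measurableI.
  + exists (maxn n n') => p; rewrite geq_max => /andP[np np'].
    by rewrite Bn// Bn'// setIT.
  + by rewrite Bi Bi' setIT.
  + by rewrite -bigcapI; apply: eq_bigcap.
- by move=> B cB; rewrite m2E -independent_cylinder// setIC.
- move=> _; rewrite /m1 /= /mrestr setTI.
  by rewrite ltey_eq fin_num_measure.
Qed.

Let TT i := g_sigma_algebraType (cylinders_avoiding i).

Lemma cylinder_measurable_coordinate i p : p != i ->
  measurable_fun [set: TT i] (Y p : TT i -> R).
Proof.
move=> pi _ C mC; rewrite setTI; apply: sub_sigma_algebra.
exists (fun q => if q == p then C else setT); split.
- by move=> q; case: ifP.
- by exists p.+1 => q pq; rewrite gtn_eqF.
- by rewrite eq_sym (negbTE pi).
- apply/seteqP; split => x.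
    by move=> Cx q _ /=; case: eqP => // ->.
  by move/(_ p Logic.I) => /=; rewrite eqxx.
Qed.

Lemma independent_measurable i d2 (S : measurableType d2) (B : T -> S) C D :
  measurable_fun [set: TT i] (B : TT i -> S) ->
  measurable C -> measurable D ->
  P (Y i @^-1` C `&` B @^-1` D) = P (Y i @^-1` C) * P (B @^-1` D).
Proof.
move=> mB mC mD; apply: independent_g_sigma => //.
by have := mB measurableT _ mD; rewrite setTI.
Qed.

Lemma g_sigma_measurable i d2 (S : measurableType d2) (B : T -> S) :
  measurable_fun [set: TT i] (B : TT i -> S) -> measurable_fun [set: T] B.
Proof.
move=> mB _ D mD; have := mB measurableT _ mD; rewrite !setTI.
apply: smallest_sub; first exact: sigma_algebra_measurable.
exact: measurable_cylinders_avoiding.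
Qed.

End sequence.

Lemma ge0_integral_has_density (Y : T -> R) (f : R -> R) (k : R -> \bar R) :
  measurable_fun setT Y -> has_density_on P setT Y f ->
  measurable_fun setT k -> (forall x, 0 <= k x) ->
  \int[P]_x k (Y x) = \int[lebesgue_measure]_y (k y * (f y)%:E).
Proof.
move=> mY [mf f0 Pf] mk k0.
have f0' y : (0 <= f y)%R by exact: f0.
have mY' : measurable_fun setT (Y : T -> measurableTypeR R) by exact: mY.
rewrite -(ge0_integral_density lebesgue_measure mf f0')//.
rewrite -(ge0_integral_image_measure P mY')//.
by apply: eq_measure_integral => A mA _; exact: (Pf A mA).
Qed.

Section decoupling.
Local Notation mu := (@lebesgue_measure R).
Variables (Y1 Y2 W : T -> R) (f1 f2 : R -> R).
Hypotheses (mY1 : measurable_fun setT Y1) (mY2 : measurable_fun setT Y2)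
  (mW : measurable_fun setT W).
Hypothesis indep1 : forall C D, measurable C -> measurable D ->
  P (Y1 @^-1` C `&` (fun x => (Y2 x, W x)) @^-1` D) =
  P (Y1 @^-1` C) * P ((fun x => (Y2 x, W x)) @^-1` D).
Hypothesis indep2 : forall C D, measurable C -> measurable D ->
  P (Y2 @^-1` C `&` W @^-1` D) = P (Y2 @^-1` C) * P (W @^-1` D).
Hypotheses (df1 : has_density_on P setT Y1 f1) (df2 : has_density_on P setT Y2 f2).

Local Notation RR := (measurableTypeR R * measurableTypeR R)%type.

Let mf1 : measurable_fun [set: measurableTypeR R] f1. Proof. by case: df1. Qed.
Let mf2 : measurable_fun [set: measurableTypeR R] f2. Proof. by case: df2. Qed.
Let f10 y : (0 <= f1 y)%R. Proof. by case: df1 => _ + _; exact. Qed.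
Let f20 y : (0 <= f2 y)%R. Proof. by case: df2 => _ + _; exact. Qed.

(** [Y1] is integrated first, with [(Y2, W)] frozen, then [Y2] with [W] frozen;
    each time the law of the variable is replaced by its density.  The variable
    [W] stays random. *)
Lemma decoupling (F : RR * measurableTypeR R -> \bar R) :
  measurable_fun setT F -> (forall z, 0 <= F z) ->
  \int[P]_x F ((Y1 x, Y2 x), W x) =
  \int[planar_measure \x P]_q (F (q.1, W q.2) * (f1 q.1.1 * f2 q.1.2)%:E).
Proof.
move=> mF F0.
pose F1 (z : R * (R * R)) := F ((z.1, z.2.1), z.2.2).
have mF1 : measurable_fun setT F1.
  apply: (measurableT_comp mF); apply: measurable_fun_pair.
    apply: measurable_fun_pair => //.
    exact: (measurableT_comp measurable_fst measurable_snd).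
  exact: (measurableT_comp measurable_snd measurable_snd).
have mY2W : measurable_fun setT (fun x => (Y2 x, W x)) by exact: measurable_fun_pair.
rewrite (@ge0_integral_independent _ _ _ _ Y1 (fun x => (Y2 x, W x)) F1)//;
  last by move=> z; exact: F0.
have F1dens x : \int[P]_y F1 (Y1 y, (Y2 x, W x)) =
    \int[mu]_y (F ((y, Y2 x), W x) * (f1 y)%:E).
  rewrite (ge0_integral_has_density mY1 df1 (k := fun y => F ((y, Y2 x), W x)))//.
  exact: (measurableT_comp mF1 (measurable_pair2 (Y2 x, W x))).
under eq_integral do rewrite F1dens.
pose H (z : (R * R) * measurableTypeR R) : \bar R := F ((z.2, z.1.1), z.1.2) * (f1 z.2)%:E.
have mH : measurable_fun setT H.
  apply: emeasurable_funM.
    apply: (measurableT_comp mF); apply: measurable_fun_pair.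
      apply: measurable_fun_pair => //.
      exact: (measurableT_comp measurable_fst measurable_fst).
    exact: (measurableT_comp measurable_snd measurable_fst).
  by apply/measurable_EFinP; exact: (measurableT_comp mf1).
have H0 z : 0 <= H z by rewrite mule_ge0// lee_fin.
pose F2 (z : R * R) := \int[mu]_y H (z, y).
have mF2 : measurable_fun setT F2.
  exact: (measurable_fun_fubini_tonelli_F (m2 := mu) H mH).
have F20 z : 0 <= F2 z by exact: integral_ge0.
rewrite (@ge0_integral_independent _ _ _ _ Y2 W F2)//.
pose G (q : RR * T) : \bar R := F (q.1, W q.2) * (f1 q.1.1 * f2 q.1.2)%:E.
have mG : measurable_fun setT G.
  apply: emeasurable_funM.
    apply: (measurableT_comp mF); apply: measurable_fun_pair => //.
    exact: (measurableT_comp mW measurable_snd).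
  apply/measurable_EFinP; apply: measurable_funM.
    apply: (measurableT_comp mf1).
    exact: (measurableT_comp measurable_fst measurable_fst).
  apply: (measurableT_comp mf2).
  exact: (measurableT_comp measurable_snd measurable_fst).
have G0 q : 0 <= G q by rewrite mule_ge0// lee_fin mulr_ge0.
rewrite (ge0_integral_planar_prod P mG G0).
apply: eq_integral => x _.
rewrite (ge0_integral_has_density mY2 df2 (k := fun y => F2 (y, W x)))//; last first.
  exact: (measurableT_comp mF2 (measurable_pair2 (W x))).
have mGx : measurable_fun setT (fun z : RR => G (z, x)).
  exact: (measurableT_comp mG (measurable_pair2 x)).
rewrite (ge0_integral_planar mGx (fun=> G0 _)).1.
apply: eq_integral => y _; rewrite muleC /F2 -ge0_integralZl//; first last.
- by rewrite lee_fin.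
- exact: (measurableT_comp mH (measurable_pair1 (y, W x))).
by apply: eq_integral => z _; rewrite /H /G /= EFinM [RHS]muleA [RHS]muleC.
Qed.

End decoupling.
End independence.

(** * Comparison of integrals and symmetrization *)

Section comparison.
Context {R : realType} {d : measure_display} {X : measurableType d}.
Variable mu : {measure set X -> \bar R}.

(** A pointwise comparison relative to a nonnegative integrable [G] passes to the
    integrals, and makes [F] integrable; all the asymptotic comparisons below
    come from this one. *)
Lemma integral_comparison (F G : X -> R) (c eps : R) :
  measurable_fun setT F -> mu.-integrable setT (EFin \o G) ->
  (forall x, 0 <= G x) -> 0 <= eps ->
  (forall x, `|F x - c * G x| <= eps * G x) ->
  mu.-integrable setT (EFin \o F) /\
  `|\int[mu]_x F x - c * \int[mu]_x G x| <= eps * \int[mu]_x G x.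
Proof.
move=> mF iG G0 eps0 FG.
have icG (b : R) : mu.-integrable setT (EFin \o (fun x => b * G x)).
  exact: (@integrableZl _ _ _ mu setT measurableT b (EFin \o G)).
have iF : mu.-integrable setT (EFin \o F).
  apply: (le_integrable measurableT _ _ (icG (`|c| + eps))).
    exact/measurable_EFinP.
  move=> x _ /=; rewrite lee_fin [leRHS]ger0_norm; last first.
    by rewrite mulr_ge0// addr_ge0.
  have := ler_normD (F x - c * G x) (c * G x); rewrite subrK normrM.
  by rewrite (ger0_norm (G0 x)) mulrDl => /le_trans; apply; rewrite addrC lerD2l.
split => //; rewrite -RintegralZl// -RintegralB//.
have iFG : mu.-integrable setT (EFin \o (fun x => F x - c * G x)).
  exact: (@integrableB _ _ _ mu setT measurableT (EFin \o F) _ iF (icG c)).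
apply: (le_trans (le_normr_Rintegral measurableT iFG)).
rewrite -RintegralZl//; apply: le_Rintegral => //.
exact: (integrable_norm iFG).
Qed.

End comparison.

Section near_zero.
Context {R : realType}.

(** The predicate [A] allows for difference quotients, which are controlled at
    nonzero points only. *)
Lemma product_near_zero (u v : R -> R) (a b : R) (A : R -> Prop) :
  (forall e, 0 < e -> exists2 eta, 0 < eta & forall x, A x -> `|x| <= eta -> `|u x - a| <= e) ->
  (forall e, 0 < e -> exists2 eta, 0 < eta & forall x, A x -> `|x| <= eta -> `|v x - b| <= e) ->
  forall e, 0 < e -> exists2 eta, 0 < eta & forall x y, A x -> A y ->
    `|x| <= eta -> `|y| <= eta -> `|u x * v y - a * b| <= e.
Proof.
move=> hu hv e e0; pose dl := Num.min 1 (e / (`|a| + `|b| + 1)).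
have s0 : 0 < `|a| + `|b| + 1 by rewrite ltr_wpDl// addr_ge0.
have dl0 : 0 < dl by rewrite lt_min ltr01 divr_gt0.
have dl1 : dl <= 1 by rewrite ge_min lexx.
have dle : dl * (`|a| + `|b| + 1) <= e.
  by rewrite -ler_pdivlMr// ge_min lexx orbT.
have [e1 e10 h1] := hu _ dl0; have [e2 e20 h2] := hv _ dl0.
exists (Num.min e1 e2); first by rewrite lt_min e10.
move=> x y Ax Ay; rewrite !le_min => /andP[x1 _] /andP[_ y2].
have := h1 _ Ax x1; have := h2 _ Ay y2.
set p := u x - a; set q := v y - b => qd pd.
have -> : u x * v y - a * b = p * q + (p * b + a * q) by rewrite /p /q; ring.
have pq : `|p * q| <= dl by rewrite normrM -[leRHS]mulr1 ler_pM// (le_trans qd).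
have pb : `|p * b| <= dl * `|b| by rewrite normrM ler_wpM2r.
have aq : `|a * q| <= `|a| * dl by rewrite normrM ler_wpM2l.
have := ler_normD (p * q) (p * b + a * q); have := ler_normD (p * b) (a * q).
nra.
Qed.

Lemma continuous_near_zero (u : R -> R) : {for 0, continuous u} ->
  forall e, 0 < e -> exists2 eta, 0 < eta & forall x, True -> `|x| <= eta -> `|u x - u 0| <= e.
Proof.
move=> /cvgrPdist_le cu e e0; have [eta /= eta0 H] := cu _ e0.
exists (eta / 2); first by rewrite divr_gt0.
move=> x _ xe; rewrite distrC; apply: H => /=; rewrite sub0r normrN; lra.
Qed.

(** The symmetric difference quotient is the average of two difference quotients
    at [0], along [x] and along [- x]. *)
Lemma derive_near_zero (u : R -> R) (a : R) : is_derive (0:R) (1:R) u a ->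
  forall e, 0 < e -> exists2 eta, 0 < eta & forall x, x != 0 -> `|x| <= eta ->
    `|(u x - u (- x)) / (2 * x) - a| <= e.
Proof.
move=> [du ua] e e0.
have : h^-1 *: (u (h *: 1 + 0) - u 0) @[h --> 0^'] --> a.
  by have := du; rewrite /derivable => /cvg_ex[l hl]; rewrite -ua /derive (cvg_lim _ hl).
move=> /cvgrPdist_le/(_ _ e0)[eta /= eta0 H].
exists (eta / 2); first by rewrite divr_gt0.
have {}H x : x != 0 -> `|x| <= eta / 2 -> `|a - (u x - u 0) / x| <= e.
  move=> x0 xe; have := H x _ x0; rewrite /= sub0r normrN.
  have -> : `|x| < eta by lra.
  move=> /(_ isT); rewrite /GRing.scale /= mulr1 addr0.
  by rewrite [_ * (u x - u 0)]mulrC.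
move=> x x0 xe; have h1 := H x x0 xe.
have h2 : `|a - (u (- x) - u 0) / - x| <= e by apply: H; rewrite ?oppr_eq0 ?normrN.
have -> : (u x - u (- x)) / (2 * x) - a =
  - ((a - (u x - u 0) / x) + (a - (u (- x) - u 0) / - x)) / 2.
  by field.
rewrite normrM normrN [`|2^-1|]ger0_norm ?invr_ge0//.
have := ler_normD (a - (u x - u 0) / x) (a - (u (- x) - u 0) / - x); lra.
Qed.

End near_zero.

Section reflections.
Local Open Scope ereal_scope.
Context {R : realType} {d : measure_display} {T : measurableType d}.
Variables (P : probability T R).
Local Notation mu := (@lebesgue_measure R).
Local Notation RR := (measurableTypeR R * measurableTypeR R)%type.
Local Notation Q := (planar_measure \x P).

Definition reflect_fst (q : RR * T) : RR * T := (((- q.1.1)%R, q.1.2), q.2).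
Definition reflect_snd (q : RR * T) : RR * T := ((q.1.1, (- q.1.2)%R), q.2).

Lemma measurable_reflect_fst : measurable_fun setT reflect_fst.
Proof.
apply: measurable_fun_pair => //; apply: measurable_fun_pair.
  apply: (measurableT_comp (@oppr_measurable R setT)).
  exact: (measurableT_comp measurable_fst measurable_fst).
exact: (measurableT_comp measurable_snd measurable_fst).
Qed.

Lemma measurable_reflect_snd : measurable_fun setT reflect_snd.
Proof.
apply: measurable_fun_pair => //; apply: measurable_fun_pair.
  exact: (measurableT_comp measurable_fst measurable_fst).
apply: (measurableT_comp (@oppr_measurable R setT)).
exact: (measurableT_comp measurable_snd measurable_fst).
Qed.

Let section_meas (G : RR * T -> \bar R) w : measurable_fun setT G ->
  measurable_fun setT (fun z : RR => G (z, w)).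
Proof. by move=> mG; exact: (measurableT_comp mG (measurable_pair2 w)). Qed.

Lemma ge0_integral_reflect_fst (G : RR * T -> \bar R) :
  measurable_fun setT G -> (forall q, 0 <= G q) ->
  \int[Q]_q G (reflect_fst q) = \int[Q]_q G q.
Proof.
move=> mG G0.
have mGr : measurable_fun setT (G \o reflect_fst).
  exact: (measurableT_comp mG measurable_reflect_fst).
rewrite [LHS](ge0_integral_planar_prod P mGr (fun=> G0 _)).
rewrite [RHS](ge0_integral_planar_prod P mG G0); apply: eq_integral => w _.
rewrite [LHS](ge0_integral_planar (section_meas w mGr) (fun=> G0 _)).1.
rewrite [RHS](ge0_integral_planar (section_meas w mG) (fun=> G0 _)).1.
apply: eq_integral => y _; rewrite -[RHS]ge0_integral_reflect//.
exact: (measurableT_comp (section_meas w mG) (measurable_pair2 y)).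
Qed.

Lemma ge0_integral_reflect_snd (G : RR * T -> \bar R) :
  measurable_fun setT G -> (forall q, 0 <= G q) ->
  \int[Q]_q G (reflect_snd q) = \int[Q]_q G q.
Proof.
move=> mG G0.
have mGr : measurable_fun setT (G \o reflect_snd).
  exact: (measurableT_comp mG measurable_reflect_snd).
rewrite [LHS](ge0_integral_planar_prod P mGr (fun=> G0 _)).
rewrite [RHS](ge0_integral_planar_prod P mG G0); apply: eq_integral => w _.
rewrite [LHS](ge0_integral_planar (section_meas w mGr) (fun=> G0 _)).2.
rewrite [RHS](ge0_integral_planar (section_meas w mG) (fun=> G0 _)).2.
apply: eq_integral => x _; rewrite -[RHS]ge0_integral_reflect//.
exact: (measurableT_comp (section_meas w mG) (measurable_pair1 x)).
Qed.

Section invariance.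
Variable s : RR * T -> RR * T.
Hypothesis ms : measurable_fun setT s.
Hypothesis s_inv : forall G : RR * T -> \bar R, measurable_fun setT G ->
  (forall q, 0 <= G q) -> \int[Q]_q G (s q) = \int[Q]_q G q.
Variable F : RR * T -> R.
Hypothesis iF : Q.-integrable setT (EFin \o F).

Let mF : measurable_fun setT (EFin \o F). Proof. exact: measurable_int iF. Qed.

Lemma integrable_invariant : Q.-integrable setT (EFin \o (F \o s)).
Proof.
apply/integrableP; split; first exact: (measurableT_comp mF ms).
rewrite (s_inv (G := fun q => `|(F q)%:E|))//; first by have /integrableP[] := iF.
exact: (measurableT_comp (@abse_measurable R setT) mF).
Qed.

Lemma Rintegral_invariant : (\int[Q]_q F (s q) = \int[Q]_q F q)%R.
Proof.
rewrite /Rintegral; congr fine; rewrite integralE [RHS]integralE; congr (_ - _).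
  transitivity (\int[Q]_q (EFin \o F)^\+ (s q)).
    by apply: eq_integral => q _; rewrite !funeposE.
  by rewrite (s_inv (measurable_funepos mF))// => q; exact: funepos_ge0.
transitivity (\int[Q]_q (EFin \o F)^\- (s q)).
  by apply: eq_integral => q _; rewrite !funenegE.
by rewrite (s_inv (measurable_funeneg mF))// => q; exact: funeneg_ge0.
Qed.

(** Symmetrizing kills the part of [F] that is odd under [s], which is where the
    cancellations of [product_coordinates_comparison] come from. *)
Lemma Rintegral_symmetrize :
  (\int[Q]_q F q = \int[Q]_q ((F q + F (s q)) / 2))%R /\
  Q.-integrable setT (EFin \o (fun q => (F q + F (s q)) / 2))%R.
Proof.
have iFs := integrable_invariant.
have iD : Q.-integrable setT (EFin \o (fun q => F q + F (s q))%R).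
  exact: (@integrableD _ _ _ Q setT measurableT _ _ iF iFs).
split; last first.
  rewrite (_ : _ \o _ = fun q => (2^-1)%:E * (EFin \o (fun q => F q + F (s q))%R) q).
    exact: (@integrableZl _ _ _ Q setT measurableT (2^-1)%R _ iD).
  by apply/funext => q /=; rewrite [in LHS]mulrC EFinM.
transitivity (\int[Q]_q (2^-1 * (F q + F (s q))))%R; last first.
  by apply: eq_Rintegral => q _; rewrite mulrC.
rewrite RintegralZl// RintegralD// Rintegral_invariant.
by field.
Qed.

End invariance.
End reflections.

(** * Expectations of radial functions of two coordinates *)

Section two_coordinates.
Context {R : realType} {d : measure_display} {T : measurableType d}.
Variable P : probability T R.
Local Notation mu := (@lebesgue_measure R).
Local Notation RR := (measurableTypeR R * measurableTypeR R)%type.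
Local Notation Q := (planar_measure \x P)%E.
Variables (Y1 Y2 W : T -> R) (f1 f2 : R -> R).
Hypotheses (mY1 : measurable_fun setT Y1) (mY2 : measurable_fun setT Y2)
  (mW : measurable_fun setT W) (W0 : forall w, 0 <= W w).
Hypothesis indep1 : forall C D, measurable C -> measurable D ->
  P (Y1 @^-1` C `&` (fun x => (Y2 x, W x)) @^-1` D) =
  (P (Y1 @^-1` C) * P ((fun x => (Y2 x, W x)) @^-1` D))%E.
Hypothesis indep2 : forall C D, measurable C -> measurable D ->
  P (Y2 @^-1` C `&` W @^-1` D) = (P (Y2 @^-1` C) * P (W @^-1` D))%E.
Hypotheses (df1 : has_density_on P setT Y1 f1) (df2 : has_density_on P setT Y2 f2).

Local Notation rad := (radius W).
Local Notation S := (fun w => Num.sqrt (Y1 w ^+ 2 + Y2 w ^+ 2 + W w)).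

Let mf1 : measurable_fun [set: measurableTypeR R] f1. Proof. by case: df1. Qed.
Let mf2 : measurable_fun [set: measurableTypeR R] f2. Proof. by case: df2. Qed.
Let f10 y : 0 <= f1 y. Proof. by case: df1 => _ + _; exact. Qed.
Let f20 y : 0 <= f2 y. Proof. by case: df2 => _ + _; exact. Qed.
Let f12 (q : RR * T) := f1 q.1.1 * f2 q.1.2.

Let mx : measurable_fun setT (fun q : RR * T => q.1.1).
Proof. exact: (measurableT_comp measurable_fst measurable_fst). Qed.
Let my : measurable_fun setT (fun q : RR * T => q.1.2).
Proof. exact: (measurableT_comp measurable_snd measurable_fst). Qed.
Let mrad : measurable_fun setT rad. Proof. exact: measurable_planar_radius. Qed.

Let mf12 : measurable_fun setT f12.
Proof.
by apply: measurable_funM; [exact: (measurableT_comp mf1 mx)|exact: (measurableT_comp mf2 my)].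
Qed.

Let f12_ge0 q : 0 <= f12 q. Proof. by rewrite mulr_ge0. Qed.

(** The densities are nonnegative, so multiplying by them commutes with taking
    positive and negative parts. *)
Lemma decoupling_signed (F : RR * measurableTypeR R -> R) :
  measurable_fun setT F ->
  \int[P]_w F ((Y1 w, Y2 w), W w) = \int[Q]_q (F (q.1, W q.2) * (f1 q.1.1 * f2 q.1.2)).
Proof.
move=> mF; have mF' : measurable_fun setT (EFin \o F) by exact/measurable_EFinP.
rewrite /Rintegral; congr fine; rewrite integralE [RHS]integralE; congr (_ - _)%E.
  transitivity (\int[P]_w (EFin \o F)^\+ ((Y1 w, Y2 w), W w))%E.
    by apply: eq_integral => w _; rewrite !funeposE.
  rewrite (decoupling mY1 mY2 mW indep1 indep2 df1 df2 (measurable_funepos mF'));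
    last by move=> z; exact: funepos_ge0.
  apply: eq_integral => q _; rewrite !funeposE /= EFinM.
  by rewrite maxeMl ?mul0e// lee_fin mulr_ge0.
transitivity (\int[P]_w (EFin \o F)^\- ((Y1 w, Y2 w), W w))%E.
  by apply: eq_integral => w _; rewrite !funenegE.
rewrite (decoupling mY1 mY2 mW indep1 indep2 df1 df2 (measurable_funeneg mF'));
  last by move=> z; exact: funeneg_ge0.
apply: eq_integral => q _; rewrite !funenegE /= -mulNr EFinM.
by rewrite maxeMl ?mul0e// lee_fin mulr_ge0.
Qed.

(** The comparisons below are uniform over this class, because they are applied to
    test functions [k r] that vary with the bandwidth, such as [K (r / h)] and its
    products with powers of [r * rho r].  Boundedness makes all the integrals
    finite. *)
Definition cutoff (eta : R) (k : R -> R) : Prop :=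
  [/\ measurable_fun setT k, forall r, 0 <= k r,
      exists B, forall r, k r <= B & forall r, eta < r -> k r = 0].

Lemma cutoff_integrable eta k M : cutoff eta k -> half_line_monotone M ->
  mu.-integrable setT (fun r => (k r * M r)%:E).
Proof.
move=> [mk k0 [B kB] keta] HM; have M0 := half_line_monotone_ge0 HM.
have B0 : 0 <= B by exact: le_trans (k0 0) (kB 0).
have mkM : measurable_fun [set: measurableTypeR R] (fun r => k r * M r).
  by apply: measurable_funM => //; exact: measurable_half_line_monotone.
have fin : (mu `[0%R, eta]%classic < +oo)%E.
  by rewrite lebesgue_measure_itv /=; case: ifP => _; rewrite ?ltry// -EFinB ltry.
apply: (@le_integrable _ _ _ mu _ measurableT _
    (fun r => ((B * M eta)%:E * (\1_(`[0%R, eta]%classic) r)%:E)%E)).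
- exact/measurable_EFinP.
- move=> r _ /=; rewrite !ger0_norm ?mulr_ge0// lee_fin indicE.
  have [r0|r0] := leP r 0; first by rewrite (HM.1 r r0) mulr0 !mulr_ge0.
  have [re|re] := leP r eta; last by rewrite keta// mul0r !mulr_ge0.
  rewrite mem_set/= ?in_itv/= ?(ltW r0)// mulr1.
  by apply: ler_pM => //; exact: HM.2.
- apply: integrableZl => //; apply/integrableP; split.
    exact/measurable_EFinP/measurable_indic.
  under eq_integral do rewrite gee0_abs ?lee_fin//.
  by rewrite integral_indic// setIT.
Qed.

(** The densities that rule the radius under the weights [1], [x ^+ 2] and
    [x ^+ 2 * y ^+ 2], see [planar0], [planar1] and [planar2]. *)
Let M0 := radius_density P W.
Let HM0 : half_line_monotone M0.
Proof. exact: half_line_monotone_radius_density. Qed.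
Let M1 r := Num.max r 0 * primitive M0 r.
Let HM1 : half_line_monotone M1.
Proof. exact: half_line_monotone_mul_primitive. Qed.
Let M2 r := Num.max r 0 * primitive M1 r.
Let HM2 : half_line_monotone M2.
Proof. exact: half_line_monotone_mul_primitive. Qed.

Section test_function.
Variables (eta : R) (k : R -> R).
Hypothesis Hk : cutoff eta k.

Let mk : measurable_fun setT k. Proof. by case: Hk. Qed.
Let k0 r : 0 <= k r. Proof. by case: Hk. Qed.
Let mkE : measurable_fun setT (EFin \o k). Proof. exact/measurable_EFinP. Qed.
Let kE0 r : (0 <= (EFin \o k) r)%E. Proof. by rewrite lee_fin. Qed.
Let mkr : measurable_fun setT (fun q => k (rad q)).
Proof. exact: (measurableT_comp mk mrad). Qed.

Let from_nonneg (G : RR * T -> R) (M : R -> R) : half_line_monotone M ->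
  measurable_fun setT G -> (forall q, 0 <= G q) ->
  (\int[Q]_q (G q)%:E = \int[mu]_r (k r * M r)%:E)%E ->
  Q.-integrable setT (EFin \o G) /\ \int[Q]_q G q = \int[mu]_r (k r * M r).
Proof.
move=> HM mG G0 E; split; last by rewrite /Rintegral E.
apply/integrableP; split; first exact/measurable_EFinP.
under eq_integral do rewrite gee0_abs ?lee_fin//.
rewrite E; have /integrableP[_] := cutoff_integrable Hk HM.
rewrite (eq_integral (fun r : measurableTypeR R => (k r * M r)%:E))// => r _.
by rewrite gee0_abs// lee_fin mulr_ge0// half_line_monotone_ge0.
Qed.

Let planar_tail :
  (\int[mu]_r (radial_tail (EFin \o k) r * (M0 r)%:E) = \int[mu]_r (k r * M1 r)%:E)%E.
Proof.
by rewrite (integral_radial_tail_mul HM0)//; apply: eq_integral => r _; rewrite EFinM.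
Qed.

Lemma planar0 : Q.-integrable setT (EFin \o (fun q => k (rad q))) /\
  \int[Q]_q k (rad q) = \int[mu]_r (k r * M0 r).
Proof.
apply: (from_nonneg HM0 mkr (fun=> k0 _)).
by apply: (etrans (planar_radius_density P mW W0 mkE kE0)); apply: eq_integral => r _;
  rewrite EFinM.
Qed.

Lemma planar1 : Q.-integrable setT (EFin \o (fun q => q.1.1 ^+ 2 * k (rad q))) /\
  \int[Q]_q (q.1.1 ^+ 2 * k (rad q)) = \int[mu]_r (k r * M1 r).
Proof.
apply: (from_nonneg HM1).
- by apply: measurable_funM => //; exact: measurable_funX.
- by move=> q; rewrite mulr_ge0// sqr_ge0.
have := @planar_weight_fst _ _ _ P W mW W0 (EFin \o k) (cst 1) mkE kE0
  (@measurable_cst _ _ _ _ _ _) (fun=> ler01).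
under eq_integral do rewrite mule1.
under [X in _ = X -> _]eq_integral do rewrite mule1.
rewrite (planar_radius_density P mW W0 (measurable_radial_tail mkE kE0)
  (fun t => radial_tail_ge0 t kE0)) planar_tail => <-.
by apply: eq_integral => q _; rewrite EFinM muleC.
Qed.

(** Each of the two weights costs one radial tail, and each tail turns into one
    step from a density to [r] times its primitive. *)
Lemma planar2 : Q.-integrable setT
    (EFin \o (fun q => q.1.1 ^+ 2 * q.1.2 ^+ 2 * k (rad q))) /\
  \int[Q]_q (q.1.1 ^+ 2 * q.1.2 ^+ 2 * k (rad q)) = \int[mu]_r (k r * M2 r).
Proof.
have mt := measurable_radial_tail mkE kE0.
have t0 := fun t => radial_tail_ge0 t kE0.
apply: (from_nonneg HM2).
- apply: measurable_funM => //; apply: measurable_funM; exact: measurable_funX.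
- by move=> q; apply: mulr_ge0 => //; apply: mulr_ge0; exact: sqr_ge0.
have := @planar_weight_fst _ _ _ P W mW W0 (EFin \o k) (fun y => y ^+ 2) mkE kE0
  (measurable_funX 2 (@measurable_id _ _ _)) (fun y => sqr_ge0 y).
rewrite (planar_weight_snd P mW W0 mt t0).
rewrite (planar_radius_density P mW W0 (measurable_radial_tail mt t0)
  (fun t => radial_tail_ge0 t t0)).
rewrite (integral_radial_tail_mul HM0 mt t0) (integral_radial_tail_mul HM1 mkE kE0).
move=> E; transitivity (\int[Q]_q ((EFin \o k) (rad q) * (q.1.1 ^+ 2)%:E * (q.1.2 ^+ 2)%:E))%E.
  by apply: eq_integral => q _ /=; rewrite -!EFinM; congr EFin; ring.
by rewrite E; apply: eq_integral => r _; rewrite EFinM.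
Qed.

Lemma expectation_planar (psi : RR -> R) : measurable_fun setT psi ->
  \int[P]_w (psi (Y1 w, Y2 w) * k (S w)) = \int[Q]_q (psi q.1 * k (rad q) * f12 q).
Proof.
move=> mpsi.
pose F (z : RR * measurableTypeR R) := psi z.1 * k (Num.sqrt (z.1.1 ^+ 2 + z.1.2 ^+ 2 + z.2)).
rewrite -[RHS](decoupling_signed (F := F))//.
apply: measurable_funM; first exact: (measurableT_comp mpsi measurable_fst).
apply: (measurableT_comp mk); apply: (measurableT_comp measurable_sqrt).
apply: measurable_funD; last exact: measurable_snd.
by apply: measurable_funD; apply: measurable_funX;
  [exact: (measurableT_comp measurable_fst measurable_fst)
  |exact: (measurableT_comp measurable_snd measurable_fst)].
Qed.

End test_function.

Let rad_fst q : `|q.1.1| <= rad q.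
Proof.
rewrite -sqrtr_sqr ler_wsqrtr// -addrA lerDl addr_ge0 ?sqr_ge0//.
Qed.

Let rad_snd q : `|q.1.2| <= rad q.
Proof.
rewrite -sqrtr_sqr ler_wsqrtr// (addrC (q.1.1 ^+ 2)) -addrA lerDl addr_ge0 ?sqr_ge0//.
Qed.

Section limits.
Hypotheses (cf1 : {for 0, continuous f1}) (cf2 : {for 0, continuous f2}).

Let densities_near0 e : 0 < e -> exists2 eta, 0 < eta & forall k, cutoff eta k ->
  forall q, k (rad q) != 0 -> `|f12 q - f1 0 * f2 0| <= e.
Proof.
move=> e0; have [eta eta0 H] := product_near_zero (continuous_near_zero cf1)
  (continuous_near_zero cf2) e0.
exists eta => // k [_ _ _ keta] q kq.
have re : rad q <= eta by rewrite leNgt; apply: contra_neqN kq; exact: keta.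
by apply: H => //; [exact: le_trans (rad_fst q) re|exact: le_trans (rad_snd q) re].
Qed.

(** Where [k (rad q)] is nonzero both coordinates are small, so the densities are
    within [e] of their values at [0]. *)
Let compare_densities (psi : RR -> R) e eta (M : R -> R) k :
  0 <= e -> measurable_fun setT psi -> (forall z, 0 <= psi z) -> cutoff eta k ->
  (forall q, k (rad q) != 0 -> `|f12 q - f1 0 * f2 0| <= e) ->
  Q.-integrable setT (EFin \o (fun q => psi q.1 * k (rad q))) /\
  \int[Q]_q (psi q.1 * k (rad q)) = \int[mu]_r (k r * M r) ->
  `|\int[P]_w (psi (Y1 w, Y2 w) * k (S w)) - f1 0 * f2 0 * \int[mu]_r (k r * M r)|
    <= e * \int[mu]_r (k r * M r).
Proof.
move=> e0 mpsi psi0 Hk near [iG <-]; have [mk k0 _ _] := Hk.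
rewrite (expectation_planar Hk mpsi).
apply: (@integral_comparison _ _ _ Q (fun q => psi q.1 * k (rad q) * f12 q) _ _ _ _ iG _ e0 _).2.
- apply: measurable_funM => //; apply: measurable_funM; last exact: (measurableT_comp mk mrad).
  exact: (measurableT_comp mpsi measurable_fst).
- by move=> q; rewrite mulr_ge0.
move=> q; have [->|kq] := eqVneq (k (rad q)) 0; first by rewrite !(mulr0, mul0r) subrr normr0.
rewrite [f1 0 * f2 0 * _]mulrC -mulrBr normrM ger0_norm ?mulr_ge0//.
by rewrite mulrC ler_wpM2r ?mulr_ge0// near.
Qed.

Lemma law_radius_comparison e : 0 < e -> exists2 eta, 0 < eta & forall k, cutoff eta k ->
  `|\int[P]_w k (S w) - f1 0 * f2 0 * \int[mu]_r (k r * M0 r)|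
    <= e * \int[mu]_r (k r * M0 r).
Proof.
move=> e0; have [eta eta0 H] := densities_near0 e0; exists eta => // k Hk.
have -> : \int[P]_w k (S w) = \int[P]_w (cst 1 (Y1 w, Y2 w) * k (S w)).
  by apply: eq_Rintegral => w _; rewrite mul1r.
apply: (@compare_densities (cst 1) e eta M0 k (ltW e0)) => //; first exact: H.
have [i0 E0] := planar0 Hk; split.
  by apply: eq_integrable i0 => // q _ /=; rewrite mul1r.
by rewrite -E0; apply: eq_Rintegral => q _; rewrite mul1r.
Qed.

Lemma square_coordinate_comparison e : 0 < e -> exists2 eta, 0 < eta & forall k, cutoff eta k ->
  `|\int[P]_w (Y1 w ^+ 2 * k (S w)) - f1 0 * f2 0 * \int[mu]_r (k r * M1 r)|
    <= e * \int[mu]_r (k r * M1 r).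
Proof.
move=> e0; have [eta eta0 H] := densities_near0 e0; exists eta => // k Hk.
apply: (@compare_densities (fun z => z.1 ^+ 2) e eta M1 k (ltW e0)) => //.
- exact: measurable_funX.
- by move=> z; exact: sqr_ge0.
- exact: H.
- exact: planar1 Hk.
Qed.

Variables d1 d2 : R.
Hypotheses (Df1 : is_derive (0:R) (1:R) f1 d1) (Df2 : is_derive (0:R) (1:R) f2 d2).

(** Both reflections preserve the radius and change the sign of [x * y].  Averaging
    over the four images of a point leaves [x * y] times the product of the odd
    parts of the densities, that is [x ^+ 2 * y ^+ 2] times the product of their
    symmetric difference quotients, which are close to [d1] and [d2]. *)
Lemma product_coordinates_comparison e : 0 < e ->
  exists2 eta, 0 < eta & forall k, cutoff eta k ->
  `|\int[P]_w (Y1 w * Y2 w * k (S w)) - d1 * d2 * \int[mu]_r (k r * M2 r)|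
    <= e * \int[mu]_r (k r * M2 r).
Proof.
move=> e0; have [eta1 eta10 H1] := densities_near0 ltr01.
have [eta2 eta20 H2] := product_near_zero (derive_near_zero Df1) (derive_near_zero Df2) e0.
exists (Num.min eta1 eta2); first by rewrite lt_min eta10.
move=> k Hk; have [mk k0 kB keta] := Hk.
have Hk1 : cutoff eta1 k.
  by split => // r r1; apply: keta; rewrite gt_min r1.
have mprod : measurable_fun setT (fun z : RR => z.1 * z.2).
  by apply: measurable_funM; [exact: measurable_fst|exact: measurable_snd].
rewrite (expectation_planar Hk mprod).
have [iG <-] := planar2 Hk.
have mkr : measurable_fun setT (fun q => k (rad q)) by exact: (measurableT_comp mk mrad).
pose F q := q.1.1 * q.1.2 * k (rad q) * f12 q.
have mF : measurable_fun setT F.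
  by apply: measurable_funM => //; apply: measurable_funM => //; exact: measurable_funM.
have supp q : k (rad q) != 0 -> rad q <= Num.min eta1 eta2.
  by move=> kq; rewrite leNgt; apply: contra_neqN kq; exact: keta.
(* On the support of [k] the coordinates are at most [eta1] and the product of
   the densities is within [1] of its value at [0]: hence a crude bound that makes
   [F] integrable, as symmetrization requires. *)
have iF : Q.-integrable setT (EFin \o F).
  have c0 : 0 <= eta1 ^+ 2 * (f1 0 * f2 0 + 1).
    by rewrite mulr_ge0 ?sqr_ge0// addr_ge0// mulr_ge0.
  apply: (@integral_comparison _ _ _ Q F (fun q => k (rad q)) 0 _ mF (planar0 Hk).1 (fun=> k0 _) c0 _).1.
  move=> q; rewrite mul0r subr0 /F; have [->|kq] := eqVneq (k (rad q)) 0.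
    by rewrite !(mulr0, mul0r) normr0.
  have := supp q kq; rewrite le_min => /andP[r1 _].
  have x1 := le_trans (rad_fst q) r1; have y1 := le_trans (rad_snd q) r1.
  have fb : f12 q <= f1 0 * f2 0 + 1.
    by have := H1 _ Hk1 q kq; rewrite ler_norml => /andP[_]; rewrite lerBlDl.
  rewrite (normrM _ (f12 q)) (ger0_norm (f12_ge0 q)).
  rewrite (normrM _ (k _)) (ger0_norm (k0 _)) normrM.
  rewrite -mulrA [k _ * _]mulrC mulrA ler_wpM2r//.
  by rewrite ler_pM ?mulr_ge0// expr2 ler_pM.
have inv1 := ge0_integral_reflect_fst P; have inv2 := ge0_integral_reflect_snd P.
have [-> iF1] := Rintegral_symmetrize (@measurable_reflect_fst _ _ _) inv1 iF.
have [-> iF2] := Rintegral_symmetrize (@measurable_reflect_snd _ _ _) inv2 iF1.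
apply: (integral_comparison _ iG _ (ltW e0) _).2.
- by apply/measurable_EFinP; exact: measurable_int iF2.
- by move=> q; apply: mulr_ge0 => //; apply: mulr_ge0; exact: sqr_ge0.
move=> q; set G := q.1.1 ^+ 2 * q.1.2 ^+ 2 * k (rad q).
have rad1 : rad (reflect_fst q) = rad q by rewrite /radius /= sqrrN.
have rad2 : rad (reflect_snd q) = rad q by rewrite /radius /= sqrrN.
have rad12 : rad (reflect_fst (reflect_snd q)) = rad q by rewrite /radius /= !sqrrN.
pose u := (f1 q.1.1 - f1 (- q.1.1)) / (2 * q.1.1).
pose v := (f2 q.1.2 - f2 (- q.1.2)) / (2 * q.1.2).
(* On the axes, where the quotients are not defined, both sides vanish. *)
have -> : ((F q + F (reflect_fst q)) / 2 +
   (F (reflect_snd q) + F (reflect_fst (reflect_snd q))) / 2) / 2 = u * v * G.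
  rewrite /F rad1 rad2 rad12 /f12 /= /u /v /G.
  have [->|x0] := eqVneq q.1.1 0; first by rewrite oppr0 !(mul0r, subrr, expr0n, mulr0, addr0).
  have [->|y0] := eqVneq q.1.2 0; first by rewrite oppr0 !(mul0r, subrr, expr0n, mulr0, addr0).
  by field; rewrite x0 y0.
have G0 : 0 <= G by apply: mulr_ge0 => //; apply: mulr_ge0; exact: sqr_ge0.
rewrite -mulrBl normrM (ger0_norm G0).
have [->|Gn0] := eqVneq G 0; first by rewrite !mulr0.
rewrite ler_wpM2r//.
move: Gn0; rewrite !mulf_eq0 !negb_or => /andP[/andP[/andP[x0 _]/andP[y0 _]] kq].
have := supp q kq; rewrite le_min => /andP[_ r2].
by apply: H2 => //; [exact: le_trans (rad_fst q) r2|exact: le_trans (rad_snd q) r2].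
Qed.

End limits.
End two_coordinates.

(** * From the density of the norm to a monotone density *)

Section density_of_the_norm.
Context {R : realType}.
Local Notation mu := (@lebesgue_measure R).

(** On the set where [b < a] the two integrals coincide by monotonicity, so the
    nonnegative [a - b] has integral [0] on it. *)
Lemma null_set_of_integral_le d (X : measurableType d)
    (m : {measure set X -> \bar R}) (D : set X) (a b : X -> R) :
  measurable D -> measurable_fun D a -> measurable_fun D b ->
  (forall x, D x -> 0 <= a x) -> (forall x, D x -> 0 <= b x) ->
  (\int[m]_(x in D) (b x)%:E < +oo)%E ->
  (forall A, measurable A -> A `<=` D ->
     \int[m]_(x in A) (a x)%:E <= \int[m]_(x in A) (b x)%:E)%E ->
  m (D `&` [set x | b x < a x]) = 0%E.
Proof.
move=> mD ma mb a0 b0 bfin ab; set A := D `&` _.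
have mA : measurable A.
  have -> : A = D `&` (fun x => b x < a x) @^-1` [set true].
    by apply/seteqP; split => x.
  exact: (measurable_fun_ltr mb ma mD).
have AD : A `<=` D by move=> x [].
have maA : measurable_fun A a by exact: measurable_funS ma.
have mbA : measurable_fun A b by exact: measurable_funS mb.
have bA : (\int[m]_(x in A) (b x)%:E < +oo)%E.
  apply: le_lt_trans bfin; apply: ge0_subset_integral => //.
  exact/measurable_EFinP.
have iaE : (\int[m]_(x in A) (a x)%:E = \int[m]_(x in A) (b x)%:E)%E.
  apply/eqP; rewrite eq_le ab//=; apply: ge0_le_integral => //.
  - by move=> x /AD/b0; rewrite lee_fin.
  - exact/measurable_EFinP.
  - exact/measurable_EFinP.
  - by move=> x [_ /ltW]; rewrite lee_fin.
have ib : m.-integrable A (EFin \o b).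
  apply/integrableP; split; first exact/measurable_EFinP.
  rewrite (eq_integral (EFin \o b))// => x /set_mem/AD/b0 bx.
  by rewrite gee0_abs// lee_fin.
have ia : m.-integrable A (EFin \o a).
  apply/integrableP; split; first exact/measurable_EFinP.
  rewrite (eq_integral (EFin \o a)) ?iaE// => x /set_mem/AD/a0 ax.
  by rewrite gee0_abs// lee_fin.
have z : (\int[m]_(x in A) `|(a x - b x)%:E| = 0)%E.
  rewrite (eq_integral ((EFin \o a) \- (EFin \o b))%E); last first.
    by move=> x /set_mem[_ /= xab]; rewrite ger0_norm// subr_ge0 ltW.
  rewrite integralB//= iaE subee//; exact: integrable_fin_num ib.
have := (ae_eq_integral_abs m mA _).1 z.
have mab : measurable_fun A (fun x => (a x - b x)%:E).
  by apply/measurable_EFinP; exact: measurable_funB.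
move=> /(_ mab) [N [mN N0 AN]].
apply: (subset_measure0 mA mN _ N0) => x Ax; apply: AN => /= H.
case: Ax => Dx /= xab; have := H (conj Dx xab) => -[] /eqP.
by rewrite subr_eq0 gt_eqF.
Qed.

(** A density is determined up to a null set only; what matters is that one null
    set serves for all precisions [e]. *)
Definition ae_equivalent_at0 (Z : set R) (g M : R -> R) (k : R) : Prop :=
  [/\ measurable Z, mu Z = 0%E, forall r, r < 0 -> ~ Z r -> g r = 0 &
      forall e, 0 < e -> exists2 eta, 0 < eta &
        forall r, 0 < r -> r < eta -> ~ Z r -> `|g r - k * M r| <= e * M r].

Section transfer.
Variables (g M rho : R -> R) (k r0 : R) (Z : set R).
Hypotheses (GV : Gamma_varying g rho) (HM : half_line_monotone M) (k0 : 0 < k)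
  (r00 : 0 < r0) (g0 : forall r, r < r0 -> 0 <= g r)
  (gM : ae_equivalent_at0 Z g M k).

Let rho0 h : 0 < h -> 0 < rho h. Proof. by case: GV => _ + _; exact. Qed.

Let M0 := half_line_monotone_ge0 HM.

(** For each [n] the bad [x] form the preimage of a null set by an affine
    bijection, hence a null set, and so does their union. *)
Let good_point (u : nat -> R) (a b : R) : (forall n, 0 < u n) -> a < b ->
  exists x, [/\ a < x, x < b & forall n, ~ Z (u n + rho (u n) * x)].
Proof.
move=> u0 ab; have [mZ Z0 _ _] := gM.
pose B n : set (measurableTypeR R) := (fun x => rho (u n) * x + u n) @^-1` Z.
have mB n : measurable (B n).
  rewrite -[X in measurable X]setTI.
  exact: (measurable_affine (rho (u n)) (u n) measurableT mZ).
have B0 n : mu (B n) = 0%E.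
  have := @ge0_integral_affine R (rho (u n)) (u n) (EFin \o \1_Z) (rho0 (u0 n)).
  have mI : measurable_fun setT (EFin \o (\1_Z : R -> R)).
    exact/measurable_EFinP/measurable_indic.
  have I0 x : (0 <= (EFin \o (\1_Z : R -> R)) x)%E by rewrite lee_fin.
  move=> /(_ mI I0).
  rewrite integral_indic// setIT [X in X = _]Z0.
  have -> : (\int[mu]_x (EFin \o \1_Z) (rho (u n) * x + u n)%R = mu (B n))%E.
    transitivity (\int[mu]_x (\1_(B n) x)%:E)%E; last by rewrite integral_indic// setIT.
    by apply: eq_integral => x _; rewrite /= /B !indicE.
  by move/esym/eqP; rewrite mule_eq0 eqe gt_eqF ?rho0//= => /eqP.
have U0 : mu (\bigcup_n B n) = 0%E.
  apply/eqP; rewrite eq_le measure_ge0 andbT.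
  rewrite (le_trans (measure_sigma_subadditive mu mB _ _))//.
    exact: bigcupT_measurable.
  by rewrite eseries0// => n _ _; exact: B0.
have [x [/= xab nB]] : exists x, `]a, b[%classic x /\ ~ (\bigcup_n B n) x.
  apply: contrapT => H.
  have sub : `]a, b[%classic `<=` \bigcup_n B n.
    by move=> x xab; apply: contrapT => nB; apply: H; exists x.
  have : (mu `]a, b[%classic <= mu (\bigcup_n B n))%E.
    by apply: le_measure; rewrite ?inE//; exact: bigcupT_measurable.
  rewrite U0 lebesgue_measure_itv/= lte_fin ab -EFinB lee_fin.
  by rewrite leNgt subr_gt0 ab.
exists x; move: xab; rewrite in_itv /= => /andP[-> ->]; split => // n Zn.
by apply: nB; exists n => //; rewrite /B /= addrC.
Qed.

Let GVu (u : nat -> R) x : (forall n, 0 < u n) -> u n @[n --> \oo] --> 0 ->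
  g (u n + rho (u n) * x) / g (u n) @[n --> \oo] --> expR x.
Proof. by move=> u0 uc; case: GV => _ _ /(_ x)/cvg_at_rightP; apply. Qed.

(** Where it is defined, [g] vanishes almost everywhere on the negative half-line,
    whereas the ratio of its values tends to [expR x > 0]: so [h + rho h * x]
    cannot be negative infinitely often, for an [x] that avoids the null set.
    Taking [x] below [- e^-1] yields [rho h <= e * h]. *)
Lemma auxiliary_function_littleo : rho h / h @[h --> 0^'+] --> (0:R).
Proof.
apply/cvg_at_rightP => u [u0 uc].
apply/cvgrPdist_le => e e0.
have ie : - e^-1 - 1 < - e^-1 by lra.
have [x [_ x2 nZ]] := good_point u0 ie; have [_ _ gneg _] := gM.
near=> n; rewrite sub0r normrN ger0_norm; last first.
  by rewrite divr_ge0// ltW// rho0.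
have gn : 0 < g (u n + rho (u n) * x) / g (u n).
  by near: n; exact: (cvgr_gt _ (@GVu u x u0 uc) _ (expR_gt0 x)).
have : 0 <= u n + rho (u n) * x.
  rewrite leNgt; apply/negP => neg; move: gn.
  by rewrite (gneg _ neg (nZ n)) mul0r ltxx.
have rn := rho0 (u0 n).
rewrite ler_pdivrMr// => le1; rewrite -ler_pdivrMl//.
have := ler_wpM2l (ltW rn) (ltW x2); lra.
Unshelve. all: by end_near. Qed.

(** Outside the null set [g] may be exchanged for [k * M] in the numerator. *)
Let ratio_good (u : nat -> R) x : (forall n, 0 < u n) -> u n @[n --> \oo] --> 0 ->
  (forall n, ~ Z (u n + rho (u n) * x)) ->
  k * M (u n + rho (u n) * x) / g (u n) @[n --> \oo] --> expR x.
Proof.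
move=> u0 uc nZ; apply/cvgrPdist_le => e e0.
have ex := expR_gt0 x.
have ex1 : expR x < expR x + 1 by rewrite ltrDl.
have e2 : 0 < e / 2 by rewrite divr_gt0.
(* A relative error [dl <= 1 / 2] keeps the new ratio below twice the old one,
   which is less than [expR x + 1]; the absolute error is then at most [e / 2]. *)
pose dl := Num.min (1 / 2) (e / (4 * (expR x + 1))).
have s0 : 0 < 4 * (expR x + 1) by rewrite mulr_gt0// addr_gt0.
have dl0 : 0 < dl by rewrite lt_min !divr_gt0.
have dl1 : dl <= 1 / 2 by rewrite ge_min lexx.
have dle : dl * (4 * (expR x + 1)) <= e by rewrite -ler_pdivlMr// ge_min lexx orbT.
have [_ _ _ /(_ _ (mulr_gt0 dl0 k0)) [eta eta0 H]] := gM.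
have uc' : u n @[n --> \oo] --> 0^'+.
  move=> A [eps /= eps0 HA]; change (\forall n \near \oo, A (u n)); near=> n.
  apply: HA; last exact: u0.
  by near: n; exact: (cvgr_dist_lt _ _ uc _ eps0).
have vc : u n + rho (u n) * x @[n --> \oo] --> 0^'+.
  exact: (cvg_comp _ _ uc' (@cvg_shift_at_right R rho x rho0 auxiliary_function_littleo)).
near=> n.
have v0 : 0 < u n + rho (u n) * x by near: n; exact: (vc _ near0_gt0).
have veta : u n + rho (u n) * x < eta.
  by near: n; exact: (vc [set y | y < eta] (nbhs_right_lt eta0)).
have gu : 0 < g (u n).
  have : g (u n + rho (u n) * 0) / g (u n) != 0.
    by rewrite gt_eqF//; near: n; exact: (cvgr_gt _ (@GVu u 0 u0 uc) _ (expR_gt0 0)).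
  rewrite mulr0 addr0 mulf_eq0 negb_or => /andP[gn0 _].
  rewrite lt_def gn0 g0//; near: n; exact: (cvgr_lt _ uc _ r00).
have q1 : g (u n + rho (u n) * x) / g (u n) < expR x + 1.
  by near: n; exact: (cvgr_lt _ (@GVu u x u0 uc) _ ex1).
have qe : `|expR x - g (u n + rho (u n) * x) / g (u n)| <= e / 2.
  by near: n; exact: (cvgr_dist_le _ _ (@GVu u x u0 uc) _ e2).
have := H _ v0 veta (nZ n); move: q1 qe; set v := u n + _ in v0 veta *.
set q := g v / g (u n) => q1 qe.
have -> : g v = q * g (u n) by rewrite /q mulfVK// gt_eqF.
set t := k * M v / g (u n).
have -> : k * M v = t * g (u n) by rewrite /t mulfVK// gt_eqF.
rewrite -mulrBl normrM (gtr0_norm gu) -mulrA.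
have -> : k * M v = t * g (u n) by rewrite /t mulfVK// gt_eqF.
rewrite mulrA ler_pM2r// => qt.
have t0 : 0 <= t by rewrite divr_ge0 ?(ltW gu)// mulr_ge0// ltW.
have tq : t <= 2 * q by move: qt; rewrite ler_norml => /andP[]; nra.
have := ler_normD (expR x - q) (q - t); rewrite subrKA => /le_trans; apply.
have : dl * t <= e / 2 by nra.
lra.
Unshelve. all: by end_near. Qed.

(** An arbitrary [x] is squeezed between good points [x1 < x < x2], by monotonicity
    of [M] and continuity of the exponential. *)
Let ratio (u : nat -> R) x : (forall n, 0 < u n) -> u n @[n --> \oo] --> 0 ->
  k * M (u n + rho (u n) * x) / g (u n) @[n --> \oo] --> expR x.
Proof.
move=> u0 uc; apply/cvgrPdist_le => e e0.
have e2 : 0 < e / 2 by rewrite divr_gt0.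
have /cvgrPdist_lt/(_ _ e2)[dl /= dl0 Hdl] := @continuous_expR R x.
have lx : x - dl < x by lra.
have rx : x < x + dl by lra.
have [x1 [x1l x1r nZ1]] := good_point u0 lx.
have [x2 [x2l x2r nZ2]] := good_point u0 rx.
have d1 : `|expR x - expR x1| < e / 2.
  by apply: Hdl => /=; rewrite gtr0_norm; lra.
have d2 : `|expR x - expR x2| < e / 2.
  by apply: Hdl => /=; rewrite ltr0_norm; lra.
near=> n.
have c1 : `|expR x1 - k * M (u n + rho (u n) * x1) / g (u n)| <= e / 2.
  by near: n; exact: (cvgr_dist_le _ _ (ratio_good u0 uc nZ1) _ e2).
have c2 : `|expR x2 - k * M (u n + rho (u n) * x2) / g (u n)| <= e / 2.
  by near: n; exact: (cvgr_dist_le _ _ (ratio_good u0 uc nZ2) _ e2).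
have gu : 0 <= g (u n) by apply: g0; near: n; exact: (cvgr_lt _ uc _ r00).
have rn := rho0 (u0 n).
have m1 : k * M (u n + rho (u n) * x1) / g (u n) <= k * M (u n + rho (u n) * x) / g (u n).
  rewrite ler_wpM2r ?invr_ge0// ler_pM2l//; apply: HM.2.
  by rewrite lerD2l ler_pM2l// ltW.
have m2 : k * M (u n + rho (u n) * x) / g (u n) <= k * M (u n + rho (u n) * x2) / g (u n).
  rewrite ler_wpM2r ?invr_ge0// ler_pM2l//; apply: HM.2.
  by rewrite lerD2l ler_pM2l// ltW.
move: c1 c2 d1 d2; rewrite !ler_norml !ltr_norml.
move=> /andP[? ?] /andP[? ?] /andP[? ?] /andP[? ?]; apply/andP; split; lra.
Unshelve. all: by end_near. Qed.

(** The quotient of the limits of [ratio] at [x] and at [0], in which [g] cancels. *)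
Lemma Gamma_mono_transfer : Gamma_mono M rho.
Proof.
have Mpos r : 0 < r -> 0 < M r.
  move=> rp; have [//|Mr] := ltP 0 (M r).
  pose u (n : nat) : R := n.+1%:R^-1.
  have u0 n : 0 < u n by rewrite invr_gt0.
  have uc : u n @[n --> \oo] --> 0 by exact: cvg_harmonic.
  have [n [un Mn]] : exists n, u n < r /\ 0 < k * M (u n + rho (u n) * 0) / g (u n).
    apply: (@filter_ex _ \oo); near=> n; split.
      by near: n; exact: (cvgr_lt _ uc _ rp).
    by near: n; exact: (cvgr_gt _ (@ratio u 0 u0 uc) _ (expR_gt0 0)).
  have /(HM.2) : u n <= r by exact: ltW.
  move=> /le_trans/(_ Mr) Mu; have Mu0 : M (u n) = 0 by apply/le_anti; rewrite Mu M0.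
  by move: Mn; rewrite mulr0 addr0 Mu0 mulr0 mul0r ltxx.
split => //.
- by move=> x y _; exact: HM.2.
- exact: auxiliary_function_littleo.
move=> x; apply/cvg_at_rightP => u [u0 uc].
have l0 := @ratio u 0 u0 uc; rewrite expR0 in l0.
have lim : k * M (u n + rho (u n) * x) / g (u n) *
    (k * M (u n + rho (u n) * 0) / g (u n))^-1 @[n --> \oo] --> expR x * 1^-1.
  by apply: cvgM; [exact: (@ratio u x u0 uc)|exact: (cvgV (oner_neq0 R) l0)].
rewrite invr1 mulr1 in lim; apply: (near_eq_lim _ lim); near=> n => /=.
have gu : g (u n) != 0.
  have : g (u n + rho (u n) * 0) / g (u n) != 0.
    by rewrite gt_eqF//; near: n; exact: (cvgr_gt _ (@GVu u 0 u0 uc) _ (expR_gt0 0)).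
  by rewrite mulr0 addr0 mulf_eq0 negb_or => /andP[].
rewrite mulr0 addr0; have := Mpos _ (u0 n) => Mu.
by field; rewrite gu !gt_eqF.
Unshelve. all: by end_near. Qed.

End transfer.
End density_of_the_norm.

Section density_equivalence.
Context {R : realType} {d : measure_display} {T : measurableType d}.
Variable P : probability T R.
Local Notation mu := (@lebesgue_measure R).
Variables (S : T -> R) (g M : R -> R) (r k : R).
Hypotheses (mS : measurable_fun setT S) (S0 : forall w, 0 <= S w)
  (r0 : 0 < r) (dg : has_density_on P `]-oo, r[ S g)
  (HM : half_line_monotone M) (k0 : 0 < k).
Hypothesis law : forall e, 0 < e -> exists2 eta, 0 < eta & forall kk, cutoff eta kk ->
  `|\int[P]_w kk (S w) - k * \int[mu]_r (kk r * M r)| <= e * \int[mu]_r (kk r * M r).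

Let mg : measurable_fun (`]-oo, r[ : set (measurableTypeR R)) g. Proof. by case: dg. Qed.
Let g0 x : x < r -> 0 <= g x.
Proof. by move=> xr; case: dg => _ + _; apply; rewrite /= in_itv. Qed.
Let M0 := half_line_monotone_ge0 HM.
Let mM : measurable_fun [set: measurableTypeR R] M.
Proof. exact: measurable_half_line_monotone. Qed.

Let cutoff_indic eta (A : set R) : measurable A -> A `<=` `]0, eta[ ->
  cutoff eta (\1_A : R -> R).
Proof.
move=> mA Aeta; split => //.
- by exists 1 => x; rewrite indicE; case: (x \in A).
- move=> x xeta; rewrite indicE; case: (boolP (x \in A)) => // xA.
  by have := Aeta _ (set_mem xA); rewrite /= in_itv /= => /andP[_ /lt_trans/(_ xeta)];
    rewrite ltxx.
Qed.

Let fin_M eta (A : set R) : measurable A -> A `<=` `]0, eta[ ->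
  (\int[mu]_(x in A) (M x)%:E)%E \is a fin_num /\
  \int[mu]_x (\1_A x * M x) = fine (\int[mu]_(x in A) (M x)%:E)%E.
Proof.
move=> mA Aeta; have ck := cutoff_indic mA Aeta.
have E : (\int[mu]_x (\1_A x * M x)%:E = \int[mu]_(x in A) (M x)%:E)%E.
  rewrite [RHS]integral_mkcond; apply: eq_integral => x _.
  by rewrite patchE indicE; case: ifP => _; rewrite ?mul1r ?mul0r.
rewrite /Rintegral E; split => //.
by rewrite -E; exact: (integrable_fin_num measurableT (cutoff_integrable ck HM)).
Qed.

Let fin_g (A : set R) : measurable A -> A `<=` `]-oo, r[ ->
  (\int[mu]_(x in A) (g x)%:E)%E \is a fin_num /\
  \int[P]_w (\1_A (S w)) = fine (\int[mu]_(x in A) (g x)%:E)%E.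
Proof.
move=> mA Ar; have mSA : measurable (S @^-1` A).
  by rewrite -[X in measurable X]setTI; exact: mS.
have <- : P (S @^-1` A) = (\int[mu]_(x in A) (g x)%:E)%E by case: dg => _ _; apply.
split; first exact: fin_num_measure.
rewrite /Rintegral; congr fine.
transitivity (\int[P]_w (\1_(S @^-1` A) w)%:E)%E; last by rewrite integral_indic// setIT.
by apply: eq_integral => w _; rewrite !indicE.
Qed.

(** Testing [law] on indicators of subsets of a small interval [(0, eta)] compares
    [g] and [k * M] on all these subsets, hence almost everywhere. *)
Let null_pos e : 0 < e -> exists Zeta : set R * R, [/\ measurable Zeta.1,
  mu Zeta.1 = 0%E, 0 < Zeta.2 & forall x, 0 < x -> x < Zeta.2 -> ~ Zeta.1 x ->
    `|g x - k * M x| <= e * M x].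
Proof.
move=> e0; (* Below [k], so that [(k - e') * M] is nonnegative. *)
pose e' := Num.min e k.
have e'0 : 0 < e' by rewrite lt_min e0.
have e'k : e' <= k by rewrite ge_min lexx orbT.
have [eta eta0 H] := law e'0.
pose eta' := Num.min eta r; pose D : set (measurableTypeR R) := `]0, eta'[%classic.
have Deta : D `<=` `]0, eta[.
  by move=> x; rewrite /D /= !in_itv /= lt_min => /andP[-> /andP[-> _]].
have Dr : D `<=` `]-oo, r[.
  by move=> x; rewrite /D /= !in_itv /= lt_min => /andP[_ /andP[_ ->]].
have mD : measurable D by exact: measurable_itv.
have mgD : measurable_fun D (g : measurableTypeR R -> R).
  by apply: measurable_funS mg.
have mcM (c : R) : measurable_fun D (fun x : measurableTypeR R => c * M x).
  by apply: measurable_funTS; apply: measurable_funM.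
have scale (c : R) (A : set R) : 0 <= c -> measurable A -> A `<=` D ->
    (\int[mu]_(x in A) (c * M x)%:E = (c * fine (\int[mu]_(x in A) (M x)%:E))%:E)%E.
  move=> c0 mA AD; have [finM _] := fin_M mA (subset_trans AD Deta).
  under eq_integral do rewrite EFinM.
  rewrite ge0_integralZl//; first by rewrite EFinM fineK.
  - exact/measurable_EFinP/measurable_funTS.
  - by move=> x _; rewrite lee_fin.
have both (A : set R) : measurable A -> A `<=` D ->
    (\int[mu]_(x in A) (g x)%:E <= \int[mu]_(x in A) ((k + e') * M x)%:E)%E /\
    (\int[mu]_(x in A) ((k - e') * M x)%:E <= \int[mu]_(x in A) (g x)%:E)%E.
  move=> mA AD.
  have [fg Eg] := fin_g mA (subset_trans AD Dr).
  have [fM EM] := fin_M mA (subset_trans AD Deta).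
  have := H _ (cutoff_indic mA (subset_trans AD Deta)); rewrite Eg EM ler_norml.
  move=> /andP[le1 le2]; rewrite !scale ?subr_ge0 ?addr_ge0 ?(ltW k0) ?(ltW e'0)//.
  rewrite -(fineK fg) !lee_fin; split; lra.
pose Z1 := D `&` [set x | (k + e') * M x < g x].
pose Z2 := D `&` [set x | g x < (k - e') * M x].
have ke : 0 <= k + e' by rewrite addr_ge0 ?ltW.
have ke' : 0 <= k - e' by rewrite subr_ge0.
have Dg0 x : D x -> 0 <= g x by move=> /Dr /=; rewrite in_itv /= => /g0.
have Z10 : mu Z1 = 0%E.
  apply: null_set_of_integral_le => //.
  - by move=> x _; rewrite mulr_ge0.
  - by rewrite scale// ltry.
  - by move=> A mA AD; exact: (both A mA AD).1.
have Z20 : mu Z2 = 0%E.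
  apply: null_set_of_integral_le => //.
  - by move=> x _; rewrite mulr_ge0.
  - by have [fg _] := fin_g mD Dr; rewrite -(fineK fg) ltry.
  - by move=> A mA AD; exact: (both A mA AD).2.
have mZ1 : measurable Z1.
  have -> : Z1 = D `&` (fun x => (k + e') * M x < g x) @^-1` [set true].
    by apply/seteqP; split => x.
  exact: (measurable_fun_ltr (mcM _) mgD mD).
have mZ2 : measurable Z2.
  have -> : Z2 = D `&` (fun x => g x < (k - e') * M x) @^-1` [set true].
    by apply/seteqP; split => x.
  exact: (measurable_fun_ltr mgD (mcM _) mD).
exists (Z1 `|` Z2, eta'); split => /=.
- exact: measurableU.
- apply/eqP; rewrite eq_le measure_ge0 andbT.
  apply: (le_trans (measureU2 mu mZ1 mZ2)).
  suff -> : (mu Z1 + mu Z2 = 0)%E by [].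
  by rewrite Z10 Z20 adde0.
- by rewrite lt_min eta0.
move=> x x0 xe nZ; have Dx : D x by rewrite /D /= in_itv /= x0.
have le1 : g x <= (k + e') * M x.
  by rewrite leNgt; apply/negP => lt1; apply: nZ; left.
have le2 : (k - e') * M x <= g x.
  by rewrite leNgt; apply/negP => lt1; apply: nZ; right.
have le3 : e' * M x <= e * M x by rewrite ler_wpM2r// ge_min lexx.
by rewrite ler_norml; apply/andP; split; lra.
Qed.

(** A countable union over the precisions [n.+1%:R^-1] gives a null set that does
    not depend on the precision. *)
Lemma density_ae_equivalent : exists Z, ae_equivalent_at0 Z g M k.
Proof.
pose e n : R := n.+1%:R^-1.
have e0 n : 0 < e n by rewrite invr_gt0.
have [F HF] := choice (fun n => null_pos (e0 n)).
pose D : set (measurableTypeR R) := `]-oo, 0[%classic.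
have mD : measurable D by exact: measurable_itv.
have Dr : D `<=` `]-oo, r[.
  by move=> x; rewrite /D /= !in_itv /= => /lt_trans; apply.
have mgD : measurable_fun D (g : measurableTypeR R -> R) by exact: measurable_funS mg.
pose Z' := D `&` [set x | 0 < g x].
have Z'0 : mu Z' = 0%E.
  apply: (null_set_of_integral_le (b := cst 0)) => //.
  - by move=> x /Dr /=; rewrite in_itv /= => /g0.
  - by rewrite integral0 ltry.
  - move=> A mA AD; rewrite integral0.
    have <- : P (S @^-1` A) = (\int[mu]_(x in A) (g x)%:E)%E.
      by case: dg => _ _; apply => //; exact: subset_trans Dr.
    have -> : S @^-1` A = set0; last by rewrite measure0.
    apply/seteqP; split => // w /= /AD; rewrite /D /= in_itv /=.
    by rewrite ltNge S0.
have mZ' : measurable Z'.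
  have -> : Z' = D `&` (fun x => (cst 0 x : R) < g x) @^-1` [set true].
    by apply/seteqP; split => x.
  exact: (measurable_fun_ltr (measurable_cst _) mgD mD).
have mF n : measurable (F n).1 by case: (HF n).
exists (Z' `|` \bigcup_n (F n).1); split.
- by apply: measurableU => //; exact: bigcupT_measurable.
- apply/eqP; rewrite eq_le measure_ge0 andbT.
  have mU : measurable (\bigcup_n (F n).1) by exact: bigcupT_measurable.
  apply: (le_trans (measureU2 mu mZ' mU)).
  suff -> : (mu Z' + mu (\bigcup_n (F n).1) = 0)%E by [].
  rewrite Z'0 add0e; apply/eqP; rewrite eq_le measure_ge0 andbT.
  rewrite (le_trans (measure_sigma_subadditive mu mF mU _))//.
  by rewrite eseries0// => n _ _; case: (HF n).
- move=> x xneg nZ; have gx : 0 <= g x by apply: g0; exact: lt_trans r0.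
  apply/eqP; move: gx; rewrite le_eqVlt eq_sym => /orP[//|gx].
  by exfalso; apply: nZ; left; split => //; rewrite /D /= in_itv.
- move=> eps eps0.
  have [n en] : exists n, e n < eps.
    by apply: (@filter_ex _ \oo); exact: (cvgr_lt _ (@cvg_harmonic R) _ eps0).
  have [_ _ F2 HFn] := HF n; exists (F n).2 => // x x0 xF nZ.
  apply: (@le_trans _ _ (e n * M x)); last by rewrite ler_wpM2r// ltW.
  by apply: HFn => // Zx; apply: nZ; right; exists n.
Qed.

End density_equivalence.

(** * Asymptotic domination *)

Section asymptotic_domination.
Context {R : realType}.
Local Notation mu := (@lebesgue_measure R).
Implicit Types (A B C V : R -> R) (c : R).

(** [A ~ c * B] at [0] from the right, or [A = o(B)] if [c = 0].  The error is
    bounded by [e * B h] rather than [e * `|B h|], so [B] is nonnegative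
    near [0]. *)
Definition dominated_equiv c A B : Prop :=
  forall e, 0 < e -> \forall h \near (0:R)^'+, `|A h - c * B h| <= e * B h.

Lemma dominated_equiv_ge0 c A B : dominated_equiv c A B ->
  \forall h \near (0:R)^'+, 0 <= B h.
Proof.
move=> /(_ _ ltr01); apply: filterS => h; rewrite mul1r; exact: le_trans.
Qed.

Lemma dominated_equiv_trans c c' A B C :
  dominated_equiv c A B -> dominated_equiv c' B C -> dominated_equiv (c * c') A C.
Proof.
move=> AB BC e e0.
pose e1 := e / (2 * (`|c'| + 1)); pose e2 := Num.min 1 (e / (2 * (`|c| + 1))).
have s1 : 0 < 2 * (`|c'| + 1) by rewrite mulr_gt0// ltr_wpDl.
have s2 : 0 < 2 * (`|c| + 1) by rewrite mulr_gt0// ltr_wpDl.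
have e10 : 0 < e1 by rewrite divr_gt0.
have e20 : 0 < e2 by rewrite lt_min ltr01 divr_gt0.
have e1E : e1 * (2 * (`|c'| + 1)) = e by rewrite /e1 mulfVK// gt_eqF.
have e21 : e2 <= 1 by rewrite ge_min lexx.
have e2E : e2 * (2 * (`|c| + 1)) <= e by rewrite -ler_pdivlMr// ge_min lexx orbT.
near=> h.
have C0 : 0 <= C h by near: h; exact: dominated_equiv_ge0 BC.
have hA : `|A h - c * B h| <= e1 * B h by near: h; exact: AB.
have hB : `|B h - c' * C h| <= e2 * C h by near: h; exact: BC.
have -> : A h - c * c' * C h = (A h - c * B h) + c * (B h - c' * C h) by ring.
apply: (le_trans (ler_normD _ _)); rewrite normrM.
have cB : `|c| * `|B h - c' * C h| <= `|c| * (e2 * C h) by rewrite ler_wpM2l.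
have Bb : B h <= (`|c'| + 1) * C h.
  have := ler_norm (B h - c' * C h).
  have : c' * C h <= `|c'| * C h by rewrite ler_wpM2r// ler_norm.
  have : e2 * C h <= 1 * C h by rewrite ler_wpM2r.
  lra.
have h1 : e1 * B h <= e1 * ((`|c'| + 1) * C h) by rewrite ler_wpM2l// ltW.
have h2 : e1 * ((`|c'| + 1) * C h) = e / 2 * C h by rewrite -e1E; field.
have h3 : `|c| * (e2 * C h) <= e / 2 * C h.
  rewrite mulrA ler_wpM2r//; have : 0 <= `|c| by []; nra.
lra.
Unshelve. all: by end_near. Qed.

(** Two quantities compared with the same [C] are comparable with each other: this
    is how the model density is eliminated in the end. *)
Lemma dominated_equiv_ratio c c' A V C : 0 < c' ->
  dominated_equiv c A C -> dominated_equiv c' V C -> dominated_equiv (c / c') A V.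
Proof.
move=> c'0 AC VC e e0.
pose e1 := e * c' / 4; pose e2 := Num.min (c' / 2) (e * c' / (4 * (`|c / c'| + 1))).
have s2 : 0 < 4 * (`|c / c'| + 1) by rewrite mulr_gt0// ltr_wpDl.
have e10 : 0 < e1 by rewrite divr_gt0// mulr_gt0.
have e20 : 0 < e2 by rewrite lt_min !divr_gt0// mulr_gt0.
have e21 : e2 <= c' / 2 by rewrite ge_min lexx.
have e2E : e2 * (4 * (`|c / c'| + 1)) <= e * c'.
  by rewrite -ler_pdivlMr// ge_min lexx orbT.
near=> h.
have C0 : 0 <= C h by near: h; exact: dominated_equiv_ge0 VC.
have hA : `|A h - c * C h| <= e1 * C h by near: h; exact: AC.
have hV : `|V h - c' * C h| <= e2 * C h by near: h; exact: VC.
have -> : A h - c / c' * V h = (A h - c * C h) - c / c' * (V h - c' * C h).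
  by field; rewrite gt_eqF.
apply: (le_trans (ler_normB _ _)); rewrite normrM.
have cV : `|c / c'| * `|V h - c' * C h| <= `|c / c'| * (e2 * C h) by rewrite ler_wpM2l.
have Vb : c' / 2 * C h <= V h.
  have : e2 * C h <= c' / 2 * C h by rewrite ler_wpM2r.
  move: hV; rewrite ler_norml => /andP[]; lra.
have h3 : `|c / c'| * (e2 * C h) <= e * c' / 4 * C h.
  rewrite mulrA ler_wpM2r//; have : 0 <= `|c / c'| by []; nra.
have : e * (c' / 2 * C h) <= e * V h by rewrite ler_wpM2l// ltW.
rewrite /e1 in hA; lra.
Unshelve. all: by end_near. Qed.

(** A comparison that is uniform over the test functions supported in a fixed
    neighbourhood of [0] applies to a family with shrinking supports. *)
Lemma dominated_equiv_cutoff (Phi : (R -> R) -> R) c M (k : R -> R -> R) :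
  (forall e, 0 < e -> exists2 eta, 0 < eta & forall kk, cutoff eta kk ->
     `|Phi kk - c * \int[mu]_r (kk r * M r)| <= e * \int[mu]_r (kk r * M r)) ->
  (\forall h \near (0:R)^'+, cutoff h (k h)) ->
  dominated_equiv c (fun h => Phi (k h)) (fun h => \int[mu]_r (k h r * M r)).
Proof.
move=> H ck e e0; have [eta eta0 He] := H _ e0; near=> h.
apply: He; have [m1 m2 m3 m4] : cutoff h (k h) by near: h.
have hle : h <= eta by near: h; exact: nbhs_right_le.
by split => // r /(le_lt_trans hle); exact: m4.
Unshelve. all: by end_near. Qed.

(** For shrinking supports only the behaviour of the densities at [0] counts, so
    a weight [q] may be traded for a change of density from [M] to
    [M' ~ q * M]. *)
Lemma dominated_equiv_weight (k kq : R -> R -> R) (q M M' : R -> R) :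
  (forall h r, kq h r = k h r * q r) ->
  (\forall h \near (0:R)^'+, cutoff h (k h)) ->
  (\forall h \near (0:R)^'+, cutoff h (kq h)) ->
  half_line_monotone M -> half_line_monotone M' ->
  (forall r, 0 < r -> 0 < M' r) ->
  q r * M r / M' r @[r --> 0^'+] --> (1:R) ->
  dominated_equiv 1 (fun h => \int[mu]_r (kq h r * M r))
                    (fun h => \int[mu]_r (k h r * M' r)).
Proof.
move=> kqE ck ckq HM HM' M'pos lim e e0.
have /cvgrPdist_le/(_ _ e0)[eta /= eta0 H] := lim.
near=> h.
have chk : cutoff h (k h) by near: h.
have chkq : cutoff h (kq h) by near: h.
have heta : h < eta by near: h; exact: nbhs_right_lt.
have [mk k0 kB kh] := chk; have [mkq _ _ _] := chkq.
have M'0 := half_line_monotone_ge0 HM'.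
apply: (@integral_comparison _ _ _ mu (fun r => kq h r * M r)
  (fun r => k h r * M' r) 1 e _ (cutoff_integrable chk HM') _ (ltW e0) _).2.
- by apply: measurable_funM => //; exact: measurable_half_line_monotone.
- by move=> r; rewrite mulr_ge0.
move=> r; rewrite mul1r kqE.
have [r0|r0] := leP r 0.
  by rewrite (HM.1 r r0) (HM'.1 r r0) !mulr0 subrr normr0.
have [rh|hr] := leP r h; last by rewrite kh// !mul0r subrr normr0 mulr0.
have M'r := M'pos _ r0.
have -> : k h r * q r * M r - k h r * M' r = - (1 - q r * M r / M' r) * (k h r * M' r).
  by field; rewrite gt_eqF.
rewrite normrM normrN ger0_norm ?mulr_ge0// ler_wpM2r ?mulr_ge0//.
apply: H => //=; rewrite sub0r normrN gtr0_norm//; exact: le_lt_trans heta.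
Unshelve. all: by end_near. Qed.

End asymptotic_domination.

(** * Hilbert space: Parseval, Riesz and Bochner means *)

Section hilbert.
Context {R : realType} {H : completeNormedModType R}.
Variable dot : {dot H for (idfun : R -> R)}.
Hypothesis Hdot : norm_from dot.

Lemma dotC u v : dot u v = dot v u.
Proof. by rewrite hermC /= expr0 mul1r. Qed.

Lemma dotDr u v w : dot u (v + w) = dot u v + dot u w.
Proof. by rewrite linearD. Qed.

Lemma dotZr u (c : R) v : dot u (c *: v) = c * dot u v.
Proof. by rewrite linearZ. Qed.

Lemma dotBr u v w : dot u (v - w) = dot u v - dot u w.
Proof. by rewrite linearB. Qed.

Lemma dotDl u v w : dot (u + v) w = dot u w + dot v w.
Proof. by rewrite !(dotC _ w) dotDr. Qed.

Lemma dotBl u v w : dot (u - v) w = dot u w - dot v w.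
Proof. by rewrite !(dotC _ w) dotBr. Qed.

Lemma dotZl (c : R) u v : dot (c *: u) v = c * dot u v.
Proof. by rewrite !(dotC _ v) dotZr. Qed.

Lemma dot_sumr u (F : nat -> H) m n :
  dot u (\sum_(m <= p < n) F p) = \sum_(m <= p < n) dot u (F p).
Proof. by rewrite linear_sum. Qed.

Lemma dot_norm u : dot u u = `|u| ^+ 2.
Proof. by rewrite Hdot. Qed.

Lemma dot_cauchy_schwarz u v : `|dot u v| <= `|u| * `|v|.
Proof.
have [->|v0] := eqVneq v 0; first by rewrite linear0 !normr0 mulr0.
have nv : 0 < `|v| by rewrite normr_gt0.
rewrite -ler_sqr ?nnegrE ?mulr_ge0// real_normK ?num_real// exprMn.
pose t := dot u v / `|v| ^+ 2.
have : 0 <= `|u - t *: v| ^+ 2 by rewrite sqr_ge0.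
rewrite -dot_norm dotBl !dotBr dotZl !dotZr dotZl !dot_norm (dotC v u).
have -> : `|u| ^+ 2 - t * dot u v - (t * dot u v - t * (t * `|v| ^+ 2)) =
  (`|u| ^+ 2 * `|v| ^+ 2 - dot u v ^+ 2) / `|v| ^+ 2.
  by rewrite /t; field; rewrite gt_eqF.
by rewrite pmulr_lge0 ?invr_gt0 ?exprn_gt0// subr_ge0.
Qed.

Lemma continuous_dotr u : continuous (dot u).
Proof.
move=> x; apply/cvgrPdist_le => eps eps0; near=> y.
rewrite -dotBr (le_trans (dot_cauchy_schwarz _ _))//.
have u1 : 0 < `|u| + 1 by rewrite ltr_wpDl.
have xy : `|x - y| <= eps / (`|u| + 1).
  by near: y; apply: (@cvgr_dist_le _ _ _ _ _ id x); [exact: cvg_id|rewrite divr_gt0].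
apply: (@le_trans _ _ ((`|u| + 1) * `|x - y|)); first by rewrite ler_wpM2r// lerDl.
by rewrite mulrC -ler_pdivlMr.
Unshelve. all: by end_near. Qed.

Section basis.
Variable e : nat -> H.
Hypothesis He : orthonormal_basis dot e.

Lemma dot_basis p q : dot (e p) (e q) = (p == q)%:R.
Proof. by case: He. Qed.

Lemma basis_expansion x : series (fun p => dot x (e p) *: e p) @ \oo --> x.
Proof. by case: He. Qed.

(** Continuity of [dot x] applied to the expansion of [x]. *)
Lemma parseval x : series (fun p => dot x (e p) ^+ 2) @ \oo --> `|x| ^+ 2.
Proof.
rewrite -dot_norm.
have -> : series (fun p => dot x (e p) ^+ 2) =
    dot x \o series (fun p => dot x (e p) *: e p).
  apply/funext => n; rewrite /series /= dot_sumr.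
  by apply: eq_bigr => p _; rewrite dotZr expr2.
by apply: cvg_comp; [exact: basis_expansion|exact: continuous_dotr].
Qed.

Lemma norm_sum_basis (c : nat -> R) m n :
  `|\sum_(m <= p < n) c p *: e p| ^+ 2 = \sum_(m <= p < n) c p ^+ 2.
Proof.
rewrite -dot_norm dot_sumr; apply: eq_big_nat => p pmn.
rewrite dotZr dotC dot_sumr (bigD1_seq p)/= ?mem_index_iota ?iota_uniq//.
rewrite dotZr dot_basis eqxx mulr1 big1 ?addr0 ?expr2// => q qp.
by rewrite dotZr dot_basis eq_sym (negbTE qp) mulr0.
Qed.

(** Riesz representation.  The coordinates of the representing vector have to be
    the values of [phi] on the basis; they are square summable because the partial
    sums [m_ n] satisfy [`|m_ n| ^+ 2 = phi (m_ n) <= C * `|m_ n|]. *)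
Lemma riesz_representation (phi : H -> R) (C : R) :
  (forall u v, phi (u + v) = phi u + phi v) ->
  (forall c u, phi (c *: u) = c * phi u) ->
  (forall u, `|phi u| <= C * `|u|) ->
  exists m, forall u, phi u = dot u m.
Proof.
move=> phiD phiZ phiC.
have phi0 : phi 0 = 0 by rewrite -(scale0r (0:H)) phiZ mul0r.
have phi_sum (F : nat -> H) m n :
    phi (\sum_(m <= p < n) F p) = \sum_(m <= p < n) phi (F p).
  by elim/big_ind2 : _ => // x1 x2 y1 y2 <- <-; rewrite phiD.
have C0 : 0 <= C.
  have := phiC (e 0%N); have -> : `|e 0%N| = 1.
    by apply/eqP; rewrite -(@eqrXn2 _ 2)// -dot_norm dot_basis expr1n.
  by rewrite mulr1; apply: le_trans.
pose m_ := series (fun p => phi (e p) *: e p).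
have mn n : `|m_ n| ^+ 2 = \sum_(0 <= p < n) phi (e p) ^+ 2.
  by rewrite /m_ /series /= norm_sum_basis.
have mC n : \sum_(0 <= p < n) phi (e p) ^+ 2 <= C ^+ 2.
  have : phi (m_ n) = `|m_ n| ^+ 2.
    rewrite mn /m_ /series /= phi_sum; apply: eq_bigr => p _.
    by rewrite phiZ expr2.
  move=> E; have := le_trans (ler_norm _) (phiC (m_ n)); rewrite E -mn => le1.
  rewrite ler_sqr ?nnegrE//.
  have [->//|n0] := eqVneq (`|m_ n|) 0.
  by move: le1; rewrite expr2 ler_pM2r// lt_def n0 normr_ge0.
have csq : cvgn (series (fun p => phi (e p) ^+ 2)).
  apply: nondecreasing_is_cvgn.
    apply/nondecreasing_seqP => n; rewrite /series /= big_nat_recr//= lerDl.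
    by rewrite sqr_ge0.
  by exists (C ^+ 2) => _ [n _ <-]; exact: mC.
have cm : cvgn m_.
  apply/cauchy_cvgP/cauchy_seriesP => eps eps0.
  have /cvg_cauchy/cauchy_seriesP/(_ (eps ^+ 2)) := csq.
  rewrite exprn_gt0// => /(_ isT); apply: filterS => -[a b] /=.
  rewrite ger0_norm ?sumr_ge0// => [|p _]; last exact: sqr_ge0.
  by rewrite -norm_sum_basis ltr_sqr ?nnegrE// ltW.
exists (limn m_) => u.
have l1 : dot u \o m_ @ \oo --> dot u (limn m_).
  by apply: cvg_comp; [exact: cm|exact: continuous_dotr].
have l2 : dot u \o m_ @ \oo --> phi u.
  have -> : dot u \o m_ = phi \o series (fun p => dot u (e p) *: e p).
    apply/funext => n; rewrite /m_ /series /= dot_sumr phi_sum.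
    by apply: eq_bigr => p _; rewrite dotZr phiZ mulrC.
  apply: cvg_comp; first exact: basis_expansion.
  have C1 : 0 < C + 1 by rewrite ltr_wpDl.
  apply/cvgrPdist_le => eps eps0; near=> y.
  have -> : phi u - phi y = phi (u - y).
    by rewrite phiD -(scaleN1r y) phiZ mulN1r.
  rewrite (le_trans (phiC _))//.
  have uy : `|u - y| <= eps / (C + 1).
    near: y; apply: (@cvgr_dist_le _ _ _ _ _ id u); [exact: cvg_id|]. exact: divr_gt0.
  apply: (@le_trans _ _ ((C + 1) * `|u - y|)); first by rewrite ler_wpM2r// lerDl.
  by rewrite mulrC -ler_pdivlMr.
by rewrite -(cvg_lim _ l1)// -(cvg_lim _ l2).
Unshelve. all: by end_near. Qed.

Section mean.
Context {d : measure_display} {T : measurableType d} (P : probability T R).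
Variables (Z : T -> H) (C : R).
Hypothesis mZ : forall u, measurable_fun setT (fun w => dot u (Z w)).
Hypothesis mnZ : measurable_fun setT (fun w => `|Z w|).
Hypothesis ZC : forall w, `|Z w| <= C.

Let integrable_bounded (f : T -> R) (D : R) : measurable_fun setT f ->
  (forall w, `|f w| <= D) -> P.-integrable setT (EFin \o f).
Proof.
move=> mf fD; apply: (@le_integrable _ _ _ P _ measurableT _ (EFin \o cst D)).
- exact/measurable_EFinP.
- by move=> w _ /=; rewrite lee_fin (le_trans (fD w))// ler_norm.
- exact: finite_measure_integrable_cst.
Qed.

Let C0 : 0 <= C.
Proof.
have [w _] : [set: T] !=set0.
  apply/set0P/eqP => T0; have := @probability_setT _ _ _ P.
  by rewrite T0 measure0 => /eqP; rewrite eqe eq_sym oner_eq0.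
exact: le_trans (ZC w).
Qed.

Let dotZ_bound u w : `|dot u (Z w)| <= C * `|u|.
Proof.
by rewrite (le_trans (dot_cauchy_schwarz _ _))// mulrC ler_wpM2r.
Qed.

Let int_dot u : P.-integrable setT (EFin \o (fun w => dot u (Z w))).
Proof. exact: (integrable_bounded (mZ u) (dotZ_bound u)). Qed.

(** For a bounded [Z] the weak mean [u |-> \int[P]_w dot u (Z w)] is a bounded
    functional, represented by a vector. *)
Lemma has_mean_exists : exists m, has_mean P dot Z m.
Proof.
pose phi u := (\int[P]_w dot u (Z w))%R.
have [m phim] : exists m, forall u, phi u = dot u m.
  apply: (@riesz_representation phi C).
  - move=> u v; rewrite /phi -RintegralD//.
    by apply: eq_Rintegral => w _; rewrite dotDl.
  - move=> c u; rewrite /phi -RintegralZl//.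
    by apply: eq_Rintegral => w _; rewrite dotZl.
  - move=> u; rewrite /phi; apply: (le_trans (le_normr_Rintegral _ _)) => //.
    apply: (@le_trans _ _ (\int[P]_w (cst (C * `|u|) w))%R).
      apply: le_Rintegral => //.
      + exact: integrable_norm.
      + exact: finite_measure_integrable_cst.
    by rewrite (Rintegral_cst P measurableT) (congr1 fine (@probability_setT _ _ _ P)) mulr1.
exists m; split.
- by apply: (integrable_bounded mnZ) => w; rewrite normr_id.
- by move=> u; exact: int_dot.
- move=> u; rewrite -phim unlock /phi /Rintegral fineK//.
  exact: (integrable_fin_num measurableT (int_dot u)).
Qed.

Lemma has_mean_mean : has_mean P dot Z (mean P dot Z).
Proof. exact: (xgetPex 0 has_mean_exists). Qed.

Lemma dot_mean u : dot u (mean P dot Z) = (\int[P]_w dot u (Z w))%R.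
Proof.
have [_ _ /(_ u)] := has_mean_mean; rewrite unlock => /(congr1 fine) /= <-.
by [].
Qed.

(** Test the mean against itself. *)
Lemma norm_mean_le : `|mean P dot Z| <= C.
Proof.
set m := mean P dot Z; have [->|m0] := eqVneq m 0; first by rewrite normr0.
have nm : 0 < `|m| by rewrite normr_gt0.
rewrite -(ler_pM2r nm) -expr2 -dot_norm dot_mean.
apply: (@le_trans _ _ (\int[P]_w (cst (C * `|m|) w))%R).
  apply: le_Rintegral => //.
  - exact: finite_measure_integrable_cst.
  - by move=> w _; exact: le_trans (ler_norm _) (dotZ_bound m w).
by rewrite (Rintegral_cst P measurableT) (congr1 fine (@probability_setT _ _ _ P)) mulr1.
Qed.

End mean.
End basis.

Lemma measurable_comp_continuous {d : measure_display} {T : measurableType d}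
    (X : T -> H) (phi : H -> R) :
  random_element X -> continuous phi -> measurable_fun setT (fun w => phi (X w)).
Proof.
move=> mX cphi.
suff mphi : measurable_fun [set: g_sigma_algebraType (@open H)]
    (phi : g_sigma_algebraType (@open H) -> R).
  exact: (measurableT_comp mphi mX).
apply: (measurability _ (RGenOpens.measurableE R)).
move=> _ [_ [a [b ->]] <-]; rewrite setTI; apply: sub_sigma_algebra.
exact: open_comp.
Qed.

End hilbert.

(** * Kernel, coordinates and remainder *)

Section kernels.
Context {R : realType}.
Variables (K rho : R -> R).
Hypotheses (HK : kernel_function K) (HA2 : assumption_A2 K).
Hypotheses (mrho : measurable_fun (`]0, +oo[ : set R) rho)
  (rho0 : forall h, 0 < h -> 0 < rho h).

(** [K] and [rho] are only controlled on half-lines; they are extended by [0] to be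
    measurable on the whole line.  The weight is [r * rho r] for [r > 0]. *)
Definition scaled_kernel (h r : R) : R := (K \_ `[0, +oo[) (r / h).
Definition aux_weight (r : R) : R := Num.max r 0 * (rho \_ `]0, +oo[) r.

Lemma scaled_kernelE h r : 0 < h -> 0 <= r -> scaled_kernel h r = K (r / h).
Proof.
by move=> h0 r0; rewrite /scaled_kernel patchE mem_set//= in_itv /= divr_ge0// ltW.
Qed.

Lemma scaled_kernel_ge0 h r : 0 <= scaled_kernel h r.
Proof.
rewrite /scaled_kernel patchE; case: ifPn => // /set_mem; rewrite /= in_itv /= andbT.
by case: HK => _ + _; exact.
Qed.

Lemma cutoff_scaled_kernel h : 0 < h -> cutoff h (scaled_kernel h).
Proof.
move=> h0; case: HA2 => -[B KB] K1 _ _; case: HK => mK K0 _.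
split.
- have mKp : measurable_fun [set: R] (K \_ `[0, +oo[) by exact/(measurable_restrictT _ _).1.
  by apply: (measurableT_comp mKp); exact: measurable_funM.
- exact: scaled_kernel_ge0.
- exists (Num.max B 0) => r; rewrite /scaled_kernel patchE; case: ifPn => [/set_mem|_].
    by rewrite /= in_itv /= andbT => /KB KrB; rewrite le_max KrB.
  by rewrite le_max lexx orbT.
- move=> r hr; rewrite scaled_kernelE//; last by rewrite (le_trans _ (ltW hr))// ltW.
  by apply: K1; rewrite ltr_pdivlMr// mul1r.
Qed.

Lemma aux_weightE r : 0 < r -> aux_weight r = r * rho r.
Proof.
by move=> r0; rewrite /aux_weight max_l ?ltW// patchE mem_set//= in_itv /= r0.
Qed.

Lemma aux_weight_le0 r : r <= 0 -> aux_weight r = 0.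
Proof. by move=> r0; rewrite /aux_weight max_r// mul0r. Qed.

Lemma aux_weight_ge0 r : 0 <= aux_weight r.
Proof.
have [r0|r0] := leP r 0; first by rewrite aux_weight_le0.
by rewrite aux_weightE// mulr_ge0// ltW// rho0.
Qed.

Lemma measurable_aux_weight : measurable_fun [set: R] aux_weight.
Proof.
apply: measurable_funM; first exact: measurable_maxr.
exact/(measurable_restrictT _ _).1.
Qed.

Section small_auxiliary_function.
Hypothesis rhoh : rho h / h @[h --> 0^'+] --> (0:R).

(** Near [0] one has [rho r <= r], hence a weight at most [r ^+ 2]. *)
Lemma aux_weight_small e : 0 < e -> \forall h \near (0:R)^'+,
  forall r, r <= h -> aux_weight r <= e.
Proof.
move=> e0.
have [eta /= eta0 H] := cvgr_lt _ rhoh _ (@ltr01 R).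
have {}H r : 0 < r -> r < eta -> rho r <= r.
  move=> r0 re; have := H r; rewrite /= sub0r normrN gtr0_norm// re => /(_ isT r0).
  by rewrite ltr_pdivrMr// mul1r => /ltW.
near=> h => r rh; have [r0|r0] := leP r 0; first by rewrite aux_weight_le0// ltW.
have heta : h < eta by near: h; exact: nbhs_right_lt.
have h1 : h < 1 by near: h; exact: nbhs_right_lt.
have he : h < e by near: h; exact: nbhs_right_lt.
rewrite aux_weightE//; have := H _ r0 (le_lt_trans rh heta); have := rho0 r0; nra.
Unshelve. all: by end_near. Qed.

Lemma cutoff_weighted_kernel n : \forall h \near (0:R)^'+,
  cutoff h (fun r => scaled_kernel h r * aux_weight r ^+ n).
Proof.
near=> h; have h0 : 0 < h by near: h; exact: nbhs_right_gt.
have [mk k0 [B kB] kh] := cutoff_scaled_kernel h0.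
have small : forall r, r <= h -> aux_weight r <= 1.
  by near: h; exact: aux_weight_small.
split.
- apply: measurable_funM => //; apply: measurable_funX; exact: measurable_aux_weight.
- by move=> r; rewrite mulr_ge0// exprn_ge0// aux_weight_ge0.
- exists B => r; have [rh|hr] := leP r h; last first.
    by rewrite kh// mul0r (le_trans (k0 0)).
  by rewrite -[leRHS]mulr1 ler_pM// ?exprn_ge0 ?exprn_ile1 ?aux_weight_ge0// small.
- by move=> r hr; rewrite kh// mul0r.
Unshelve. all: by end_near. Qed.

End small_auxiliary_function.
End kernels.

Section coordinates.
Context {R : realType} {H : completeNormedModType R}.
Variable dot : {dot H for (idfun : R -> R)}.
Hypothesis Hdot : norm_from dot.
Context {d : measure_display} {T : measurableType d} (P : probability T R).
Variables (X : T -> H) (x0 : H) (e : nat -> H) (f : nat -> R -> R).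
Hypotheses (HX : random_element X) (He : orthonormal_basis dot e)
  (indepX : mutually_independent P (fun p w => dot (X w) (e p)))
  (densX : forall p, has_density_on P [set: R] (fun w => dot (X w) (e p)) (f p)).

Definition coordinate p w := dot (X w - x0) (e p).
Local Notation Y := coordinate.
Definition shifted_density p y := f p (y + dot x0 (e p)).

Let YE p : Y p = fun w => dot (X w) (e p) - dot x0 (e p).
Proof. by apply/funext => w; rewrite /Y dotBl. Qed.

Let preE p (B : set R) : Y p @^-1` B =
  (fun w => dot (X w) (e p)) @^-1` ((fun u => 1 * u + - dot x0 (e p)) @^-1` B).
Proof. by rewrite YE; apply/seteqP; split => w /=; rewrite mul1r. Qed.

Let mshift p (B : set R) : measurable B ->
  measurable ((fun u => 1 * u + - dot x0 (e p)) @^-1` B).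
Proof.
move=> mB; rewrite -[X in measurable X]setTI.
exact: (measurable_affine 1 (- dot x0 (e p)) measurableT mB).
Qed.

Lemma measurable_coordinate p : measurable_fun setT (Y p).
Proof.
rewrite YE; apply: measurable_funB => //.
apply: (measurable_comp_continuous (phi := fun x => dot x (e p)) HX) => x.
have -> : (fun x => dot x (e p)) = dot (e p) by apply/funext => y; exact: dotC.
exact: continuous_dotr.
Qed.

Lemma measurable_norm_centered : measurable_fun setT (fun w => `|X w - x0|).
Proof.
apply: (measurable_comp_continuous (phi := fun x => `|x - x0|) HX) => x.
by apply: cvg_norm; apply: cvgB; [exact: cvg_id|exact: cvg_cst].
Qed.

Lemma independent_coordinates : mutually_independent P Y.
Proof.
move=> s B us mB.
have -> : \bigcap_(p in [set` s]) (Y p @^-1` B p) = \bigcap_(p in [set` s])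
    ((fun w => dot (X w) (e p)) @^-1` ((fun u => 1 * u + - dot x0 (e p)) @^-1` B p)).
  by apply: eq_bigcapr => p _; rewrite preE.
rewrite (indepX us) => [|p]; last exact: mshift.
by apply: eq_bigr => p _; rewrite preE.
Qed.

Lemma density_coordinate p : has_density_on P [set: R] (Y p) (shifted_density p).
Proof.
have [mf f0 Pf] := densX p.
have mfs : measurable_fun [set: measurableTypeR R] (shifted_density p).
  have := measurableT_comp mf (measurable_affine 1 (dot x0 (e p))).
  by apply: eq_measurable_fun => y _; rewrite /= mul1r.
split => //; first by move=> y _; exact: f0.
move=> A mA _; rewrite preE Pf//; last exact: mshift.
rewrite integral_mkcond [RHS]integral_mkcond.
set B := _ @^-1` A; have mB : measurable B by exact: mshift.
have mfB : measurable_fun [set: measurableTypeR R] ((fun y => (f p y)%:E) \_ B).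
  by apply/(measurable_restrictT _ _).1 => //; apply: measurable_funTS; exact/measurable_EFinP.
rewrite (@ge0_integral_affine R 1 (dot x0 (e p)) _ ltr01 mfB); last first.
  by move=> y; rewrite patchE; case: ifP => //; rewrite lee_fin f0.
rewrite mul1e; apply: eq_integral => y _; rewrite !patchE mul1r.
have -> // : (y + dot x0 (e p) \in B) = (y \in A).
have BE : B (y + dot x0 (e p)) = A y by rewrite /B /= mul1r addrK.
by apply/idP/idP => /set_mem Ay; apply/mem_set; move: Ay; rewrite BE.
Qed.

Section remainder.
Variables (i j : nat).
Hypothesis ij : i != j.

(** The sum of the squares of the other coordinates, by [partial_cvg].  This
    closed form makes [norm_remainder] a mere identity. *)
Definition remainder w := `|X w - x0| ^+ 2 - Y i w ^+ 2 - Y j w ^+ 2.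

Let partial (n : nat) w := \sum_(0 <= p < n | (p != i) && (p != j)) Y p w ^+ 2.

(** Parseval, with the two terms of indices [i] and [j] taken out. *)
Let partial_cvg w : partial n w @[n --> \oo] --> remainder w.
Proof.
have lim := @parseval R H dot Hdot e He (X w - x0).
have l2 : (series (fun p => Y p w ^+ 2) n - Y i w ^+ 2 - Y j w ^+ 2) @[n --> \oo] --> remainder w.
  by apply: cvgB; [apply: cvgB; [exact: lim|exact: cvg_cst]|exact: cvg_cst].
apply: (near_eq_lim _ l2); near=> n.
have ni : (i < n)%N by near: n; exact: nbhs_infty_gt.
have nj : (j < n)%N by near: n; exact: nbhs_infty_gt.
have split_sum (F : nat -> R) : \sum_(0 <= p < n) F p =
    F i + (F j + \sum_(0 <= p < n | (p != i) && (p != j)) F p).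
  rewrite (bigD1_seq i)/= ?mem_index_iota ?iota_uniq//; congr (_ + _).
  rewrite big_mkcond (bigD1_seq j)/= ?mem_index_iota ?iota_uniq// eq_sym ij.
  congr (_ + _); rewrite -big_mkcondr; apply: eq_bigl => p; exact: andbC.
by rewrite /partial /series /= split_sum; ring.
Unshelve. all: by end_near. Qed.

Lemma remainder_ge0 w : 0 <= remainder w.
Proof.
apply: (cvgr_to_ge (@partial_cvg w)); apply: nearW => n.
by apply: sumr_ge0 => p _; exact: sqr_ge0.
Qed.

Lemma norm_remainder w :
  Num.sqrt (Y i w ^+ 2 + Y j w ^+ 2 + remainder w) = `|X w - x0|.
Proof.
have -> : Y i w ^+ 2 + Y j w ^+ 2 + remainder w = `|X w - x0| ^+ 2.
  by rewrite /remainder; ring.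
by rewrite sqrtr_sqr normr_id.
Qed.

(** As a limit of sums of squares of other coordinates, the remainder is measurable
    for the sigma-algebra that ignores coordinate [i], and for the one that
    ignores [j]. *)
Lemma cylinder_measurable_remainder k : k \in [:: i; j] ->
  measurable_fun [set: g_sigma_algebraType (cylinders_avoiding Y k)]
    (remainder : g_sigma_algebraType (cylinders_avoiding Y k) -> R).
Proof.
move=> kij; pose TT := g_sigma_algebraType (cylinders_avoiding Y k).
apply: (@measurable_fun_cvg _ TT R setT (partial : nat -> TT -> R) remainder);
  last by move=> w _; exact: partial_cvg.
move=> n; rewrite /partial; under eq_fun do rewrite big_mkcond.
apply: measurable_sum => p.
case: (boolP ((p != i) && (p != j))) => [/andP[pi pj]|_]; last exact: measurable_cst.
apply: measurable_funX; apply: cylinder_measurable_coordinate.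
by move: kij; rewrite !inE => /orP[]/eqP->.
Qed.

End remainder.
End coordinates.

(** * Moments and the local covariance operator *)

Section derivatives.
Context {R : realType}.

Lemma is_derive_shift (f : R -> R) (a : R) : derivable f a 1 ->
  is_derive (0:R) (1:R) (fun y => f (y + a)) (derive1 f a).
Proof.
move=> df; have E : (fun h : R => h^-1 *: (((fun y => f (y + a)) \o shift 0) (h *: 1) -
    f (0 + a))) = (fun h : R => h^-1 *: ((f \o shift a) (h *: 1) - f a)).
  by apply/funext => h /=; rewrite addr0 add0r.
split.
- by rewrite /derivable E.
- by rewrite /derive E derive1E.
Qed.

Lemma continuous_shift (f : R -> R) (a : R) : derivable f a 1 ->
  {for 0, continuous (fun y => f (y + a))}.
Proof.
move=> /is_derive_shift df; apply: differentiable_continuous.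
exact/derivable1_diffP/ex_derive.
Qed.

End derivatives.

Section moments.
Context {R : realType} {H : completeNormedModType R}.
Variable dot : {dot H for (idfun : R -> R)}.
Hypothesis Hdot : norm_from dot.
Context {d : measure_display} {T : measurableType d} (P : probability T R).
Variables (X : T -> H) (x0 : H) (e : nat -> H) (f : nat -> R -> R) (rho K : R -> R).
Hypotheses (HX : random_element X) (HA1 : assumption_A1 P dot X x0 e f rho)
  (HK : kernel_function K) (HA2 : assumption_A2 K).

Local Notation mu := (@lebesgue_measure R).
Local Notation S := (fun w => `|X w - x0|).
Local Notation Y := (coordinate dot X x0 e).
Local Notation a p := (dot x0 (e p)).

Let He : orthonormal_basis dot e. Proof. by case: HA1. Qed.
Let indepY : mutually_independent P Y.
Proof. by apply: independent_coordinates; case: HA1. Qed.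
Let densY p : has_density_on P setT (Y p) (shifted_density dot x0 e f p).
Proof. by apply: density_coordinate; case: HA1. Qed.
Let mY p : measurable_fun setT (Y p). Proof. exact: measurable_coordinate. Qed.
Let mS : measurable_fun setT S. Proof. exact: measurable_norm_centered. Qed.

Let dY p : derivable (f p) (a p) 1.
Proof. by case: HA1 => _ _ _ /(_ p)[/nbhs_singleton + _ _] _. Qed.

Let f_gt0 p : 0 < f p (a p).
Proof.
case: HA1 => _ _ densX /(_ p)[_ _ /(_ 0%N isT) f0] _.
by rewrite lt_def; move: f0; rewrite /= => ->; case: (densX p) => _ + _; exact.
Qed.

Let mrho : measurable_fun (`]0, +oo[ : set R) rho.
Proof. by case: HA1 => _ _ _ _ [r [g [_ _ []]]]. Qed.
Let rho0 h : 0 < h -> 0 < rho h.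
Proof. by case: HA1 => _ _ _ _ [r [g [_ _ [_ + _]]]]; exact. Qed.

Local Notation ker := (scaled_kernel K).
Local Notation q := (aux_weight rho).

(** The moments of the weight [r * rho r] under the kernel: these are [v(h)] and
    [w(h)], see [first_momentE] and [second_momentE]. *)
Definition first_moment h := \int[P]_w (ker h (S w) * q (S w)).
Definition second_moment h := \int[P]_w (ker h (S w) * q (S w) ^+ 2).
Definition cross_moment i j h := \int[P]_w (Y i w * Y j w * ker h (S w)).

Section pair.
Variables (i j : nat).
Hypothesis ij : i != j.
Local Notation W := (remainder dot X x0 e i j).

Let W0 w : 0 <= W w. Proof. exact: remainder_ge0. Qed.
Let mWk k : k \in [:: i; j] ->
  measurable_fun [set: g_sigma_algebraType (cylinders_avoiding Y k)]
    (W : g_sigma_algebraType (cylinders_avoiding Y k) -> R).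
Proof. exact: cylinder_measurable_remainder. Qed.
Let mW : measurable_fun setT W.
Proof. by apply: (@g_sigma_measurable _ _ _ Y mY i); apply: mWk; rewrite inE eqxx. Qed.

Let indep1 C D : measurable C -> measurable D ->
  P (Y i @^-1` C `&` (fun x => (Y j x, W x)) @^-1` D) =
  (P (Y i @^-1` C) * P ((fun x => (Y j x, W x)) @^-1` D))%E.
Proof.
move=> mC mD; apply: (@independent_measurable _ _ _ _ Y mY indepY i) => //.
apply: measurable_fun_pair; last by apply: mWk; rewrite inE eqxx.
by apply: cylinder_measurable_coordinate; rewrite eq_sym.
Qed.

Let indep2 C D : measurable C -> measurable D ->
  P (Y j @^-1` C `&` W @^-1` D) = (P (Y j @^-1` C) * P (W @^-1` D))%E.
Proof.
move=> mC mD; apply: (@independent_measurable _ _ _ _ Y mY indepY j) => //.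
by apply: mWk; rewrite !inE eqxx orbT.
Qed.

Let M0 := radius_density P W.
Let HM0 : half_line_monotone M0.
Proof. exact: half_line_monotone_radius_density. Qed.
Let M1 r := Num.max r 0 * primitive M0 r.
Let HM1 : half_line_monotone M1.
Proof. exact: half_line_monotone_mul_primitive. Qed.
Let M2 r := Num.max r 0 * primitive M1 r.
Let HM2 : half_line_monotone M2.
Proof. exact: half_line_monotone_mul_primitive. Qed.

Let c := f i (a i) * f j (a j).
Let c_gt0 : 0 < c. Proof. exact: mulr_gt0. Qed.

Let cont p : {for 0, continuous (shifted_density dot x0 e f p)}.
Proof. exact: continuous_shift. Qed.

Let SE w : Num.sqrt (Y i w ^+ 2 + Y j w ^+ 2 + W w) = S w.
Proof. exact: norm_remainder. Qed.

Let cE : shifted_density dot x0 e f i 0 * shifted_density dot x0 e f j 0 = c.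
Proof. by rewrite /shifted_density !add0r. Qed.

Let law0 eps : 0 < eps -> exists2 eta, 0 < eta & forall k, cutoff eta k ->
  `|\int[P]_w k (S w) - c * \int[mu]_r (k r * M0 r)| <= eps * \int[mu]_r (k r * M0 r).
Proof.
move=> eps0; have [eta eta0 Heta] := law_radius_comparison (mY i) (mY j) mW W0 indep1 indep2
  (densY i) (densY j) (@cont i) (@cont j) eps0.
exists eta => // k /Heta; rewrite cE.
by under eq_Rintegral do rewrite SE.
Qed.

Let law1 eps : 0 < eps -> exists2 eta, 0 < eta & forall k, cutoff eta k ->
  `|\int[P]_w (Y i w * Y i w * k (S w)) - c * \int[mu]_r (k r * M1 r)|
    <= eps * \int[mu]_r (k r * M1 r).
Proof.
move=> eps0; have [eta eta0 Heta] := square_coordinate_comparison (mY i) (mY j) mW W0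
  indep1 indep2 (densY i) (densY j) (@cont i) (@cont j) eps0.
exists eta => // k /Heta; rewrite cE.
by under eq_Rintegral do rewrite SE expr2.
Qed.

Let law2 eps : 0 < eps -> exists2 eta, 0 < eta & forall k, cutoff eta k ->
  `|\int[P]_w (Y i w * Y j w * k (S w)) -
     derive1 (f i) (a i) * derive1 (f j) (a j) * \int[mu]_r (k r * M2 r)|
    <= eps * \int[mu]_r (k r * M2 r).
Proof.
move=> eps0; have [eta eta0 Heta] := product_coordinates_comparison (mY i) (mY j) mW W0
  indep1 indep2 (densY i) (densY j) (@cont i) (@cont j)
  (is_derive_shift (@dY i)) (is_derive_shift (@dY j)) eps0.
exists eta => // k /Heta.
by under eq_Rintegral do rewrite SE.
Qed.

(** The assumption on the density of the norm is turned here into one on the model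
    density [M0]. *)
Let GM0 : Gamma_mono M0 rho.
Proof.
case: HA1 => _ _ _ _ [r [g [r0 dg GV]]].
have S0 w : 0 <= S w by [].
have [Z gM] := density_ae_equivalent mS S0 r0 dg HM0 c_gt0 law0.
have g0 x : x < r -> 0 <= g x.
  by move=> xr; case: dg => _ + _; apply; rewrite /= in_itv.
exact: (Gamma_mono_transfer GV HM0 c_gt0 r0 g0 gM).
Qed.

Let rhoh : rho h / h @[h --> 0^'+] --> (0:R).
Proof. by case: GM0. Qed.

Let lim0 : primitive M0 h / (rho h * M0 h) @[h --> 0^'+] --> (1:R).
Proof. exact: (Gamma_mono_primitives HM0 GM0).1. Qed.
Let GM1 : Gamma_mono M1 rho.
Proof. exact: (Gamma_mono_primitives HM0 GM0).2. Qed.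
Let lim1 : primitive M1 h / (rho h * M1 h) @[h --> 0^'+] --> (1:R).
Proof. exact: (Gamma_mono_primitives HM1 GM1).1. Qed.
Let GM2 : Gamma_mono M2 rho.
Proof. exact: (Gamma_mono_primitives HM1 GM1).2. Qed.

Let M0pos r : 0 < r -> 0 < M0 r. Proof. by case: GM0 => _ + _ _ _; exact. Qed.
Let M1pos r : 0 < r -> 0 < M1 r. Proof. by case: GM1 => _ + _ _ _; exact. Qed.
Let M2pos r : 0 < r -> 0 < M2 r. Proof. by case: GM2 => _ + _ _ _; exact. Qed.

Let prim_pos (M : R -> R) : half_line_monotone M -> (forall r, 0 < r -> 0 < M r) ->
  forall r, 0 < r -> 0 < primitive M r.
Proof. by move=> HM Mpos r; exact: (primitive_gt0 HM Mpos). Qed.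

(** [M1 r = r * primitive M0 r] and [primitive M0 ~ rho * M0]. *)
Let ratio1 : q r * M0 r / M1 r @[r --> 0^'+] --> (1:R).
Proof.
have l : (primitive M0 h / (rho h * M0 h))^-1 @[h --> 0^'+] --> (1:R)^-1.
  exact: (cvgV (oner_neq0 R) lim0).
rewrite invr1 in l.
apply: (near_eq_lim _ l); near=> r.
have r0 : 0 < r by near: r; exact: near0_gt0.
have p0 := prim_pos HM0 M0pos r0; have m0 := M0pos r0; have rr := rho0 r0.
rewrite /= aux_weightE// /M1 max_l ?ltW//.
by field; rewrite !gt_eqF.
Unshelve. all: by end_near. Qed.

Let ratio2 : q r ^+ 2 * M0 r / M2 r @[r --> 0^'+] --> (1:R).
Proof.
have l : (primitive M0 r / (rho r * M0 r))^-1 * (primitive M1 r / (rho r * M1 r))^-1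
    @[r --> 0^'+] --> (1:R)^-1 * (1:R)^-1.
  by apply: cvgM; [exact: (cvgV (oner_neq0 R) lim0)|exact: (cvgV (oner_neq0 R) lim1)].
rewrite invr1 mulr1 in l; apply: (near_eq_lim _ l); near=> r.
have r0 : 0 < r by near: r; exact: near0_gt0.
have p0 := prim_pos HM0 M0pos r0; have m0 := M0pos r0; have rr := rho0 r0.
have p1 := prim_pos HM1 M1pos r0.
have M1E : M1 r = r * primitive M0 r by rewrite /M1 max_l// ltW.
have M2E : M2 r = r * primitive M1 r by rewrite /M2 max_l// ltW.
rewrite aux_weightE// M1E M2E.
by field; rewrite !gt_eqF.
Unshelve. all: by end_near. Qed.

Let cut0 : \forall h \near (0:R)^'+, cutoff h (ker h).
Proof. by apply: filterS near0_gt0 => h; exact: cutoff_scaled_kernel. Qed.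

Let cut1 : \forall h \near (0:R)^'+, cutoff h (fun r => ker h r * q r).
Proof.
have := cutoff_weighted_kernel HK HA2 mrho rho0 rhoh 1.
by apply: filterS => h; under eq_fun do rewrite expr1.
Qed.

Let cut2 : \forall h \near (0:R)^'+, cutoff h (fun r => ker h r * q r ^+ 2).
Proof. exact: cutoff_weighted_kernel. Qed.

(** Both sides are compared with the integral of the kernel against [M1]: the left
    one directly, the right one because the weight [r * rho r] turns [M0] into
    [M1]. *)
Lemma square_moment_equiv : dominated_equiv 1 (cross_moment i i) first_moment.
Proof.
have A := dominated_equiv_cutoff (Phi := fun k => \int[P]_w (Y i w * Y i w * k (S w))) law1 cut0.
have V := dominated_equiv_cutoff (Phi := fun k => \int[P]_w k (S w)) law0 cut1.
have B := dominated_equiv_weight (fun _ _ => erefl) cut0 cut1 HM0 HM1 M1pos ratio1.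
have := dominated_equiv_trans V B; rewrite mulr1 => V'.
by have := dominated_equiv_ratio c_gt0 A V'; rewrite divff ?gt_eqF.
Qed.

(** As for [square_moment_equiv], with the squared weight, which turns [M0] into
    [M2]; the constants are now the derivatives of the densities for the left side
    and the densities themselves for the right side. *)
Lemma cross_moment_equiv : dominated_equiv
  (derive1 (f i) (a i) / f i (a i) * (derive1 (f j) (a j) / f j (a j)))
  (cross_moment i j) second_moment.
Proof.
have A := dominated_equiv_cutoff (Phi := fun k => \int[P]_w (Y i w * Y j w * k (S w))) law2 cut0.
have V := dominated_equiv_cutoff (Phi := fun k => \int[P]_w k (S w)) law0 cut2.
have B := dominated_equiv_weight (q := fun r => q r ^+ 2) (fun _ _ => erefl)
  cut0 cut2 HM0 HM2 M2pos ratio2.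
have := dominated_equiv_trans V B; rewrite mulr1 => V'.
have := dominated_equiv_ratio c_gt0 A V'.
by rewrite /c invfM mulrACA.
Qed.

Let cutoff_P_integrable eta k : cutoff eta k -> P.-integrable setT (fun w => (k (S w))%:E).
Proof.
move=> [mk k0 [B kB] _].
apply: (@le_integrable _ _ _ P _ measurableT _ (EFin \o cst B)).
- by apply/measurable_EFinP; exact: (measurableT_comp mk mS).
- move=> w _ /=; rewrite lee_fin ger0_norm// (le_trans (kB _))// ler_norm.
  by [].
- exact: finite_measure_integrable_cst.
Qed.

(** On the support of the kernel the weight [r * rho r] is at most [eps]. *)
Lemma second_moment_negligible eps : 0 < eps ->
  \forall h \near (0:R)^'+, second_moment h <= eps * first_moment h.
Proof.
move=> eps0; near=> h.
have c1 : cutoff h (fun r => ker h r * q r) by near: h.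
have c2 : cutoff h (fun r => ker h r * q r ^+ 2) by near: h.
have small : forall r, r <= h -> q r <= eps by near: h; exact: aux_weight_small.
have [_ k0 _ kh] := c1; have i1 := cutoff_P_integrable c1.
rewrite /second_moment /first_moment -RintegralZl//.
apply: le_Rintegral => //.
- exact: (cutoff_P_integrable c2).
- exact: (@integrableZl _ _ _ P setT measurableT eps _ i1).
move=> w _; rewrite expr2 mulrA mulrC.
have [rh|hr] := leP (S w) h; last by rewrite kh// !mulr0.
by rewrite ler_wpM2r// ?k0// small.
Unshelve. all: by end_near. Qed.

End pair.

Let ZE h w t : K (`|X w - x0| / h) *: tensor dot (X w - x0) (X w - x0) t =
  (K (`|X w - x0| / h) * dot (X w - x0) t) *: (X w - x0).
Proof. by rewrite /tensor scalerA. Qed.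

Lemma kernel_bound : exists2 B, 0 <= B & forall s, 0 <= s -> 0 <= K s <= B.
Proof.
case: HK => _ K0 _; case: HA2 => -[B KB] _ _ _; exists B.
  by rewrite (le_trans (K0 0 (lexx _)))// KB.
by move=> s s0; rewrite K0//= KB.
Qed.

Lemma first_momentE h : 0 < h -> v_K P K rho X x0 h = first_moment h.
Proof.
move=> h0; rewrite /v_K unlock /first_moment /Rintegral; congr fine.
apply: eq_integral => w _; congr EFin; rewrite scaled_kernelE// -mulrA; congr (_ * _).
have [s0|s0] := leP `|X w - x0| 0; last by rewrite aux_weightE.
have sE : `|X w - x0| = 0 by apply/le_anti; rewrite s0 normr_ge0.
by rewrite aux_weight_le0// sE mul0r.
Qed.

Lemma second_momentE h : 0 < h -> w_K P K rho X x0 h = second_moment h.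
Proof.
move=> h0; rewrite /w_K unlock /second_moment /Rintegral; congr fine.
apply: eq_integral => w _; congr EFin; rewrite scaled_kernelE// -mulrA -exprMn; congr (_ * _ ^+ 2).
have [s0|s0] := leP `|X w - x0| 0; last by rewrite aux_weightE.
have sE : `|X w - x0| = 0 by apply/le_anti; rewrite s0 normr_ge0.
by rewrite aux_weight_le0// sE mul0r.
Qed.

Lemma first_moment_ge0 h : 0 <= first_moment h.
Proof.
apply: Rintegral_ge0 => w _; rewrite mulr_ge0 ?aux_weight_ge0//.
exact: scaled_kernel_ge0.
Qed.

Lemma second_moment_ge0 h : 0 <= second_moment h.
Proof.
apply: Rintegral_ge0 => w _; rewrite mulr_ge0 ?exprn_ge0 ?aux_weight_ge0//.
exact: scaled_kernel_ge0.
Qed.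

Section operator.
Variables (B h : R) (t : H).
Hypotheses (B0 : 0 <= B) (KB : forall s, 0 <= s -> 0 <= K s <= B) (h0 : 0 < h).

Let Z w := K (`|X w - x0| / h) *: tensor dot (X w - x0) (X w - x0) t.

Let mdot u : measurable_fun setT (fun w => dot u (X w - x0)).
Proof.
apply: (measurable_comp_continuous (phi := fun x => dot u (x - x0)) HX) => x.
apply: (@continuous_comp _ _ _ (fun x => x - x0) (dot u)).
  by apply: cvgB; [exact: cvg_id|exact: cvg_cst].
exact: continuous_dotr.
Qed.

Let mk : measurable_fun setT (fun w => K (`|X w - x0| / h)).
Proof.
have [mker _ _ _] := cutoff_scaled_kernel HK HA2 h0.
have := measurableT_comp mker mS; apply: eq_measurable_fun => w _ /=.
exact: scaled_kernelE.
Qed.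

Let mZ u : measurable_fun setT (fun w => dot u (Z w)).
Proof.
have -> : (fun w => dot u (Z w)) = (fun w =>
    K (`|X w - x0| / h) * dot t (X w - x0) * dot u (X w - x0)).
  by apply/funext => w; rewrite /Z ZE dotZr (dotC _ (X w - x0) t).
by apply: measurable_funM => //; exact: measurable_funM.
Qed.

Let normZ w : `|Z w| = K (`|X w - x0| / h) * `|dot t (X w - x0)| * `|X w - x0|.
Proof.
rewrite /Z ZE normrZ normrM ger0_norm; first by rewrite (dotC _ (X w - x0) t).
by have /andP[] := KB (divr_ge0 (normr_ge0 (X w - x0)) (ltW h0)).
Qed.

Let mnZ : measurable_fun setT (fun w => `|Z w|).
Proof.
under eq_fun do rewrite normZ.
apply: measurable_funM => //; apply: measurable_funM => //.
exact: (measurableT_comp (@normr_measurable R setT) (mdot t)).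
Qed.

(** On the support of the kernel, [`|X w - x0| <= h]. *)
Let Zbound w : `|Z w| <= B * h ^+ 2 * `|t|.
Proof.
rewrite normZ; set s := `|X w - x0|.
have sh0 : 0 <= s / h by rewrite /s divr_ge0// ltW.
have /andP[K0 KsB] := KB sh0.
have [sh|hs] := leP s h; last first.
  have -> : K (s / h) = 0 by case: HA2 => _ + _ _; apply; rewrite ltr_pdivlMr// mul1r.
  by rewrite !mul0r mulr_ge0// mulr_ge0// sqr_ge0.
have s0 : 0 <= s by rewrite /s.
have ds : `|dot t (X w - x0)| <= `|t| * s by exact: dot_cauchy_schwarz.
have -> : B * h ^+ 2 * `|t| = B * (`|t| * h) * h by ring.
apply: ler_pM => //; first exact: mulr_ge0.
by apply: ler_pM => //; apply: (le_trans ds); rewrite ler_wpM2l.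
Qed.

Lemma norm_Gamma_K_le : `|Gamma_K P dot K X x0 h t| <= B * h ^+ 2 * `|t|.
Proof. have := norm_mean_le Hdot He P mZ mnZ Zbound. exact. Qed.

Lemma dot_Gamma_K u : dot u (Gamma_K P dot K X x0 h t) =
  \int[P]_w (K (`|X w - x0| / h) * dot t (X w - x0) * dot u (X w - x0)).
Proof.
have := dot_mean Hdot He P mZ mnZ Zbound u; rewrite /Gamma_K /op_mean => ->.
by apply: eq_Rintegral => w _; rewrite /Z ZE dotZr (dotC _ (X w - x0) t).
Qed.

End operator.

Lemma Gamma_K_entry i j h : 0 < h ->
  dot (Gamma_K P dot K X x0 h (e i)) (e j) = cross_moment i j h.
Proof.
move=> h0; have [B B0 KB] := kernel_bound.
rewrite dotC (dot_Gamma_K _ B0 KB h0); apply: eq_Rintegral => w _.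
rewrite scaled_kernelE// /coordinate !(dotC _ (X w - x0)).
by rewrite -mulrA mulrC.
Qed.

Lemma opnorm_Gamma_K_cvg0 : opnorm (Gamma_K P dot K X x0 h) @[h --> 0^'+] --> 0%E.
Proof.
have [B B0 KB] := kernel_bound.
apply: (@squeeze_cvge _ _ _ _ (fun=> 0%E) _ (fun h => (B * h ^+ 2)%:E)).
- near=> h; have h0 : 0 < h by near: h; exact: near0_gt0.
  apply/andP; split.
    apply: (@le_trans _ _ (`|Gamma_K P dot K X x0 h 0|%:E)); first by rewrite lee_fin.
    by apply: ereal_sup_ubound; exists 0 => //=; rewrite normr0.
  apply: ge_ereal_sup => _ [t /= t1 <-]; rewrite lee_fin.
  apply: (le_trans (norm_Gamma_K_le t B0 KB h0)).
  by rewrite ler_piMr// mulr_ge0// sqr_ge0.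
- exact: cvg_cst.
- apply: cvg_EFin; first exact: nearW.
  apply: cvg_at_right_filter; rewrite -[X in _ --> X](mulr0 B).
  apply: cvgMr; rewrite -[X in _ --> X](expr0n R 2); exact: exprn_continuous.
Unshelve. all: by end_near. Qed.

(** On the diagonal the term in [w] is negligible before [v], so the right side is
    at least [v / 2] near [0]; off the diagonal it is [w] times a nonzero
    constant.  In both cases an error relative to [v], respectively [w], is an
    error relative to the right side. *)
Lemma entry_equiv i j :
  (fun h : R => dot (Gamma_K P dot K X x0 h (e i)) (e j)) ~_(0^'+)
  (fun h : R => v_K P K rho X x0 h * (i == j)%:R
                + w_K P K rho X x0 h * R_coef dot e f x0 i j).
Proof.
apply/eqaddoP => eps eps0.
have [eqij|ij] := eqVneq i j.
  rewrite -{}eqij; set r := R_coef _ _ _ _ _ _.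
  (* A plane needs a second coordinate; any other one than [i] does. *)
  have ii : i != i.+1 by rewrite neq_ltn ltnSn.
  (* With [m] this minimum, the error is at most [2 * m * v] and the right side
     at least [(1 - m) * v]: [m <= 1 / 4] makes the latter at least [v / 2], and
     [m <= eps / 4] makes the former at most [eps * (v / 2)]. *)
  have e4 : 0 < Num.min (1 / 4) (eps / 4) by rewrite lt_min !divr_gt0.
  have er : 0 < Num.min (1 / 4) (eps / 4) / (`|r| + 1).
    by rewrite divr_gt0// ltr_wpDl.
  have main := square_moment_equiv ii e4.
  have negl := second_moment_negligible ii er.
  near=> h; have h0 : 0 < h by near: h; exact: near0_gt0.
  rewrite !fctE /= Gamma_K_entry// first_momentE// second_momentE// mulr1.
  have Ev : `|cross_moment i i h - 1 * first_moment h| <=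
    Num.min (1 / 4) (eps / 4) * first_moment h by near: h.
  have wv : second_moment h <=
    Num.min (1 / 4) (eps / 4) / (`|r| + 1) * first_moment h by near: h.
  have v0 := first_moment_ge0 h; have w0 := second_moment_ge0 h.
  move: Ev wv v0 w0.
  set v := first_moment h; set w := second_moment h; set E := cross_moment i i h.
  move=> Ev wv v0 w0.
  have r1 : 0 < `|r| + 1 by rewrite ltr_wpDl.
  have wr : `|w * r| <= Num.min (1 / 4) (eps / 4) * v.
    rewrite normrM (ger0_norm w0); apply: (@le_trans _ _ (w * (`|r| + 1))).
      by rewrite ler_wpM2l// lerDl.
    by rewrite -ler_pdivlMr// mulrAC.
  move: Ev wr; set m := Num.min _ _ => Ev wr.
  have m1 : m <= 1 / 4 by rewrite ge_min lexx.
  have m2 : m <= eps / 4 by rewrite ge_min lexx orbT.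
  have low : v / 2 <= `|v + w * r|.
    have := ler_norm (v + w * r); move: wr; rewrite ler_norml => /andP[]; nra.
  have up : `|E - (v + w * r)| <= 2 * m * v.
    have -> : E - (v + w * r) = (E - 1 * v) - w * r by ring.
    by have := ler_normB (E - 1 * v) (w * r); lra.
  nra.
have Rij : R_coef dot e f x0 i j =
    derive1 (f i) (a i) / f i (a i) * (derive1 (f j) (a j) / f j (a j)).
  by rewrite /R_coef (negbTE ij).
have Dn0 p : derive1 (f p) (a p) != 0.
  by case: HA1 => _ _ _ /(_ p)[_ _ /(_ 1%N isT)] + _.
have r0 : R_coef dot e f x0 i j != 0.
  by rewrite Rij; apply: mulf_neq0; apply: mulf_neq0 => //; rewrite invr_eq0 gt_eqF.
have main := cross_moment_equiv ij; rewrite -Rij in main.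
move: r0 main; set r := R_coef _ _ _ _ _ _ => r0 main.
have e1 : 0 < eps * `|r| by rewrite mulr_gt0// normr_gt0.
near=> h; have h0 : 0 < h by near: h; exact: near0_gt0.
rewrite !fctE /= Gamma_K_entry// second_momentE// mulr0 add0r.
have w0 : 0 <= second_moment h by exact: second_moment_ge0.
rewrite normrM (ger0_norm w0) [_ * `|r|]mulrC mulrA [second_moment h * r]mulrC.
by near: h; exact: main.
Unshelve. all: by end_near. Qed.

End moments.

Theorem theorem1 (R : realType) (H : completeNormedModType R)
  (dot : {dot H for (idfun : R -> R)})
  (Hdot : norm_from dot) (Hsep : separable H) (Hinf : infinite_dimensional H)
  (d : measure_display) (T : measurableType d) (P : probability T R)
  (X : T -> H) (HX : random_element X) (HX0 : has_mean P dot X 0)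
  (x0 : H) (e : nat -> H) (f : nat -> R -> R) (rho : R -> R)
  (HA1 : assumption_A1 P dot X x0 e f rho)
  (K : R -> R) (HK : kernel_function K) (HA2 : assumption_A2 K) :
  [/\ opnorm (Gamma_K P dot K X x0 h) @[h --> 0^'+] --> 0%E,
      forall h : R, 0 < h ->
        0 <= v_K P K rho X x0 h /\ 0 <= w_K P K rho X x0 h &
      forall i j : nat,
        (fun h : R => dot (Gamma_K P dot K X x0 h (e i)) (e j)) ~_(0^'+)
        (fun h : R => v_K P K rho X x0 h * (i == j)%:R
                      + w_K P K rho X x0 h * R_coef dot e f x0 i j)].
Proof.
split.
- exact: (opnorm_Gamma_K_cvg0 Hdot HX HA1 HK HA2).
- move=> h h0; rewrite (first_momentE P X x0 rho K h0) (second_momentE P X x0 rho K h0).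
  by split; [exact: (first_moment_ge0 HA1 HK)|exact: (second_moment_ge0 HA1 HK)].
- by move=> i j; exact: (entry_equiv Hdot HX HA1 HK HA2).
Qed.
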